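(* Let $(\lambda_t)$ be the intensity process of $(N_t)$, and let $\psi:\mathbb{R}\to\mathbb{R}$ and $\phi:\mathbb{R}\to\mathbb{R}$ be continuous bounded functions. 1. The functional $\mathbb{E}\big[e^{-\int_t^1\psi(s)\mathrm{d}s}\phi(X)\,\big|\,\mathcal{F}_t\big]$, hence $$v(\hat\xi_t,\eta_t,t):=\mathbb{E}\left[e^{-\int_t^1\psi(s)\mathrm{d}s}\phi(X)\,\Big|\,\hat\xi_t,\eta_t,X\mathbf{1}_{\{t=1\}}\right],$$ satisfies the partial differential equation $$\frac{\partial v(\hat{\xi}_t, \eta_t,t)}{\partial t} + \mu(\hat{\xi}_t, \eta_t,t)\frac{\partial v(\hat{\xi}_t, \eta_t,t)}{\partial \hat{\xi}_t} + \hat{\sigma}_t^2\frac{\partial^2 v(\hat{\xi}_t, \eta_t,t)}{2\,\partial \hat{\xi}_t^2} - \psi(t)v(\hat{\xi}_t, \eta_t,t) + \big(v(\hat{\xi}_t, \eta_t,t) - v(\hat{\xi}_{t-}, \eta_{t-},t-)\big)\lambda_t = 0,$$ with the boundary condition $v(\hat\xi_1,\eta_1,1)=\phi(X)$. 2. Choose the random point field $\zeta$ such that $\tilde J^{(i)}_t=1$ implies $\tilde J^{(i)}_u=1$ for $u\ge t$, and let there be at least one active source of information at $t=0$ (i.e. $\mathcal{J}_0\neq\emptyset$). Then $$v(\hat\xi_t,t)=\mathbb{E}\left[\exp\left(-\int_t^1\psi(s)\,\mathrm{d}s\right)\phi(X)\,\bigg|\,\hat\xi_t\right]$$ satisfies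 the same partial differential equation as in part 1 (with $v(\hat\xi_t,t)$ in place of $v(\hat\xi_t,\eta_t,t)$), with the boundary condition $v(\hat\xi_1,1)=\phi(X)$.
   Context: Let $(\Omega,\mathcal{G},(\mathcal{G}_t)_{t\ge0},\mathbb{P})$ be a filtered probability space; all filtrations are right-continuous and complete. $X\in\mathcal{L}^2(\Omega,\mathcal{G},\mathbb{P})$ has law $\nu$ and state space $(\mathbb{X},\mathcal{B}(\mathbb{X}))$, $\mathbb{X}\subseteq\mathbb{R}$. For $t\in[0,1]$ and $i=1,\ldots,n$, $\xi^{(i)}_t=tX+\sigma_i\beta^{(i)}_t$, with $\sigma_i>0$ and $(\beta^{(i)}_t)_{0\le t\le1}$ standard Brownian bridges (centred Gaussian, covariance $\min(s,t)-st$); $X,\beta^{(1)},\ldots,\beta^{(n)}$ are mutually independent. Modulation: $(\boldsymbol{\tilde J}_t)_{t\in[0,1]}$ is a c\`adl\`ag $\{0,1\}^n$-valued jump process, independent of $(\boldsymbol{\xi}_t)$ (and $X$), whose $i$th coordinate switches at finitely many times generated by a random point field $\zeta$ on $[0,1]^n$. With $\otimes$ the coordinatewise product, $\mathcal{F}_t=\sigma\big((\boldsymbol{\tilde J}_u\otimes\boldsymbol{\xi}_u)_{u\le t},(\boldsymbol{\tilde J}_u)_{u\le t},X\mathbf{1}_{\{t=1\}}\big)$. Let $\mathcal{J}_t=\{i:\tilde J^{(i)}_t=1\}$, $\mathcal{J}^\complement_t=\{i:\tilde J^{(i)}_t=0\}$, and $\tau^{(i)}_t=0\vee\sup\{u\in[0,t]:\tilde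 J^{(i)}_u=1\}$ ($\sup\emptyset=-\infty$). Effective information: if $\mathcal{J}_t\neq\emptyset$, $\hat\sigma_t=\big(\sum_{i\in\mathcal{J}_t}\sigma_i^{-2}\big)^{-1/2}$ and $\hat\xi_t=\hat\sigma_t^2\sum_{i\in\mathcal{J}_t}\sigma_i^{-2}\xi^{(i)}_t$; if $\mathcal{J}_t=\emptyset$, $\hat\xi_t=0$, $\hat\sigma_t=0$. Complementary information (function-valued): $\eta_t(x)=\prod_{i\in\mathcal{J}^\complement_t}h\big(x,\xi^{(i)}(\tau^{(i)}_t),\tau^{(i)}_t,\sigma_i\big)$, with $\eta_t=1$ if $\mathcal{J}^\complement_t=\emptyset$, where $h(x,y,t,\sigma)=\exp\{(xy-tx^2/2)/(\sigma^2(1-t))\}$ and $\xi^{(i)}(u)=\xi^{(i)}_u$. Conditioning on $\hat\xi_t$ and $\eta_t$ is understood with the current state $\boldsymbol{\tilde J}_t$ known; partial derivatives in $\hat\xi_t$ and $t$ are those of $v$ as a function of these arguments with $\eta_t$ and the state held fixed. $N_t=\sum_{s\le t}\mathbf{1}\{\mathcal{J}_s\setminus\mathcal{J}_{s-}\neq\emptyset\}$; its intensity $(\lambda_t)$ is the process such that $N_t-\int_0^t\lambda_s\,\mathrm{d}s$ is an $(\mathcal{F}_t)$-martingale. For $t<1$, $\mu(\hat\xi_t,\eta_t,t)=(\mathbb{E}[X\,|\,\hat\xi_t,\eta_t]-\hat\xi_t)/(1-t)$ when $\mathcal{J}_t\neq\emptyset$ and $\mu(\hat\xi_t,\eta_t,t)=0$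 otherwise. *)

(* Defs.v *)
From HB Require Import structures.
From mathcomp Require Import all_boot all_order all_algebra.
From mathcomp Require Import all_classical all_reals all_analysis.

Set Implicit Arguments.
Unset Strict Implicit.
Unset Printing Implicit Defensive.

Import Order.TTheory GRing.Theory Num.Theory.
Import numFieldNormedType.Exports.

Local Open Scope classical_set_scope.
Local Open Scope ring_scope.

Section Probability.
Context (R : realType) (d : measure_display) (Omega : measurableType d).
Variable P : probability Omega R.

Definition sigma_gen (fs : set (Omega -> R)) : set (set Omega) :=
  <<s [set A | exists2 f, fs f & exists2 B, measurable B & A = f @^-1` B] >>.

Definition measurable_wrt (F : set (set Omega)) (f : Omega -> R) : Prop :=
  forall B : set R, measurable B -> F (f @^-1` B).

Definition sub_sigma_algebra (F : set (set Omega)) : Prop :=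
  sigma_algebra [set: Omega] F /\ F `<=` measurable.

(* The negligible sets are the subsets of P-null events, so this makes the
   whole space (Omega, P) complete. *)
Definition usual_filtration (G : R -> set (set Omega)) : Prop :=
  [/\ forall t, 0 <= t -> sub_sigma_algebra (G t),
      forall s t, 0 <= s -> s <= t -> G s `<=` G t,
      forall t, 0 <= t -> \bigcap_(s in [set s | t < s]) G s = G t
    & forall t, 0 <= t -> P.-negligible `<=` G t].

(* The right-continuous completed version of a raw filtration on [0, 1]; at
   t = 1 the intersection has the single index s = 1. *)
Definition augmentation (F : R -> set (set Omega)) (t : R) : set (set Omega) :=
  \bigcap_(s in [set s | (t < s <= 1) \/ s = 1])
     <<s F s `|` P.-negligible >>.

Definition is_cond_exp (F : set (set Omega)) (Y Z : Omega -> R) : Prop :=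
  [/\ P.-integrable setT (EFin \o Y),
      measurable_wrt F Z,
      P.-integrable setT (EFin \o Z)
    & forall A, F A ->
        (\int[P]_(w in A) (Z w)%:E = \int[P]_(w in A) (Y w)%:E)%E].

Definition martingale (F : R -> set (set Omega)) (M : R -> Omega -> R) : Prop :=
  forall s t, 0 <= s -> s <= t -> t <= 1 -> is_cond_exp (F s) (M t) (M s).

Definition mutually_independent (I : finType) (F : I -> set (set Omega)) :
    Prop :=
  forall (S : {set I}) (A : I -> set Omega),
    (forall i, i \in S -> F i (A i)) ->
    P (\bigcap_(i in [set i | i \in S]) A i) = (\prod_(i in S) P (A i))%E.

Definition independent (F1 F2 : set (set Omega)) : Prop :=
  forall A B, F1 A -> F2 B -> P (A `&` B) = (P A * P B)%E.

(* [normal_prob m 0] is not the Dirac mass at m in the library, so degenerate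
   Gaussian laws are singled out. *)
Definition gaussian_law (m s : R) (B : set R) : \bar R :=
  if s == 0 then (\d_m B : \bar R) else normal_prob m s B.

Definition gaussian (Y : Omega -> R) : Prop :=
  exists m s : R, forall B, measurable B -> P (Y @^-1` B) = gaussian_law m s B.

Definition brownian_bridge (b : R -> {RV P >-> R}) : Prop :=
  [/\ forall (k : nat) (t c : 'I_k -> R), (forall j, 0 <= t j <= 1) ->
        gaussian (fun w => \sum_(j < k) c j * b (t j) w),
      forall t, 0 <= t <= 1 -> ('E_P[b t] = 0)%E,
      forall s t, 0 <= s <= 1 -> 0 <= t <= 1 ->
        covariance P (b s) (b t) = (Num.min s t - s * t)%:E
    & {ae P, forall w, {within `[0, 1], continuous (fun t => b t w)}}].

End Probability.

Section Model.
Context (R : realType) (d : measure_display) (Omega : measurableType d).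
Variables (P : probability Omega R) (n : nat).
Variables (X : Omega -> R) (sigma : 'I_n -> R) (beta : 'I_n -> R -> Omega -> R).
(* The modulating process: [J i t w] is the i-th coordinate at time t. *)
Variable J : 'I_n -> R -> Omega -> bool.

Definition xi (i : 'I_n) (t : R) (w : Omega) : R :=
  t * X w + sigma i * beta i t w.

(* A finite random configuration of points of [0, 1]^n. *)
Definition random_point_field (zeta : Omega -> seq {ffun 'I_n -> R}) : Prop :=
  (forall w p, p \in zeta w -> forall i, 0 <= p i <= 1) /\
  (forall a b : 'I_n -> R,
     measurable_fun setT
       (fun w => count (fun p : {ffun 'I_n -> R} =>
                          [forall i, a i <= p i <= b i]) (zeta w))).

(* The i-th coordinate of J can only switch at i-th coordinates of points of
   zeta, and takes its new value at the switching time.  As zeta is finite, this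
   makes the paths cadlag with finitely many jumps. *)
Definition switches_at (zeta : Omega -> seq {ffun 'I_n -> R}) : Prop :=
  forall w i s t, 0 <= s -> s <= t -> t <= 1 ->
    (forall p, p \in zeta w -> ~~ (s < p i <= t)) -> J i t w = J i s w.

Definition active (t : R) (w : Omega) : {set 'I_n} := [set i | J i t w]%SET.

Definition active_left (t : R) (w : Omega) : {set 'I_n} :=
  [set i | `[< \forall u \near t^'-, J i u w >]]%SET.

Definition modulated_filtration_raw (t : R) : set (set Omega) :=
  sigma_gen [set f | (exists i u, 0 <= u <= t /\
                        f = (fun w => (J i u w)%:R * xi i u w))
                  \/ (exists i u, 0 <= u <= t /\ f = (fun w => (J i u w)%:R))
                  \/ f = (fun w => X w * (t == 1)%:R)].

Definition modulated_filtration : R -> set (set Omega) :=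
  augmentation P modulated_filtration_raw.

(* The real-valued [sup] of the empty set is 0, which agrees here with
   max(0, -oo). *)
Definition last_active (i : 'I_n) (t : R) (w : Omega) : R :=
  Num.max 0 (sup [set u | 0 <= u <= t /\ J i u w]).

Definition sigma_hat (t : R) (w : Omega) : R :=
  if active t w != finset.set0
  then (Num.sqrt (\sum_(i in active t w) (sigma i) ^- 2))^-1 else 0.

Definition xi_hat (t : R) (w : Omega) : R :=
  if active t w != finset.set0
  then sigma_hat t w ^+ 2 * \sum_(i in active t w) (sigma i) ^- 2 * xi i t w
  else 0.

Definition hker (x y t s : R) : R :=
  expR ((x * y - t * x ^+ 2 / 2) / (s ^+ 2 * (1 - t))).

Definition eta_fun (t : R) (w : Omega) : R -> R := fun x =>
  \prod_(i in (~: active t w)%SET)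
     hker x (xi i (last_active i t w) w) (last_active i t w) (sigma i).

Definition terminal_info (t : R) (w : Omega) : R := X w * (t == 1)%:R.

Definition gen_state (t : R) : set (Omega -> R) :=
  [set f | exists i, f = (fun w => (J i t w)%:R)].
Definition gen_eta (t : R) : set (Omega -> R) :=
  [set f | exists x, f = (fun w => eta_fun t w x)].

(* Conditioning on the effective information always includes the state J_t;
   eta_t is a random element of R -> R with the product sigma-algebra. *)
Definition sigma_xi (t : R) : set (set Omega) :=
  sigma_gen (gen_state t `|` [set xi_hat t]).
Definition sigma_xi_eta (t : R) : set (set Omega) :=
  sigma_gen (gen_state t `|` [set xi_hat t] `|` gen_eta t).
Definition sigma_xi_eta_X (t : R) : set (set Omega) :=
  sigma_gen (gen_state t `|` [set xi_hat t] `|` gen_eta t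
             `|` [set terminal_info t]).

(* The sum has finite support; the activation at s = 0 is not a jump. *)
Definition activation_count (t : R) (w : Omega) : R :=
  \sum_(s \in `]0, t])
     ((active s w :\: active_left s w != finset.set0)%:R : R).

Definition activation_intensity (lambda : R -> Omega -> R) : Prop :=
  [/\ measurable_fun [set p : measurableTypeR R * Omega | 0 <= (p.1 : R) <= 1]
        (fun p : measurableTypeR R * Omega => lambda p.1 p.2),
      forall t, 0 <= t <= 1 ->
        measurable_wrt (modulated_filtration t) (lambda t),
      {ae P, forall w, lebesgue_measure.-integrable `[0, 1]
                         (fun s => (lambda s w)%:E)}
    & martingale P modulated_filtration
        (fun t w => activation_count t w
                    - \int[lebesgue_measure]_(s in `[0, t]) lambda s w)].

(* The drift mu, from a version [m] of E[X | xi_hat_t, eta_t]. *)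
Definition drift (m : Omega -> R) (t : R) (w : Omega) : R :=
  if active t w != finset.set0 then (m w - xi_hat t w) / (1 - t) else 0.

Definition discounted (psi phi : R -> R) (t : R) (w : Omega) : R :=
  expR (- \int[lebesgue_measure]_(s in `[t, 1]) psi s) * phi (X w).

End Model.

Section PDE.
Context (R : realType).

Definition differentiable_in_t_xi (f : R -> R -> R) : Prop :=
  forall y t : R, 0 < t < 1 ->
    [/\ derivable (fun s => f y s) t 1,
        derivable (fun x => f x t) y 1
      & derivable (derive1 (fun x => f x t)) y 1].

(* [f y t] is v as a function of xi_hat and t; [jump] is
   v(xi_hat_t, eta_t, t) - v(xi_hat_{t-}, eta_{t-}, t-). *)
Definition pde (psi : R -> R) (f : R -> R -> R) (y t mu sg jump lam : R) :
    Prop :=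
  derive1 (fun s => f y s) t + mu * derive1 (fun x => f x t) y
  + sg ^+ 2 * (derive1n 2 (fun x => f x t) y / 2) - psi t * f y t + jump * lam = 0.

End PDE.

(* Main.v *)
Require Import Defs.
From HB Require Import structures.
From mathcomp Require Import all_boot all_order all_algebra.
From mathcomp Require Import all_classical all_reals all_analysis.
From mathcomp Require Import measurable_realfun.
From mathcomp Require Import ring lra.

(** Let [alpha] be the sum over the sources [i] of
    [xi i tau / (sigma i ^+ 2 * (1 - tau))] and [beta'] the sum of
    [tau / (sigma i ^+ 2 * (1 - tau))], where [tau] is the last active time of
    source [i].  Everything observed up to time [t] enters the conditional law of
    [X] through [alpha] and [beta'] alone: that law has the density
    [expR (alpha * x - beta' * x ^+ 2 / 2)], suitably normalised, with respect to
    the law of [X].  The functional is therefore the discount factor times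
    [posterior phi alpha beta'].  Among the terms of [alpha] and [beta'], those of
    the active sources are functions of [xi_hat], [t] and the state, while
    [eta_fun] is the exponential of a quadratic polynomial whose two coefficients
    are the contributions of the inactive sources.  This gives [v] as an explicit
    function of the required arguments ([functional], [functional_atE]).

    The filtering formula is Bayes' formula for Gaussian noise.  For observation
    times fixed in advance, [alpha = beta' X + M] with a Gaussian noise [M] of
    variance [beta'], and a bridge observed no later than [tau] has with [M] a
    covariance such that the residual of the observation after regression on
    [alpha] is uncorrelated with [M] and free of [X].  By Gaussianity the
    residuals are then independent of [X] and [M] together, so only [alpha] is
    informative ([bayes_schedule], resting on [bayes_line] and [bayes_family]).
    The modulating process is independent of signal and noise, so for finitely
    many observation times one may condition on its values ([bayes_grid]).
    Refining the times ([bayes_raw]) and then letting the time decrease to [t]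
    ([bayes_filtration]) yields the formula for the augmented filtration.  The
    last step is delicate at time 0 only, where the posterior may oscillate; it
    is controlled in probability, which uses the second moment of [X].

    Independence is always extracted from expectations of cosines: a law on the
    line is determined by them ([weighted_law_unique]), and for bridges they are
    given by the covariance ([bridge_cos]).

    In the equation, [posterior f a b] is a quotient of expectations of
    [expR (a X - b X ^+ 2 / 2)] with weights, hence smooth for [b > 0], and a
    derivative in [b] is minus half of a second derivative in [a] at the level of
    these expectations.  Written for the quotient this becomes the identity
    [posterior_heat], in which the posterior mean of [X] is the coefficient of
    the first derivative; by the chain rule it is the equation without the jump
    term ([value_pdeE]).  The jump term vanishes almost surely at each fixed time.
    Indeed the compensator of the activation count is absolutely continuous, so
    that no activation happens at a given time ([ae_no_activation]); deactivations
    leave [alpha] and [beta'] continuous, whence the left limit of the functional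
    is its value ([posterior_left]).

    When active sources stay active and one is active from the start, the
    inactive sources have contributed nothing and [eta_fun] is 1, so the same
    function with [eta_fun] replaced by 1 serves ([functional2_at]). *)

Set Implicit Arguments.
Unset Strict Implicit.
Unset Printing Implicit Defensive.

Import Order.TTheory GRing.Theory Num.Theory.
Import numFieldNormedType.Exports.

Local Open Scope classical_set_scope.
Local Open Scope ring_scope.

(** * Bounded random variables *)

Section BoundedMeasurable.
Context (R : realType) (d : measure_display) (T : measurableType d).

(** A class closed under the operations of the proof, on which expectations need
    no integrability conditions. *)
Definition bounded_measurable (f : T -> R) : Prop :=
  measurable_fun setT f /\ exists M, forall w, `|f w| <= M.

Implicit Types f g : T -> R.

Lemma bounded_measurableD f g : bounded_measurable f -> bounded_measurable g ->
  bounded_measurable (fun w => f w + g w).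
Proof.
move=> [mf [M fM]] [mg [N gN]]; split; first exact: measurable_funD.
by exists (M + N) => w; rewrite (le_trans (ler_normD _ _))// lerD.
Qed.

Lemma bounded_measurableN f : bounded_measurable f ->
  bounded_measurable (fun w => - f w).
Proof.
move=> [mf [M fM]]; split; first exact: measurableT_comp.
by exists M => w; rewrite normrN.
Qed.

Lemma bounded_measurableB f g : bounded_measurable f -> bounded_measurable g ->
  bounded_measurable (fun w => f w - g w).
Proof.
by move=> bf bg; apply: bounded_measurableD => //; exact: bounded_measurableN.
Qed.

Lemma bounded_measurableM f g : bounded_measurable f -> bounded_measurable g ->
  bounded_measurable (fun w => f w * g w).
Proof.
move=> [mf [M fM]] [mg [N gN]]; split; first exact: measurable_funM.
by exists (M * N) => w; rewrite normrM ler_pM.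
Qed.

Lemma bounded_measurable_cst (c : R) : bounded_measurable (fun _ => c).
Proof. by split => //; exists `|c|. Qed.

Lemma bounded_measurable_indic (A : set T) : measurable A ->
  bounded_measurable (\1_A : T -> R).
Proof.
move=> mA; split; first exact: measurable_indic.
by exists 1 => w; rewrite indicE; case: (_ \in _); rewrite ?normr1 ?normr0.
Qed.

Lemma bounded_measurable_comp d' (T' : measurableType d') (f : T' -> R)
    (h : T -> T') :
  measurable_fun setT f -> (exists M, forall x, `|f x| <= M) ->
  measurable_fun setT h -> bounded_measurable (f \o h).
Proof.
move=> mf [M fM] mh; split; first exact: measurableT_comp.
by exists M => w; exact: fM.
Qed.

Lemma measurable_cos_comp (h : T -> R) : measurable_fun setT h ->
  measurable_fun setT (fun w => cos (h w)).
Proof.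
move=> mh; apply: (measurableT_comp _ mh).
by apply: continuous_measurable_fun; exact: continuous_cos.
Qed.

Lemma bounded_measurable_cos (h : T -> R) : measurable_fun setT h ->
  bounded_measurable (fun w => cos (h w)).
Proof.
move=> mh; split; first exact: measurable_cos_comp.
by exists 1 => w; rewrite ler_norml cos_geN1 cos_le1.
Qed.

Lemma bounded_measurable_sum I (s : seq I) (p : pred I) (F : I -> T -> R) :
  (forall i, bounded_measurable (F i)) ->
  bounded_measurable (fun w => \sum_(i <- s | p i) F i w).
Proof.
move=> bF; elim: s => [|i s ih].
  by under eq_fun do rewrite big_nil; exact: bounded_measurable_cst.
under eq_fun do rewrite big_cons; case: (p i) => //.
exact: bounded_measurableD.
Qed.

End BoundedMeasurable.

Section DominatedConvergence.
Context (R : realType) (d : measure_display) (T : measurableType d).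
Variable mu : {measure set T -> \bar R}.

Lemma Rintegral_dominated_cvg (f_ : nat -> T -> R) (f g : T -> R) :
  (forall n, measurable_fun setT (f_ n)) -> measurable_fun setT f ->
  mu.-integrable setT (EFin \o g) -> (forall n w, `|f_ n w| <= g w) ->
  {ae mu, forall w, f_ n w @[n --> \oo] --> f w} ->
  \int[mu]_w f_ n w @[n --> \oo] --> \int[mu]_w f w.
Proof.
move=> mf_ mf ig fg ff.
have mfE_ n : measurable_fun setT (EFin \o f_ n) by exact/measurable_EFinP.
have mfE : measurable_fun setT (EFin \o f) by exact/measurable_EFinP.
have ffE : {ae mu, forall x, setT x ->
    (EFin \o f_ n) x @[n --> \oo] --> (EFin \o f) x}.
  by apply: filterS ff => w fw _; apply: cvg_EFin => //; exact: nearW.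
have dom : {ae mu, forall x n, setT x ->
    (`|(EFin \o f_ n) x| <= (EFin \o g) x)%E}.
  by apply/aeW => w n _ /=; rewrite lee_fin.
have [intf _ cv] := @dominated_convergence _ _ _ mu setT measurableT
  _ _ _ mfE_ mfE ffE ig dom.
apply: fine_cvg.
have -> : (\int[mu]_w f w)%:E = (\int[mu]_w (EFin \o f) w)%E.
  by rewrite /Rintegral fineK//; exact: integrable_fin_num.
exact: cv.
Qed.

End DominatedConvergence.

Section BoundedExpectation.
Context (R : realType) (d : measure_display) (T : measurableType d).
Variable P : probability T R.
Implicit Types f g : T -> R.
Local Notation E f := (\int[P]_w f w).

Lemma integrable_bounded f : bounded_measurable f ->
  P.-integrable setT (EFin \o f).
Proof.
move=> [mf [M fM]]; apply: measurable_bounded_integrable => //.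
  exact: fin_num_fun_lty.
exists M; split; first exact: num_real.
by move=> x Mx w _; exact: le_trans (fM w) (ltW Mx).
Qed.

Lemma expect_cst (c : R) : E (fun _ => c) = c.
Proof.
transitivity (c * fine (P setT)); first by rewrite Rintegral_cst.
by rewrite probability_setT mulr1.
Qed.

Lemma expectD f g : bounded_measurable f -> bounded_measurable g ->
  E (fun w => f w + g w) = E f + E g.
Proof. by move=> bf bg; rewrite RintegralD//; exact: integrable_bounded. Qed.

Lemma expectB f g : bounded_measurable f -> bounded_measurable g ->
  E (fun w => f w - g w) = E f - E g.
Proof. by move=> bf bg; rewrite RintegralB//; exact: integrable_bounded. Qed.

Lemma expectZ (c : R) f : bounded_measurable f ->
  E (fun w => c * f w) = c * E f.
Proof. by move=> bf; rewrite RintegralZl//; exact: integrable_bounded. Qed.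

Lemma expect_sum I (s : seq I) (F : I -> T -> R) :
  (forall i, bounded_measurable (F i)) ->
  E (fun w => \sum_(i <- s) F i w) = \sum_(i <- s) E (F i).
Proof.
move=> bF; elim: s => [|i s ih].
  rewrite big_nil -[RHS](expect_cst 0); apply: eq_Rintegral => w _.
  by rewrite big_nil.
rewrite big_cons -ih -expectD//; last exact: bounded_measurable_sum.
by apply: eq_Rintegral => w _; rewrite big_cons.
Qed.

Lemma expect_le f g : bounded_measurable f -> bounded_measurable g ->
  (forall w, f w <= g w) -> E f <= E g.
Proof.
by move=> bf bg fg; apply: le_Rintegral => //; exact: integrable_bounded.
Qed.

Lemma expect_norm_le f (M : R) : bounded_measurable f ->
  (forall w, `|f w| <= M) -> `|E f| <= M.
Proof.
move=> bf fM; rewrite -[M]expect_cst.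
apply: le_trans (le_normr_Rintegral _ (integrable_bounded bf)) _ => //.
apply: expect_le => //; last exact: bounded_measurable_cst.
by case: bf => mf [N fN]; split; [exact: measurableT_comp|exists N => w; rewrite normr_id].
Qed.

Lemma expect_indic (A : set T) : measurable A -> E (\1_A) = fine (P A).
Proof.
by move=> mA; rewrite /Rintegral integral_indic// setIT.
Qed.

Lemma expect_EFin f : bounded_measurable f ->
  (\int[P]_w (f w)%:E)%E = (E f)%:E.
Proof.
move=> bf; rewrite /Rintegral fineK//; apply: integrable_fin_num => //.
exact: integrable_bounded.
Qed.

Lemma expect_ae f g : measurable_fun setT f -> measurable_fun setT g ->
  {ae P, forall w, f w = g w} -> E f = E g.
Proof.
move=> mf mg fg; congr fine; apply: ae_eq_integral => //.
- exact/measurable_EFinP.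
- exact/measurable_EFinP.
- by apply: filterS fg => w fgw _ /=; rewrite fgw.
Qed.

Lemma expect_cvg (f_ : nat -> T -> R) f (M : R) :
  (forall n, measurable_fun setT (f_ n)) -> measurable_fun setT f ->
  (forall n w, `|f_ n w| <= M) ->
  {ae P, forall w, f_ n w @[n --> \oo] --> f w} ->
  E (f_ n) @[n --> \oo] --> E f.
Proof.
move=> mf_ mf fM ff.
apply: (@Rintegral_dominated_cvg _ _ _ P f_ f (fun=> M)) => //.
by apply: integrable_bounded; exact: bounded_measurable_cst.
Qed.

End BoundedExpectation.

(** * Sigma-algebras and independence *)

Section SigmaAlgebraClosure.
Context (T : Type) (F : set (set T)).
Hypothesis sF : sigma_algebra setT F.

Lemma sigma_algebra_setC A : F A -> F (~` A).
Proof. by move=> FA; rewrite -setTD; have [_ + _] := sF; exact. Qed.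

Lemma sigma_algebra_setT : F setT.
Proof. by have [F0 _ _] := sF; rewrite -setC0; exact: sigma_algebra_setC. Qed.

Lemma sigma_algebra_setU : setU_closed F.
Proof.
move=> A A' FA FA'; have [F0 _ FU] := sF; rewrite -bigcup2E.
by apply: FU => -[|[|n]].
Qed.

Lemma sigma_algebra_setI : setI_closed F.
Proof.
move=> A A' FA FA'; rewrite -[A `&` A']setCK setCI.
by apply/sigma_algebra_setC/sigma_algebra_setU; exact: sigma_algebra_setC.
Qed.

End SigmaAlgebraClosure.

Section Dynkin.
Context (R : realType) (d : measure_display) (T : measurableType d).
Variable P : probability T R.
Local Notation E f := (\int[P]_w f w).

Lemma g_sigma_algebra_measurable (C : set (set T)) : C `<=` measurable ->
  <<s C >> `<=` measurable.
Proof. by move=> Cm; apply: smallest_sub => //; exact: sigma_algebra_measurable. Qed.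

Lemma bounded_measurable_indic_comp d1 (T1 : measurableType d1) (S : Type)
    (U : T1 -> S) (h : T1 -> R) (A : set S) :
  bounded_measurable h -> measurable (U @^-1` A) ->
  bounded_measurable (fun w => h w * \1_A (U w)).
Proof.
move=> bh mA; apply: bounded_measurableM => //.
exact: (bounded_measurable_indic R mA).
Qed.

Lemma integral_set_indic (f : T -> R) (A : set T) : bounded_measurable f ->
  measurable A -> (\int[P]_(w in A) (f w)%:E)%E = (E (fun w => f w * \1_A w))%:E.
Proof.
move=> bf mA; rewrite -expect_EFin; last first.
  by apply: bounded_measurableM => //; exact: bounded_measurable_indic.
rewrite integral_mkcond; apply: eq_integral => w _.
by rewrite patchE indicE; case: ifP => _; rewrite ?mulr1 ?mulr0.
Qed.

(** Two weighted laws, of [W] under [f P] and of [V] under [g Q], agree on a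
    generated sigma-algebra as soon as they agree on a generating pi-system. *)
Lemma expect_dynkin2 d' (T' : measurableType d') (Q : probability T' R)
    (S : Type) (W : T -> S) (V : T' -> S) (f : T -> R) (g : T' -> R)
    (C : set (set S)) :
  bounded_measurable f -> bounded_measurable g ->
  (forall A, <<s C >> A -> measurable (W @^-1` A)) ->
  (forall A, <<s C >> A -> measurable (V @^-1` A)) ->
  setI_closed C -> E f = \int[Q]_w g w ->
  (forall A, C A -> E (fun w => f w * \1_A (W w)) =
                    \int[Q]_w (g w * \1_A (V w))) ->
  forall A, <<s C >> A -> E (fun w => f w * \1_A (W w)) =
                         \int[Q]_w (g w * \1_A (V w)).
Proof.
move=> bf bg mW mV CI fg0 fg.
pose D := [set A | <<s C >> A /\ E (fun w => f w * \1_A (W w)) =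
                         \int[Q]_w (g w * \1_A (V w))].
suff : <<s C >> `<=` D by move=> CD A /CD[].
rewrite -[X in X `<=` _]setI_closed_g_dynkin_g_sigma_algebra//.
have sC : sigma_algebra setT <<s C >> by exact: smallest_sigma_algebra.
apply: smallest_sub; last first.
  by move=> A CA; split; [exact: sub_sigma_algebra|exact: fg].
split.
- split; first exact: (sigma_algebra_setT sC).
  under eq_Rintegral do rewrite indicT mulr1.
  by under [RHS]eq_Rintegral do rewrite indicT mulr1.
- move=> A [CA fgA]; split; first exact: (sigma_algebra_setC sC CA).
  have eC d1 (T1 : measurableType d1) (P1 : probability T1 R) (U : T1 -> S) h :
      bounded_measurable h -> measurable (U @^-1` A) ->
      \int[P1]_w (h w * \1_(~` A) (U w)) =
      \int[P1]_w h w - \int[P1]_w (h w * \1_A (U w)).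
    move=> bh mA; rewrite -expectB//; last exact: bounded_measurable_indic_comp.
    apply: eq_Rintegral => w _; rewrite !indicE in_setC.
    by case: (U w \in A); rewrite ?mulr0 ?mulr1 ?subrr ?subr0.
  by rewrite !eC ?fg0 ?fgA//; [exact: mV|exact: mW].
- move=> F tF DF.
  have CF k : <<s C >> (F k) by have [] := DF k.
  have CUF : <<s C >> (\bigcup_k F k) by have [_ _] := sC; exact.
  split => //.
  have cvgF d1 (T1 : measurableType d1) (P1 : probability T1 R) (U : T1 -> S) h :
      bounded_measurable h -> (forall A, <<s C >> A -> measurable (U @^-1` A)) ->
      (\sum_(k < n) \int[P1]_w (h w * \1_(F k) (U w))) @[n --> \oo] -->
      \int[P1]_w (h w * \1_(\bigcup_k F k) (U w)).
    move=> bh mU.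
    have e1 n : \sum_(k < n) \int[P1]_w (h w * \1_(F k) (U w)) =
        \int[P1]_w (h w * \1_(\big[setU/set0]_(k < n) F k) (U w)).
      rewrite -expect_sum; last by move=> k; apply: bounded_measurable_indic_comp => //; exact: mU.
      apply: eq_Rintegral => w _; rewrite -mulr_sumr; congr (_ * _).
      rewrite indicE -bigcup_mkord.
      have [|nF] := boolP (U w \in _).
        rewrite inE => -[j /= jn Fjw]; rewrite (bigD1 (Ordinal jn))//= indicE mem_set//.
        rewrite big1 ?addr0// => k kj; rewrite indicE memNset// => Fkw.
        move/eqP : kj; apply; apply: val_inj => /=.
        by apply: (tF) => //; exists (U w).
      rewrite big1// => k _; rewrite indicE memNset// => Fkw.
      by move: nF; rewrite notin_setE; apply; exists k => /=.
    under eq_fun do rewrite e1.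
    have [mh [M hM]] := bh.
    apply: (@expect_cvg _ _ _ _ _ _ M).
    + move=> n; apply: (bounded_measurable_indic_comp bh _).1; apply: mU.
      rewrite -bigcup_mkord bigcup_mkcond; have [C0 _ CU] := sC; apply: CU => k.
      by case: ifP.
    + by apply: (bounded_measurable_indic_comp bh _).1; exact: mU.
    + move=> n w; rewrite normrM (le_trans _ (hM w))// ler_piMr// indicE.
      by case: (_ \in _); rewrite ?normr1 ?normr0.
    + apply/aeW => w; apply: cvgM; first exact: cvg_cst.
      have [[j _ Fjw]|nF] := pselect ((\bigcup_k F k) (U w)).
        apply: cvg_near_cst; exists j.+1 => // n /= jn.
        have Un : (\big[setU/set0]_(k < n) F k) (U w).
          by rewrite -bigcup_mkord; exists j.
        have U' : (\bigcup_k F k) (U w) by exists j.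
        by rewrite !indicE !mem_set.
      apply: cvg_near_cst; apply: nearW => n.
      rewrite !indicE (memNset nF) memNset//; apply: contra_not nF.
      by rewrite -bigcup_mkord => -[k _ Fkw]; exists k.
  have e : (fun n => \sum_(k < n) E (fun w => f w * \1_(F k) (W w)))
    = (fun n => \sum_(k < n) \int[Q]_w (g w * \1_(F k) (V w))).
    by apply/funext => n; apply: eq_bigr => k _; have [] := DF k.
  have := cvgF _ _ P _ _ bf mW; rewrite e => /cvg_lim <-//.
  by have /cvg_lim -> := cvgF _ _ Q _ _ bg mV.
Qed.

Lemma expect_dynkin (f g : T -> R) (C : set (set T)) :
  bounded_measurable f -> bounded_measurable g ->
  C `<=` measurable -> setI_closed C -> E f = E g ->
  (forall A, C A -> E (fun w => f w * \1_A w) = E (fun w => g w * \1_A w)) ->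
  forall A, <<s C >> A -> E (fun w => f w * \1_A w) = E (fun w => g w * \1_A w).
Proof.
move=> bf bg mC CI fg0 fg.
by apply: (@expect_dynkin2 _ _ P _ id id) => // A /(g_sigma_algebra_measurable mC).
Qed.

(** Dynkin's argument, applied to one event after the other. *)
Lemma independent_pi (C1 C2 : set (set T)) :
  C1 `<=` measurable -> C2 `<=` measurable ->
  setI_closed C1 -> setI_closed C2 ->
  (forall A B, C1 A -> C2 B -> P (A `&` B) = (P A * P B)%E) ->
  independent P <<s C1 >> <<s C2 >>.
Proof.
move=> mC1 mC2 IC1 IC2 C12.
have key C A : C `<=` measurable -> setI_closed C -> measurable A ->
    (forall B, C B -> P (A `&` B) = (P A * P B)%E) ->
    forall B, <<s C >> B -> P (A `&` B) = (P A * P B)%E.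
  move=> mC IC mA CA.
  have toE B : measurable B -> P (A `&` B) = (P A * P B)%E <->
      E (fun w => \1_A w * \1_B w) = E (fun w => fine (P A) * \1_B w).
    move=> mB; rewrite expectZ; last exact: bounded_measurable_indic.
    rewrite expect_indic//.
    have -> : E (fun w => \1_A w * \1_B w) = fine (P (A `&` B)).
      rewrite -expect_indic; last exact: measurableI.
      by apply: eq_Rintegral => w _; rewrite indicI.
    have fAB : P (A `&` B) \is a fin_num.
      by rewrite fin_num_measure//; exact: measurableI.
    have fApB : (P A * P B)%E \is a fin_num by rewrite fin_numM ?fin_num_measure.
    rewrite -fineM ?fin_num_measure//; split => [->//|e].
    by rewrite -(fineK fAB) e fineK.
  move=> B CB; have mB := g_sigma_algebra_measurable mC CB.
  apply/toE => //; move: B CB {mB}; apply: expect_dynkin => //.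
  - exact: bounded_measurable_indic.
  - exact: bounded_measurable_cst.
  - by rewrite expect_cst expect_indic.
  - by move=> B CB; apply/toE; [exact: mC|exact: CA].
move=> A B sA sB; have mA := g_sigma_algebra_measurable mC1 sA.
apply: (key C2 A) => // {sB} B' CB; have mB := mC2 _ CB.
rewrite setIC muleC; apply: (key C1 B') => // A' CA.
by rewrite setIC muleC; exact: C12.
Qed.

End Dynkin.

Section IndependentExpectation.
Context (R : realType) (d : measure_display) (T : measurableType d).
Variable P : probability T R.
Local Notation E f := (\int[P]_w f w).

(** The joint law of two independent random elements is the product of their
    laws, so an expectation of both is an iterated expectation over two
    independent copies of the sample space. *)
Lemma independent_fubini d1 d2 (T1 : measurableType d1) (T2 : measurableType d2)
    (U : T -> T1) (V : T -> T2) (Phi : T1 * T2 -> \bar R) :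
  measurable_fun setT U -> measurable_fun setT V ->
  (forall A B, measurable A -> measurable B ->
    P (U @^-1` A `&` V @^-1` B) = (P (U @^-1` A) * P (V @^-1` B))%E) ->
  measurable_fun setT Phi -> (forall z, 0 <= Phi z)%E ->
  (\int[P]_w Phi (U w, V w) = \int[P]_w \int[P]_w' Phi (U w, V w'))%E.
Proof.
move=> mU mV UV mPhi Phi0.
pose U' : {mfun T >-> T1} := HB.pack U (isMeasurableFun.Build _ _ _ _ _ mU).
pose V' : {mfun T >-> T2} := HB.pack V (isMeasurableFun.Build _ _ _ _ _ mV).
have mUV : measurable_fun setT (fun w => (U w, V w)) by exact: measurable_fun_pair.
pose W : {mfun T >-> (T1 * T2)%type} :=
  HB.pack (fun w => (U w, V w)) (isMeasurableFun.Build _ _ _ _ _ mUV).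
have eW := @product_measure_unique _ _ _ _ R (distribution P U') (distribution P V')
  (distribution P W) _.
have -> : (\int[P]_w Phi (U w, V w) = \int[distribution P W]_z Phi z)%E.
  by rewrite ge0_integral_distribution.
rewrite (eq_measure_integral (distribution P U' \x distribution P V')%E); last first.
  by move=> A mA _; symmetry; apply: eW => // B1 B2 mB1 mB2; exact: UV.
rewrite fubini_tonelli1//.
rewrite ge0_integral_distribution//.
- apply: eq_integral => w _ /=; rewrite /fubini_F ge0_integral_distribution//.
  exact: measurable_fun_pair2.
- exact: measurable_fun_fubini_tonelli_F.
- by move=> x; exact: integral_ge0.
Qed.

Lemma independentC (F1 F2 : set (set T)) :
  independent P F1 F2 -> independent P F2 F1.
Proof. by move=> I A B FA FB; rewrite setIC muleC; exact: I. Qed.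

(** For nonnegative factors this is an iterated expectation; bounded factors are
    first shifted by a constant. *)
Lemma expectM_independent (F1 F2 : set (set T)) (U V : T -> R) :
  independent P F1 F2 -> measurable_wrt F1 U -> measurable_wrt F2 V ->
  bounded_measurable U -> bounded_measurable V ->
  E (fun w => U w * V w) = E U * E V.
Proof.
move=> I FU FV bU bV.
have ge0 M N : (forall w, 0 <= U w + M) -> (forall w, 0 <= V w + N) ->
    E (fun w => (U w + M) * (V w + N)) = E (fun w => U w + M) * E (fun w => V w + N).
  move=> UM VN.
  have bUM : bounded_measurable (fun w => U w + M).
    by apply: bounded_measurableD => //; exact: bounded_measurable_cst.
  have bVN : bounded_measurable (fun w => V w + N).
    by apply: bounded_measurableD => //; exact: bounded_measurable_cst.
  pose Phi (z : R * R) : \bar R := (Num.max 0 (z.1 + M) * Num.max 0 (z.2 + N))%:E.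
  have PhiE w w' : Phi (U w, V w') = ((U w + M) * (V w' + N))%:E.
    by rewrite /Phi /= !max_r.
  have mmax1 : measurable_fun setT (fun z : R * R => Num.max 0 (z.1 + M)).
    apply: measurable_maxr => //; apply: measurable_funD => //.
  have mmax2 : measurable_fun setT (fun z : R * R => Num.max 0 (z.2 + N)).
    apply: measurable_maxr => //; apply: measurable_funD => //.
  have := @independent_fubini _ _ _ _ U V Phi bU.1 bV.1
    (fun A B mA mB => I _ _ (FU A mA) (FV B mB)).
  have mPhi : measurable_fun setT Phi.
    by apply/measurable_EFinP; exact: measurable_funM.
  have Phi0 z : (0 <= Phi z)%E.
    by rewrite lee_fin mulr_ge0// le_max lexx.
  move=> /(_ mPhi Phi0).
  under eq_integral do rewrite PhiE.
  rewrite expect_EFin; last exact: bounded_measurableM.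
  under [RHS]eq_integral => w _.
    under eq_integral do rewrite PhiE.
    rewrite expect_EFin; last first.
      by apply: bounded_measurableM => //; exact: bounded_measurable_cst.
    rewrite expectZ// mulrC.
    over.
  rewrite expect_EFin; last first.
    by apply: bounded_measurableM => //; exact: bounded_measurable_cst.
  by rewrite expectZ// mulrC => -[].
have [_ [M UM]] := bU; have [_ [N VN]] := bV.
have := ge0 M N.
have lowb (x y : R) : `|x| <= y -> 0 <= x + y.
  by rewrite ler_norml => /andP[]; rewrite -subr_ge0 opprK.
move=> /(_ (fun w => lowb _ _ (UM w)) (fun w => lowb _ _ (VN w))).
have bc c : bounded_measurable (fun _ : T => c : R) by exact: bounded_measurable_cst.
have bZ c (f : T -> R) : bounded_measurable f -> bounded_measurable (fun w => c * f w).
  by move=> bf; exact: bounded_measurableM.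
rewrite !expectD// !expect_cst.
have -> : E (fun w => (U w + M) * (V w + N)) = E (fun w => U w * V w) + N * E U + M * E V + M * N.
  have bUV : bounded_measurable (fun w => U w * V w) by exact: bounded_measurableM.
  have b1 := bZ N U bU; have b2 := bZ M V bV.
  have b3 := bounded_measurableD bUV b1; have b4 := bounded_measurableD b3 b2.
  rewrite -(expectZ P N bU) -(expectZ P M bV) -[M * N](expect_cst P).
  rewrite -(expectD P bUV b1) -(expectD P b3 b2) -(expectD P b4 (bc _)).
  by apply: eq_Rintegral => w _; ring.
by move=> e; nra.
Qed.

End IndependentExpectation.

Section MeasurableWrt.
Context (R : realType) (d : measure_display) (T : measurableType d).
Implicit Types (F : set (set T)) (f g : T -> R).

(** Measurability of functions on the space re-equipped with [F]; the closure
    properties below are inherited from it. *)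
Lemma measurable_wrtE F f : sigma_algebra setT F ->
  measurable_wrt F f <-> measurable_fun setT (f : g_sigma_algebraType F -> R).
Proof.
move=> sF; split => [Ff _ B mB|mf B mB].
  by rewrite setTI; apply: sub_sigma_algebra; exact: Ff.
have := mf measurableT B mB; rewrite setTI.
by rewrite /measurable /= sigma_algebra_id.
Qed.

Lemma measurable_wrt_ext F f g : f =1 g -> measurable_wrt F f ->
  measurable_wrt F g.
Proof. by move=> /funext ->. Qed.

Lemma measurable_wrtS F F' f : F `<=` F' -> measurable_wrt F f ->
  measurable_wrt F' f.
Proof. by move=> FF' Ff B mB; exact/FF'/Ff. Qed.

Lemma measurable_wrt_measurable F f : F `<=` measurable ->
  measurable_wrt F f -> measurable_fun setT f.
Proof. by move=> mF Ff _ B mB; rewrite setTI; exact/mF/Ff. Qed.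

Lemma measurable_wrt_comp F f (h : R -> R) : measurable_fun setT h ->
  measurable_wrt F f -> measurable_wrt F (h \o f).
Proof.
move=> mh Ff B mB; apply: (Ff (h @^-1` B)).
by rewrite -[X in measurable X]setTI; exact: mh.
Qed.

Lemma measurable_wrt_gen (fs : set (T -> R)) f : fs f ->
  measurable_wrt (sigma_gen fs) f.
Proof. by move=> fsf B mB; apply: sub_sigma_algebra; exists f => //; exists B. Qed.

Lemma sigma_genP (fs : set (T -> R)) F : sigma_algebra setT F ->
  (forall f, fs f -> measurable_wrt F f) -> sigma_gen fs `<=` F.
Proof.
move=> sF fsF; apply: smallest_sub => // A [f fsf [B mB ->]].
exact: fsF.
Qed.

Lemma sigma_gen_sigma_algebra (fs : set (T -> R)) :
  sigma_algebra setT (sigma_gen fs).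
Proof. exact: smallest_sigma_algebra. Qed.

Section closure.
Variable F : set (set T).
Hypothesis sF : sigma_algebra setT F.

Lemma measurable_wrt_cst (c : R) : measurable_wrt F (fun _ => c).
Proof. by apply/measurable_wrtE => //; exact: measurable_cst. Qed.

Lemma measurable_wrtD f g : measurable_wrt F f -> measurable_wrt F g ->
  measurable_wrt F (fun w => f w + g w).
Proof.
move=> /(measurable_wrtE _ sF) mf /(measurable_wrtE _ sF) mg.
by apply/(measurable_wrtE _ sF); exact: (measurable_funD mf mg).
Qed.

Lemma measurable_wrtM f g : measurable_wrt F f -> measurable_wrt F g ->
  measurable_wrt F (fun w => f w * g w).
Proof.
move=> /(measurable_wrtE _ sF) mf /(measurable_wrtE _ sF) mg.
by apply/(measurable_wrtE _ sF); exact: (measurable_funM mf mg).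
Qed.

Lemma measurable_wrtB f g : measurable_wrt F f -> measurable_wrt F g ->
  measurable_wrt F (fun w => f w - g w).
Proof.
move=> /(measurable_wrtE _ sF) mf /(measurable_wrtE _ sF) mg.
by apply/(measurable_wrtE _ sF); exact: (measurable_funB mf mg).
Qed.

Lemma measurable_wrt_comp2 f g (h : R * R -> R) : measurable_fun setT h ->
  measurable_wrt F f -> measurable_wrt F g ->
  measurable_wrt F (fun w => h (f w, g w)).
Proof.
move=> mh /(measurable_wrtE _ sF) mf /(measurable_wrtE _ sF) mg.
apply/(measurable_wrtE _ sF); apply: (measurableT_comp mh).
exact: measurable_fun_pair.
Qed.

Lemma measurable_wrt_sum I (s : seq I) (p : pred I) (f : I -> T -> R) :
  (forall i, p i -> measurable_wrt F (f i)) ->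
  measurable_wrt F (fun w => \sum_(i <- s | p i) f i w).
Proof.
move=> mf; elim: s => [|i s ih].
  by under eq_fun do rewrite big_nil; exact: measurable_wrt_cst.
under eq_fun do rewrite big_cons; case: (boolP (p i)) => // p_i.
by apply: measurable_wrtD => //; exact: mf.
Qed.

Lemma measurable_wrt_indic A : F A -> measurable_wrt F (\1_A : T -> R).
Proof.
move=> FA; apply/measurable_wrtE => //.
have mA : measurable (A : set (g_sigma_algebraType F)).
  exact: sub_sigma_algebra.
by have /measurable_indicP := mA; exact.
Qed.

Lemma measurable_wrt_cvg (f_ : nat -> T -> R) f :
  (forall n, measurable_wrt F (f_ n)) ->
  (forall w, f_ n w @[n --> \oo] --> f w) -> measurable_wrt F f.
Proof.
move=> mf_ ff; apply/measurable_wrtE => //.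
apply: (measurable_fun_cvg (h := (f_ : nat -> g_sigma_algebraType F -> R))).
  by move=> n; exact/(measurable_wrtE _ sF).
by move=> w _; exact: ff.
Qed.

End closure.

(** Along a complete class of null sets almost sure limits stay measurable. *)
Lemma measurable_wrt_ae (P : probability T R) F f g :
  sigma_algebra setT F -> P.-negligible `<=` F ->
  measurable_wrt F f -> {ae P, forall w, f w = g w} -> measurable_wrt F g.
Proof.
move=> sF NF Ff fg B mB.
have -> : g @^-1` B = (f @^-1` B `&` ~` [set w | f w <> g w])
                      `|` (g @^-1` B `&` [set w | f w <> g w]).
  apply/seteqP; split => [w Bg|w [[/= Bf /contrapT <-//]|[//]]].
  have [e|ne] := pselect (f w = g w); last by right.
  by left; split => /=; [rewrite e|rewrite e].
apply: (sigma_algebra_setU sF).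
  apply: (sigma_algebra_setI sF); first exact: Ff.
  by apply: (sigma_algebra_setC sF); exact: NF.
by apply: NF; apply: negligibleS fg => w [].
Qed.

Lemma measurable_wrt_cvg_ae (P : probability T R) F (f_ : nat -> T -> R) f :
  sigma_algebra setT F -> P.-negligible `<=` F ->
  (forall n, measurable_wrt F (f_ n)) ->
  {ae P, forall w, f_ n w @[n --> \oo] --> f w} -> measurable_wrt F f.
Proof.
move=> sF NF mf_ ff.
pose N : set T := [set w | ~ (f_ n w @[n --> \oo] --> f w)].
have FN : F N by exact: NF.
have FNC : F (~` N) by exact: (sigma_algebra_setC sF).
apply: (@measurable_wrt_ae P F (fun w => f w * \1_(~` N) w)) => //; last first.
  apply: filterS ff => w fw; rewrite indicE mem_set ?mulr1//.
apply: (@measurable_wrt_cvg F sF (fun n w => f_ n w * \1_(~` N) w)).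
  by move=> n; apply: measurable_wrtM => //; exact: measurable_wrt_indic.
move=> w; have [fw|nfw] := pselect (f_ n w @[n --> \oo] --> f w).
  by apply: cvgM => //; exact: cvg_cst.
rewrite indicE memNset; last by move=> /=; exact.
by rewrite mulr0; under eq_fun do rewrite mulr0; exact: cvg_cst.
Qed.

End MeasurableWrt.

Section Grouping.
Context (R : realType) (d : measure_display) (T : measurableType d).
Variables (P : probability T R) (I : finType) (F : I -> set (set T)).
Hypothesis sF : forall i, sigma_algebra setT (F i).
Hypothesis mF : forall i, F i `<=` measurable.
Hypothesis iF : mutually_independent P F.

Definition joined (S : {set I}) : set (set T) :=
  <<s [set A | exists2 i, i \in S & F i A] >>.

Let cylinder (S : {set I}) : set (set T) :=
  [set A | exists2 B : I -> set T, (forall i, i \in S -> F i (B i)) &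
    A = \bigcap_(i in [set i | i \in S]) B i].

Let cylinder_measurable S : cylinder S `<=` measurable.
Proof.
move=> _ [B FB ->]; apply: fin_bigcap_measurable; first exact: finite_finset.
by move=> i /= iS; exact/mF/FB.
Qed.

Let cylinder_setI S : setI_closed (cylinder S).
Proof.
move=> _ _ [A FA ->] [B FB ->]; exists (fun i => A i `&` B i).
  by move=> i iS; exact: (sigma_algebra_setI (sF i) (FA i iS) (FB i iS)).
by rewrite bigcapI.
Qed.

Let joined_cylinder S : joined S `<=` <<s cylinder S >>.
Proof.
apply: smallest_sub; first exact: smallest_sigma_algebra.
move=> A [i iS FA]; apply: sub_sigma_algebra.
exists (fun j => if j == i then A else setT).
  move=> j jS; case: eqP => [->//|_].
  exact: (sigma_algebra_setT (sF j)).
apply/seteqP; split => [w Aw j /= jS|w /(_ i iS)]; first by case: eqP.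
by rewrite eqxx.
Qed.

(** Mutual independence speaks of one event from each sigma-algebra; the
    intersections of such events form generating pi-systems of the two joins. *)
Lemma joined_independent (S S' : {set I}) : (forall i, i \in S' -> i \notin S) ->
  independent P (joined S) (joined S').
Proof.
move=> SS'.
suff H : independent P <<s cylinder S >> <<s cylinder S' >>.
  by move=> A B /joined_cylinder SA /joined_cylinder SB; exact: H.
apply: independent_pi => // _ _ [A FA ->] [B FB ->].
pose C i := if i \in S then A i else B i.
have -> : \bigcap_(i in [set i | i \in S]) A i `&`
          \bigcap_(i in [set i | i \in S']) B i =
          \bigcap_(i in [set i | i \in finset.setU S S']) C i.
  apply/seteqP; split => [w [Aw Bw] i /=|w Cw].
    by rewrite /C finset.in_setU; case: ifPn => iS /= iS'; [exact: Aw|exact: Bw].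
  split => i /= iS; have := Cw i; rewrite /C /= finset.in_setU iS ?orbT.
    by move=> /(_ isT).
  by rewrite (negbTE (SS' _ iS)); exact.
rewrite iF; last first.
  by move=> i; rewrite finset.in_setU /C; case: ifPn => iS /= iS'; [exact: FA|exact: FB].
rewrite !iF// (eq_bigl [predU S & S']); last first.
  by move=> i; rewrite finset.in_setU !inE.
rewrite bigU/=; last first.
  apply/pred0P => i /=; apply/negbTE/negP => /andP[iS iS'].
  by have := SS' i iS'; rewrite iS.
congr (_ * _)%E; apply: eq_bigr => i iS; rewrite /C; first by rewrite iS.
by rewrite (negbTE (SS' _ iS)).
Qed.

Lemma sub_joined (S : {set I}) i : i \in S -> F i `<=` joined S.
Proof. by move=> iS A FA; apply: sub_sigma_algebra; exists i. Qed.

Lemma joined_measurable (S : {set I}) : joined S `<=` measurable.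
Proof.
by apply: g_sigma_algebra_measurable => A [i _ FA]; exact: mF FA.
Qed.

End Grouping.

(** * Gaussian laws *)

Section NormalDensity.
Context (R : realType).
Local Notation mu := (@lebesgue_measure R).

(** The fundamental theorem of calculus on growing symmetric intervals. *)
Lemma integral_derivative_eq0 (h h' : R -> R) :
  (forall x : R, is_derive x 1 h (h' x)) -> continuous h' ->
  mu.-integrable setT (EFin \o h') ->
  (h n%:R - h (- n%:R)) @[n --> \oo] --> 0 ->
  \int[mu]_x h' x = 0.
Proof.
move=> dh ch' ih' h0.
have mh' : measurable_fun setT h' by exact: continuous_measurable_fun.
have ch : continuous h.
  by move=> x; apply: differentiable_continuous; apply/derivable1_diffP; case: (dh x).
pose f_ (n : nat) (x : R) : R := h' x * \1_(`[- n%:R, n%:R]%classic : set R) x.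
have cvg_int : \int[mu]_x f_ n x @[n --> \oo] --> \int[mu]_x h' x.
  apply: (@Rintegral_dominated_cvg _ _ _ mu f_ h' (fun x => `|h' x|)) => //.
  - by move=> n; apply: measurable_funM.
  - exact: integrable_norm.
  - move=> n x; rewrite normrM ler_piMr// indicE.
    by case: (_ \in _); rewrite ?normr1 ?normr0.
  - apply/aeW => x; rewrite -[X in _ --> X]mulr1; apply: cvgM; first exact: cvg_cst.
    apply: cvg_near_cst; near=> n; rewrite indicE mem_set//= in_itv/=.
    by rewrite -ler_norml; near: n; exact: nbhs_infty_ger.
suff : \int[mu]_x f_ n x @[n --> \oo] --> 0.
  by move=> /(cvg_unique _ cvg_int); exact.
move: h0; apply: cvg_trans; apply: near_eq_cvg; exists 1%N => // n /= n0.
have nn : - n%:R < n%:R :> R.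
  by rewrite -subr_gt0 opprK addr_gt0 ?ltr0n.
have := @continuous_FTC2 R h' h _ _ nn.
move=> /(_ (continuous_subspaceT ch')).
have dl : derivable_oo_LRcontinuous h (- n%:R) n%:R.
  split; first by move=> x _; case: (dh x).
  - by apply: cvg_at_right_filter; exact: ch.
  - by apply: cvg_at_left_filter; exact: ch.
move=> /(_ dl); have dh' : {in `](- n%:R), n%:R[, derive1 h =1 h'}.
  by move=> x _; rewrite derive1E; case: (dh x).
move=> /(_ dh') e; rewrite /Rintegral.
have -> : (\int[mu]_x (f_ n x)%:E)%E =
    (\int[mu]_(x in `[(- n%:R)%R, n%:R%R]%classic) (h' x)%:E)%E.
  rewrite [RHS]integral_mkcond; apply: eq_integral => x _.
  by rewrite /f_ patchE indicE; case: ifP => _; rewrite ?mulr1 ?mulr0.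
by rewrite e.
Unshelve. all: end_near. Qed.

Variables (m s : R).
Hypothesis s0 : s != 0.
Local Notation p := (normal_pdf m s).
Let t x : R := (x - m) ^+ 2 / (s ^+ 2 *+ 2).

Let t_ge0 x : 0 <= t x.
Proof. by rewrite divr_ge0// ?sqr_ge0// mulrn_wge0// sqr_ge0. Qed.

Let pE x : p x = normal_peak s * expR (- t x).
Proof. by rewrite normal_pdfE// /normal_fun /t mulNr. Qed.

Let s2_gt0 : 0 < s ^+ 2. Proof. by rewrite exprn_even_gt0. Qed.

Lemma is_derive_normal_pdf (x : R) :
  is_derive x 1 p (- ((x - m) / s ^+ 2) * p x).
Proof.
have -> : p = (fun x => normal_peak s * expR (- ((x - m) ^+ 2 / (s ^+ 2 *+ 2)))).
  by apply/funext => y; rewrite pE.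
apply: is_derive_eq; rewrite /GRing.scale /=; field.
exact: s0.
Qed.

(** Functions of at most quadratic growth: the Gaussian density beats them. *)
Let quad (q : R -> R) := exists C, forall x, `|q x| <= C * (1 + t x).

Let continuous_p : continuous p. Proof. exact: continuous_normal_pdf. Qed.

Let quad_le q C x : (forall x, `|q x| <= C * (1 + t x)) ->
  `|q x * p x| <= C * 2 * normal_peak s * expR (- (t x / 2)).
Proof.
move=> qC; have C0 : 0 <= C.
  have := le_trans (normr_ge0 _) (qC m).
  by rewrite /t subrr expr0n /= mul0r addr0 mulr1.
rewrite pE normrM [X in _ * X]ger0_norm; last first.
  by rewrite mulr_ge0 ?normal_peak_ge0 ?expR_ge0.
apply: (@le_trans _ _ (C * (1 + t x) * (normal_peak s * expR (- t x)))).
  by rewrite ler_wpM2r// mulr_ge0 ?normal_peak_ge0 ?expR_ge0.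
rewrite {2}(splitr (t x)) opprD expRD.
rewrite (_ : _ * _ = C * normal_peak s * expR (- (t x / 2)) *
  ((1 + t x) * expR (- (t x / 2)))); last by ring.
rewrite (_ : C * 2 * _ * _ = C * normal_peak s * expR (- (t x / 2)) * 2); last by ring.
apply: ler_wpM2l.
  by rewrite mulr_ge0 ?expR_ge0// mulr_ge0 ?normal_peak_ge0.
rewrite expRN ler_pdivrMr ?expR_gt0//.
have := expR_ge1Dx (t x / 2); have := t_ge0 x; lra.
Qed.

Let integrable_quad q : measurable_fun setT q -> quad q ->
  mu.-integrable setT (EFin \o (fun x => q x * p x)).
Proof.
move=> mq [C qC].
have s20 : s * Num.sqrt 2 != 0 by rewrite mulf_neq0// gt_eqF// sqrtr_gt0.
pose K := C * 2 * normal_peak s / normal_peak (s * Num.sqrt 2).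
have iK : mu.-integrable setT (fun x => (K%:E * (normal_pdf m (s * Num.sqrt 2) x)%:E)%E).
  by apply: integrableZl => //; exact: integrable_normal_pdf.
apply: le_integrable iK => //.
  by apply/measurable_EFinP; apply: measurable_funM => //; exact: measurable_normal_pdf.
move=> x _; rewrite /= lee_fin (le_trans (quad_le x qC))//.
rewrite (le_trans _ (ler_norm _))// normal_pdfE// /normal_fun /K.
rewrite le_eqVlt; apply/orP; left; apply/eqP.
have -> : - (x - m) ^+ 2 / ((s * Num.sqrt 2) ^+ 2 *+ 2) = - (t x / 2).
  rewrite /t exprMn sqr_sqrtr//; field; exact: s0.
by field; rewrite gt_eqF// normal_peak_gt0.
Qed.

Let quad_cvg0 q : quad q ->
  (q n%:R * p n%:R - q (- n%:R) * p (- n%:R)) @[n --> \oo] --> 0.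
Proof.
move=> [C qC].
have C0 : 0 <= C.
  have := le_trans (normr_ge0 _) (qC m).
  by rewrite /t subrr expr0n /= mul0r addr0 mulr1.
pose K := C * 2 * normal_peak s * (s ^+ 2 * 4).
have K0 : 0 <= K.
  rewrite /K; apply: mulr_ge0; last by rewrite mulr_ge0 ?sqr_ge0.
  by apply: mulr_ge0; [rewrite mulr_ge0|exact: normal_peak_ge0].
have lim (u : nat -> R) : (forall n : nat, n%:R - `|m| <= `|u n - m|) ->
    q (u n) * p (u n) @[n --> \oo] --> 0.
  move=> um; apply: norm_cvg0.
  have h0 : (K * (n.+1%:R)^-1 : R) @[n --> \oo] --> 0.
    rewrite -[X in _ --> X](mulr0 K); apply: cvgM; first exact: cvg_cst.
    exact: cvg_harmonic.
  apply: (squeeze_cvgr (f := fun=> 0) (h := fun n => K * n.+1%:R^-1) _ _ h0);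
    last exact: cvg_cst.
  near=> n; rewrite normr_ge0 /=.
  rewrite (le_trans (quad_le _ qC))// /K -[leRHS]mulrA ler_wpM2l//.
    by rewrite mulr_ge0 ?mulr_ge0 ?normal_peak_ge0.
  rewrite expRN.
  have big : n.+1%:R <= (u n - m) ^+ 2.
    have n1 : 2 * `|m| + 8 <= n%:R by near: n; exact: nbhs_infty_ger.
    have n2 := um n; have m0 := normr_ge0 m.
    rewrite -[leRHS]real_normK ?num_real// -natr1.
    have n3 : n%:R / 2 <= `|u n - m| by lra.
    have n4 : (8 : R) <= n%:R by lra.
    by apply: (@le_trans _ _ ((n%:R / 2) ^+ 2)); [nra|rewrite lerXn2r ?nnegrE//; lra].
  have ut : t (u n) / 2 = (u n - m) ^+ 2 / (s ^+ 2 * 4).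
    by rewrite /t; field; exact: s0.
  have s4 : 0 < s ^+ 2 * 4 by rewrite mulr_gt0.
  have nt : n.+1%:R / (s ^+ 2 * 4) <= t (u n) / 2.
    by rewrite ut ler_wpM2r// invr_ge0 ltW.
  rewrite -[leRHS]invrK invf_div lef_pV2 ?posrE ?expR_gt0 ?divr_gt0//.
  apply: le_trans nt _.
  by apply: le_trans (expR_ge1Dx _); rewrite lerDr.
rewrite -[X in _ --> X](subrr 0); apply: cvgB.
  apply: (lim (fun n => n%:R)) => n; apply: le_trans (lerB_dist _ _).
  by rewrite lerD2r ler_norm.
apply: (lim (fun n => - n%:R)) => n; apply: le_trans (lerB_dist _ _).
by rewrite lerD2r normrN ler_norm.
Unshelve. all: end_near. Qed.

Local Notation I q := (\int[mu]_x (q x * p x)).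

(** Integration by parts against the Gaussian density: multiplication by the
    centred variable is, up to the variance, adjoint to differentiation. *)
Lemma normal_integration_by_parts (q q' : R -> R) :
  (forall x : R, is_derive x 1 q (q' x)) -> continuous q' ->
  quad q -> quad q' -> quad (fun x => (x - m) * q x) ->
  I q' = I (fun x => (x - m) * q x) / s ^+ 2.
Proof.
move=> dq cq' bq bq' bxq.
have cq : continuous q.
  by move=> x; apply: differentiable_continuous; apply/derivable1_diffP; case: (dq x).
have mq' : measurable_fun setT q' by exact: continuous_measurable_fun.
have mxq : measurable_fun setT (fun x : R => (x - m) * q x).
  apply: measurable_funM; last exact: continuous_measurable_fun.
  by apply: measurable_funB.
have i1 := integrable_quad mq' bq'.
have i2 := integrable_quad mxq bxq.
have i2' : mu.-integrable setT
    (EFin \o (fun x => (s ^+ 2)^-1 * ((x - m) * q x * p x))).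
  have := @integrableZl _ _ _ mu setT measurableT (s ^+ 2)^-1 _ i2.
  by apply: eq_integrable.
have H : \int[mu]_x (q' x * p x - (s ^+ 2)^-1 * ((x - m) * q x * p x)) = 0.
  apply: (@integral_derivative_eq0 (fun x => q x * p x)).
  - move=> x; have := dq x; have := is_derive_normal_pdf x => dp dqx.
    by apply: is_derive_eq; rewrite /GRing.scale/=; field.
  - move=> x; apply: cvgB; first by apply: cvgM; [exact: cq'|exact: continuous_p].
    apply: cvgM; first exact: cvg_cst.
    apply: cvgM; last exact: continuous_p.
    apply: cvgM; last exact: cq.
    by apply: cvgB; [exact: cvg_id|exact: cvg_cst].
  - rewrite /comp; under eq_fun do rewrite EFinB.
    by apply: integrableB.
  - exact: quad_cvg0.
have := H; rewrite RintegralB// RintegralZl// => /eqP.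
by rewrite subr_eq0 => /eqP ->; rewrite mulrC.
Qed.

Let quad_of q (A B : R) : 0 <= A -> 0 <= B ->
  (forall x, `|q x| <= A + B * (x - m) ^+ 2) -> quad q.
Proof.
move=> A0 B0 qAB; exists (A + B * (s ^+ 2 *+ 2)) => x.
rewrite (le_trans (qAB x))//.
have tE : t x * (s ^+ 2 *+ 2) = (x - m) ^+ 2.
  by rewrite /t divfK// mulrn_eq0/= gt_eqF.
have S0 : 0 <= B * (s ^+ 2 *+ 2) by rewrite mulr_ge0// mulrn_wge0// sqr_ge0.
have T0 := mulr_ge0 A0 (t_ge0 x).
by rewrite -tE; move: (s ^+ 2 *+ 2) S0 => S S0; lra.
Qed.

Lemma Rintegral_normal_pdf : \int[mu]_x p x = 1.
Proof. by rewrite /Rintegral integral_normal_pdf. Qed.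

Lemma normal_mean : I (fun x => x - m) = 0.
Proof.
have e : I (fun=> 0) = I (fun x => (x - m) * 1) / s ^+ 2.
  apply: (@normal_integration_by_parts (fun=> 1) (fun=> 0)).
  - exact: cst_continuous.
  - by apply: (@quad_of _ 1 0) => // x; rewrite normr1 mul0r addr0.
  - by apply: (@quad_of _ 0 0) => // x; rewrite normr0 mul0r addr0.
  - apply: (@quad_of _ 1 1) => // x; rewrite mulr1 mul1r.
    rewrite -[X in _ <= _ + X]real_normK ?num_real//.
    have := normr_ge0 (x - m); move: `|x - m| => z z0; nra.
move: e; under eq_Rintegral do rewrite mul0r; under [X in _ = X / _]eq_Rintegral do rewrite mulr1.
rewrite /Rintegral integral0 /= => /esym/eqP.
by rewrite mulf_eq0 invr_eq0 (gt_eqF s2_gt0) orbF => /eqP.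
Qed.

Lemma normal_variance : I (fun x => (x - m) ^+ 2) = s ^+ 2.
Proof.
have e : I (fun=> 1) = I (fun x => (x - m) * (x - m)) / s ^+ 2.
  apply: (@normal_integration_by_parts (fun x => x - m) (fun=> 1)).
  - by move=> x; apply: is_derive_eq; rewrite subr0.
  - exact: cst_continuous.
  - apply: (@quad_of _ 1 1) => // x; rewrite mul1r.
    rewrite -[X in _ <= _ + X]real_normK ?num_real//.
    have := normr_ge0 (x - m); move: `|x - m| => z z0; nra.
  - by apply: (@quad_of _ 1 0) => // x; rewrite normr1 mul0r addr0.
  - apply: (@quad_of _ 0 1) => // x.
    by rewrite add0r mul1r -expr2 ger0_norm ?sqr_ge0.
move: e; under eq_Rintegral do rewrite mul1r; rewrite Rintegral_normal_pdf => e.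
by apply/esym; rewrite -[LHS]mul1r e divfK// gt_eqF.
Qed.

Let d1 (theta u x : R) :
  partial1of2 (fun u x => cos (u * (x - m) + theta) * p x) u x =
  - ((x - m) * sin (u * (x - m) + theta)) * p x.
Proof.
rewrite partial1of2E.
have : is_derive u 1 (fun u => cos (u * (x - m) + theta) * p x)
   (- ((x - m) * sin (u * (x - m) + theta)) * p x).
  have hl : is_derive u 1 (fun u => u * (x - m) + theta) (x - m).
    by apply: is_derive_eq; rewrite /GRing.scale/=; ring.
  have := @is_derive1_comp _ cos _ u _ _ (is_derive_cos _) hl => hc.
  by apply: is_derive_eq; rewrite /GRing.scale/=; ring.
by case.
Qed.

(** The characteristic function solves the differential equation
    c' = - s^2 u c, which is integration by parts in disguise. *)
Lemma normal_cos (theta u : R) :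
  I (fun x => cos (u * (x - m) + theta)) = cos theta * expR (- (s ^+ 2 * u ^+ 2 / 2)).
Proof.
pose c (u : R) : R := I (fun x => cos (u * (x - m) + theta)).
have ml v : measurable_fun setT (fun x : R => v * (x - m) + theta).
  apply: measurable_funD => //; apply: measurable_funM => //.
  by apply: measurable_funB.
have mcos v : measurable_fun setT (fun x : R => cos (v * (x - m) + theta)).
  exact: measurable_cos_comp.
have msin v : measurable_fun setT (fun x : R => sin (v * (x - m) + theta)).
  apply: (measurableT_comp _ (ml v)); apply: continuous_measurable_fun.
  exact: continuous_sin.
have bcos v : quad (fun x => cos (v * (x - m) + theta)).
  by apply: (@quad_of _ 1 0) => // x; rewrite mul0r addr0 ler_norml cos_geN1 cos_le1.
have bsin v : quad (fun x => sin (v * (x - m) + theta)).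
  by apply: (@quad_of _ 1 0) => // x; rewrite mul0r addr0 ler_norml sin_geN1 sin_le1.
have dc (v : R) : is_derive v 1 c (- (s ^+ 2 * v) * c v).
  have vI : `]v - 1, v + 1[%classic v by rewrite /= in_itv/=; lra.
  have intf (x : R) : `]v - 1, v + 1[%classic x ->
      mu.-integrable setT (EFin \o (fun y => cos (x * (y - m) + theta) * p y)).
    by move=> _; exact: integrable_quad.
  have derf (x y : R) : `]v - 1, v + 1[%classic x -> setT y ->
      derivable (fun x : R => cos (x * (y - m) + theta) * p y) x 1.
    move=> _ _.
    have hl : is_derive x 1 (fun u : R => u * (y - m) + theta) (y - m).
      by apply: is_derive_eq; rewrite /GRing.scale/=; ring.
    have := @is_derive1_comp _ cos _ x _ _ (is_derive_cos _) hl => hc.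
    by apply: derivableM => //; case: hc.
  pose G (y : R) : R := `|(y - m) * p y|.
  have G0 y : 0 <= G y by exact: normr_ge0.
  have iG : mu.-integrable setT (EFin \o G).
    apply: integrable_norm; apply: integrable_quad; first exact: measurable_funB.
    apply: (@quad_of _ 1 1) => // x; rewrite mul1r.
    rewrite -[X in _ <= _ + X]real_normK ?num_real//.
    have := normr_ge0 (x - m); move: `|x - m| => z z0; nra.
  have Gub (x y : R) : `]v - 1, v + 1[%classic x -> setT y ->
     `|partial1of2 (fun u x => cos (u * (x - m) + theta) * p x) x y| <= G y.
    move=> _ _; rewrite d1 /G !normrM normrN normrM ler_wpM2r// ler_piMr//.
    by rewrite ler_norml sin_geN1 sin_le1.
  have e := differentiation_under_integral measurableT vI intf derf G0 iG Gub.
  have d := derivable_under_integral measurableT vI intf derf G0 iG Gub.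
  apply: DeriveDef; first exact: d.
  rewrite -derive1E; apply: etrans e _.
  have ibp : I (fun x => v * cos (v * (x - m) + theta)) =
      I (fun x => (x - m) * sin (v * (x - m) + theta)) / s ^+ 2.
    apply: (@normal_integration_by_parts (fun x => sin (v * (x - m) + theta))
      (fun x => v * cos (v * (x - m) + theta))).
    - move=> x; have hl : is_derive x 1 (fun x : R => v * (x - m) + theta) v.
        by apply: is_derive_eq; rewrite /GRing.scale/=; ring.
      have := @is_derive1_comp _ sin _ x _ _ (is_derive_sin _) hl => hc.
      by apply: is_derive_eq; ring.
    - move=> x; apply: cvgM; first exact: cvg_cst.
      apply: (cvg_comp _ cos); last exact: continuous_cos.
      apply: cvgD; last exact: cvg_cst.
      apply: cvgM; first exact: cvg_cst.
      by apply: cvgB; [exact: cvg_id|exact: cvg_cst].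
    - exact: bsin.
    - apply: (@quad_of _ `|v| 0) => // x; rewrite mul0r addr0 normrM ler_piMr//.
      by rewrite ler_norml cos_geN1 cos_le1.
    - apply: (@quad_of _ 1 1) => // x; rewrite mul1r normrM.
      apply: (@le_trans _ _ `|x - m|).
        by rewrite ler_piMr// ler_norml sin_geN1 sin_le1.
      rewrite -[X in _ <= _ + X]real_normK ?num_real//.
      have := normr_ge0 (x - m); move: `|x - m| => z z0; nra.
  have iv := integrable_quad (mcos v) (bcos v).
  rewrite [LHS](_ : _ = - I (fun x => (x - m) * sin (v * (x - m) + theta))); last first.
    rewrite -[RHS]mulN1r -RintegralZl//; last first.
      apply: integrable_quad.
        by apply: measurable_funM; [exact: measurable_funB|].
      apply: (@quad_of _ 1 1) => // x; rewrite mul1r normrM.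
      apply: (@le_trans _ _ `|x - m|).
        by rewrite ler_piMr// ler_norml sin_geN1 sin_le1.
      rewrite -[X in _ <= _ + X]real_normK ?num_real//.
      have := normr_ge0 (x - m); move: `|x - m| => z z0; nra.
    by apply: eq_Rintegral => x _; rewrite d1; ring.
  have -> : I (fun x => (x - m) * sin (v * (x - m) + theta)) =
      s ^+ 2 * I (fun x => v * cos (v * (x - m) + theta)).
    by rewrite ibp mulrC divfK// gt_eqF.
  rewrite /c; have -> : I (fun x => v * cos (v * (x - m) + theta)) =
      v * I (fun x => cos (v * (x - m) + theta)).
    by rewrite -RintegralZl//; apply: eq_Rintegral => x _; rewrite mulrA.
  by ring.
pose F (v : R) : R := c v * expR (s ^+ 2 * v ^+ 2 / 2).
have dF (v : R) : is_derive v 1 F 0.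
  have hl : is_derive v 1 (fun v : R => s ^+ 2 * v ^+ 2 / 2) (s ^+ 2 * v).
    by apply: is_derive_eq; rewrite /GRing.scale/=; field.
  have := @is_derive1_comp _ expR _ v _ _ (is_derive_expR _) hl => he.
  have := dc v => dcv.
  by apply: is_derive_eq; rewrite /GRing.scale/=; ring.
have : F u = F 0 by exact: is_derive_0_is_cst.
have c0 : c 0 = cos theta.
  rewrite /c; under eq_Rintegral do rewrite mul0r add0r.
  rewrite RintegralZl//; first by rewrite Rintegral_normal_pdf mulr1.
  exact: integrable_normal_pdf.
rewrite /F c0 expr0n /= mulr0 mul0r expR0 mulr1 => <-.
by rewrite -mulrA -expRD subrr expR0 mulr1.
Qed.

End NormalDensity.

Section ChangeOfMeasure.
Context (R : realType).

Import HBNNSimple.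

(** A measure with density [q] integrates [f] as the reference measure
    integrates [f * q]; this goes from indicators to simple functions and then
    by monotone convergence. *)
Lemma ge0_integral_density (d : measure_display) (T : measurableType d)
    (mu nu : {measure set T -> \bar R}) (q : T -> R) (f : T -> \bar R) :
  measurable_fun setT q -> (forall x, 0 <= q x) ->
  (forall A, measurable A -> nu A = \int[mu]_(x in A) (q x)%:E)%E ->
  measurable_fun setT f -> (forall x, 0 <= f x)%E ->
  (\int[nu]_x f x = \int[mu]_x (f x * (q x)%:E))%E.
Proof.
move=> mq q0 nuq mf f0.
pose h := nnsfun_approx measurableT mf.
have fh x : (h n x)%:E @[n --> \oo] --> f x.
  by apply: cvg_nnsfun_approx.
have ndh x : {homo (fun n => h n x) : a b / (a <= b)%N >-> a <= b}.
  by move=> a b ab; exact/lefP/nd_nnsfun_approx.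
have c1 : (\int[nu]_x (h n x)%:E @[n --> \oo] --> \int[nu]_x f x)%E.
  rewrite [X in _ --> X](_ : _ = (\int[nu]_x limn (fun n => (h n x)%:E))%E).
    apply: cvg_monotone_convergence => //.
    - by move=> n; exact/measurable_EFinP.
    - by move=> n x _; rewrite lee_fin.
    - by move=> x _ a b ab; rewrite lee_fin; exact: ndh.
  by apply: eq_integral => x _; apply/esym/cvg_lim => //; exact: fh.
have c2 : (\int[mu]_x ((h n x)%:E * (q x)%:E) @[n --> \oo] -->
           \int[mu]_x (f x * (q x)%:E))%E.
  rewrite [X in _ --> X](_ : _ =
      (\int[mu]_x limn (fun n => (h n x)%:E * (q x)%:E))%E).
    apply: cvg_monotone_convergence => //.
    - by move=> n; apply: emeasurable_funM; exact/measurable_EFinP.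
    - by move=> n x _; rewrite -EFinM lee_fin mulr_ge0.
    - by move=> x _ a b ab; rewrite -!EFinM lee_fin ler_wpM2r// ndh.
  apply: eq_integral => x _; apply/esym/cvg_lim => //.
  by apply: cvgeZr => //; exact: fh.
suff e : (fun n => \int[nu]_x (h n x)%:E)%E =
         (fun n => \int[mu]_x ((h n x)%:E * (q x)%:E))%E.
  by rewrite e in c1; exact: (cvg_unique _ c1 c2).
apply/funext => n; rewrite integralT_nnsfun sintegralE.
have mr r : measurable (h n @^-1` [set r]).
  by rewrite -[X in measurable X]setTI; apply: measurable_funP.
transitivity (\int[mu]_x (\sum_(r \in range (h n))
    (r%:E * ((\1_(h n @^-1` [set r]) x)%:E * (q x)%:E))))%E; last first.
  apply: eq_integral => x _; rewrite fimfunE -fsumEFin// ge0_mule_fsuml.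
    by apply: eq_fsbigr => r _; rewrite EFinM muleA.
  by move=> r; exact: nnfun_muleindic_ge0.
have q1 r x : (0 <= (\1_(h n @^-1` [set r]) x)%:E * (q x)%:E)%E.
  by rewrite -EFinM lee_fin mulr_ge0// indicE.
have m1 r : measurable_fun setT
    (fun x => ((\1_(h n @^-1` [set r]) x)%:E * (q x)%:E)%E).
  by apply: emeasurable_funM; apply/measurable_EFinP => //; exact: measurable_indic.
rewrite ge0_integral_fsum//; first last.
- by move=> r x _; rewrite muleA mule_ge0 ?lee_fin//; exact: nnfun_muleindic_ge0.
- by move=> r; exact: measurable_funeM.
apply: eq_fsbigr => r; rewrite inE => -[x _ <-].
rewrite ge0_integralZl//; last by rewrite lee_fin.
congr (_ * _)%E; rewrite nuq// integral_mkcond; apply: eq_integral => y _.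
by rewrite patchE indicE; case: ifP => _; rewrite ?mul1e ?mul0e.
Qed.

Lemma Rintegral_density (d : measure_display) (T : measurableType d)
    (mu nu : {measure set T -> \bar R}) (q f : T -> R) :
  measurable_fun setT q -> (forall x, 0 <= q x) ->
  (forall A, measurable A -> nu A = \int[mu]_(x in A) (q x)%:E)%E ->
  measurable_fun setT f -> \int[nu]_x f x = \int[mu]_x (f x * q x).
Proof.
move=> mq q0 nuq mf; rewrite /Rintegral; congr fine.
have mfE : measurable_fun setT (EFin \o f) by exact/measurable_EFinP.
rewrite integralE [RHS]integralE.
rewrite (ge0_integral_density mq q0 nuq (measurable_funepos mfE))//.
rewrite (ge0_integral_density mq q0 nuq (measurable_funeneg mfE))//.
congr (_ - _)%E; apply: eq_integral => x _.
  rewrite !funeposE /= -!EFin_max -EFinM; congr EFin.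
  by rewrite maxr_pMl// mul0r.
rewrite !funenegE /= -!EFin_max -EFinM; congr EFin.
by rewrite maxr_pMl// mul0r mulNr.
Qed.

(** Only the law of a random variable matters for expectations of functions of
    it. *)
Lemma eq_law_Rintegral d1 d2 (T1 : measurableType d1) (T2 : measurableType d2)
    (P : probability T1 R) (Q : probability T2 R) (Y : T1 -> R) (V : T2 -> R)
    (f : R -> R) :
  measurable_fun setT Y -> measurable_fun setT V ->
  (forall B, measurable B -> P (Y @^-1` B) = Q (V @^-1` B)) ->
  measurable_fun setT f -> \int[P]_w f (Y w) = \int[Q]_w f (V w).
Proof.
move=> mY mV PQ mf; rewrite /Rintegral; congr fine.
pose Y' : {mfun T1 >-> R} := HB.pack Y (isMeasurableFun.Build _ _ _ _ _ mY).
pose V' : {mfun T2 >-> R} := HB.pack V (isMeasurableFun.Build _ _ _ _ _ mV).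
have e (g : R -> \bar R) : measurable_fun setT g -> (forall x, 0 <= g x)%E ->
    (\int[P]_w g (Y w) = \int[Q]_w g (V w))%E.
  move=> mg g0.
  rewrite -[LHS](@ge0_integral_distribution _ _ _ _ _ P Y' g)//.
  rewrite -[RHS](@ge0_integral_distribution _ _ _ _ _ Q V' g)//.
  by apply: eq_measure_integral => B mB _; exact: PQ.
have mfE : measurable_fun setT (EFin \o f) by exact/measurable_EFinP.
rewrite integralE [RHS]integralE; congr (_ - _)%E.
  transitivity (\int[P]_w (EFin \o f)^\+ (Y w))%E.
    by apply: eq_integral => w _; rewrite !funeposE.
  rewrite (e _ (measurable_funepos mfE))//.
  by apply: eq_integral => w _; rewrite !funeposE.
transitivity (\int[P]_w (EFin \o f)^\- (Y w))%E.
  by apply: eq_integral => w _; rewrite !funenegE.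
rewrite (e _ (measurable_funeneg mfE))//.
by apply: eq_integral => w _; rewrite !funenegE.
Qed.

End ChangeOfMeasure.

(** * Uniqueness of laws on the line *)

Section SmoothStep.
Context (R : realType).

(** This polynomial preserves the unit interval and is repelled by 1/2: its
    iterates tend to 0 on the left and to 1 on the right. *)
Definition smoothstep (x : R) : R := x * x * (3 - 2 * x).

Lemma smoothstep_itv x : 0 <= x <= 1 -> 0 <= smoothstep x <= 1.
Proof.
move=> /andP[x0 x1]; rewrite /smoothstep; apply/andP; split.
  by rewrite !mulr_ge0//; lra.
have y0 : 0 <= (1 - x) * (1 - x) * (1 + 2 * x) by rewrite !mulr_ge0//; lra.
by rewrite -subr_ge0; apply: le_trans y0 _; rewrite le_eqVlt; apply/orP; left; apply/eqP; ring.
Qed.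

Lemma iter_smoothstep_itv x k : 0 <= x <= 1 -> 0 <= iter k smoothstep x <= 1.
Proof. by move=> x01; elim: k => //= k ih; exact: smoothstep_itv. Qed.

Let iter_small x k : 0 <= x < 2^-1 ->
  0 <= iter k smoothstep x <= x * (x * (3 - 2 * x)) ^+ k.
Proof.
move=> /andP[x0 x1]; pose c := x * (3 - 2 * x).
have c0 : 0 <= c by rewrite mulr_ge0//; lra.
have c1 : c <= 1 by rewrite /c; nra.
elim: k => [|k /andP[y0 yx]] /=; first by rewrite expr0 mulr1 x0 /=.
move: (iter k smoothstep x) y0 yx => y y0 yx.
have yx' : y <= x by apply: le_trans yx _; rewrite ler_piMr// exprn_ile1.
rewrite /smoothstep -/c; apply/andP; split; first by rewrite !mulr_ge0//; lra.
have yc : y * (3 - 2 * y) <= c by rewrite /c; nra.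
have yy : 0 <= y * (3 - 2 * y) by rewrite mulr_ge0//; lra.
by have := ler_pM y0 yy yx yc; rewrite exprSr !mulrA.
Qed.

Lemma iter_smoothstep_lt x : 0 <= x < 2^-1 ->
  iter k smoothstep x @[k --> \oo] --> (0 : R).
Proof.
move=> x01; have /andP[x0 x1] := x01.
have c0 : 0 <= x * (3 - 2 * x) by rewrite mulr_ge0//; lra.
have c1 : x * (3 - 2 * x) < 1 by nra.
apply: (squeeze_cvgr (f := fun=> 0) (h := fun k => x * (x * (3 - 2 * x)) ^+ k)).
- by apply: nearW => k; exact: iter_small.
- exact: cvg_cst.
- rewrite -[X in _ --> X](mulr0 x); apply: cvgM; first exact: cvg_cst.
  by apply: cvg_expr; rewrite ger0_norm.
Qed.

Lemma iter_smoothstep_half k : iter k smoothstep 2^-1 = 2^-1.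
Proof. by elim: k => //= k ->; rewrite /smoothstep; field. Qed.

Lemma iter_smoothstep_gt x : 2^-1 < x <= 1 ->
  iter k smoothstep x @[k --> \oo] --> (1 : R).
Proof.
move=> /andP[x0 x1].
have e k : iter k smoothstep x = 1 - iter k smoothstep (1 - x).
  elim: k => [|k ih] /=; first by rewrite subKr.
  by rewrite ih; move: (iter k _ _) => y; rewrite /smoothstep; ring.
have h : iter k smoothstep (1 - x) @[k --> \oo] --> (0 : R).
  by apply: iter_smoothstep_lt; lra.
have -> : (fun k => iter k smoothstep x) =
    (fun k => 1 - iter k smoothstep (1 - x)) by apply/funext.
by have := cvgB (cvg_cst (1 : R)) h; rewrite subr0; exact.
Qed.

End SmoothStep.

Section LawUniqueness.
Context (R : realType) (d1 d2 : measure_display).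
Context (T1 : measurableType d1) (T2 : measurableType d2).
Variables (P : probability T1 R) (Q : probability T2 R).
Variables (H W : T1 -> R) (K V : T2 -> R).
Hypotheses (bH : bounded_measurable H) (mW : measurable_fun setT W).
Hypotheses (bK : bounded_measurable K) (mV : measurable_fun setT V).
Hypothesis HK : forall u theta,
  \int[P]_w (H w * cos (u * W w + theta)) =
  \int[Q]_w (K w * cos (u * V w + theta)).

(** The functions that the two weighted laws integrate alike, even after
    multiplication by any trigonometric function. *)
Let agree (F : R -> R) := bounded_measurable F /\ forall u theta,
  \int[P]_w (H w * (F (W w) * cos (u * W w + theta))) =
  \int[Q]_w (K w * (F (V w) * cos (u * V w + theta))).

(** As products of agreeing functions need not agree, the multipliers of the
    class are used instead: they form an algebra, and contain the
    trigonometric functions. *)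
Let mult (F : R -> R) := bounded_measurable F /\
  forall G, agree G -> agree (fun x => F x * G x).

Let bcomp (F : R -> R) d (T : measurableType d) (U : T -> R) :
  bounded_measurable F -> measurable_fun setT U ->
  bounded_measurable (fun w => F (U w)).
Proof. by move=> [mF bF] mU; exact: (bounded_measurable_comp mF bF mU). Qed.

Let maff d (T : measurableType d) (U : T -> R) u theta :
  measurable_fun setT U -> measurable_fun setT (fun w => u * U w + theta).
Proof. by move=> mU; apply: measurable_funD => //; exact: measurable_funM. Qed.

Let bterm d (T : measurableType d) (U h : T -> R) F u theta :
  bounded_measurable h -> measurable_fun setT U -> bounded_measurable F ->
  bounded_measurable (fun w => h w * (F (U w) * cos (u * U w + theta))).
Proof.
move=> bh mU bF; apply: bounded_measurableM => //; apply: bounded_measurableM.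
  exact: bcomp.
by apply: bounded_measurable_cos; exact: maff.
Qed.

Let agree1 : agree (fun=> 1).
Proof.
split; first exact: bounded_measurable_cst.
move=> u theta; under eq_Rintegral do rewrite mul1r.
by under [RHS]eq_Rintegral do rewrite mul1r.
Qed.

Let multM F G : mult F -> mult G -> mult (fun x => F x * G x).
Proof.
move=> [bF mF] [bG mG]; split; first exact: bounded_measurableM.
move=> L /mG /mF; congr agree; apply/funext => x; by rewrite mulrA.
Qed.

Let multD F G : mult F -> mult G -> mult (fun x => F x + G x).
Proof.
move=> [bF mF] [bG mG]; split; first exact: bounded_measurableD.
move=> L aL; have [bFL FL] := mF _ aL; have [bGL GL] := mG _ aL.
split.
  have := bounded_measurableD bFL bGL; congr bounded_measurable.
  by apply/funext => x; rewrite mulrDl.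
move=> u theta; have e d (T : measurableType d) (P' : probability T R) (U h : T -> R) :
    bounded_measurable h -> measurable_fun setT U ->
    \int[P']_w (h w * ((F (U w) + G (U w)) * L (U w) * cos (u * U w + theta))) =
    \int[P']_w (h w * (F (U w) * L (U w) * cos (u * U w + theta))) +
    \int[P']_w (h w * (G (U w) * L (U w) * cos (u * U w + theta))).
  move=> bh mU; rewrite -expectD.
  - by apply: eq_Rintegral => w _; ring.
  - exact: (@bterm _ _ U h (fun x => F x * L x)).
  - exact: (@bterm _ _ U h (fun x => G x * L x)).
by rewrite !e// FL GL.
Qed.

Let mult_cst c : mult (fun=> c).
Proof.
split; first exact: bounded_measurable_cst.
move=> L [bL aL]; split.
  by apply: bounded_measurableM => //; exact: bounded_measurable_cst.
move=> u theta; have e d (T : measurableType d) (P' : probability T R) (U h : T -> R) :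
    bounded_measurable h -> measurable_fun setT U ->
    \int[P']_w (h w * (c * L (U w) * cos (u * U w + theta))) =
    c * \int[P']_w (h w * (L (U w) * cos (u * U w + theta))).
  move=> bh mU; rewrite -expectZ; last exact: bterm.
  by apply: eq_Rintegral => w _; ring.
by rewrite !e// aL.
Qed.

Let mult_cos u' theta' : mult (fun x => cos (u' * x + theta')).
Proof.
have bc : bounded_measurable (fun x : R => cos (u' * x + theta')).
  by apply: bounded_measurable_cos; exact: maff.
split => // L [bL aL]; split; first exact: bounded_measurableM.
move=> u theta; have e d (T : measurableType d) (P' : probability T R) (U h : T -> R) :
    bounded_measurable h -> measurable_fun setT U ->
    \int[P']_w (h w * (cos (u' * U w + theta') * L (U w) * cos (u * U w + theta))) =
    2^-1 * \int[P']_w (h w * (L (U w) * cos ((u + u') * U w + (theta + theta')))) +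
    2^-1 * \int[P']_w (h w * (L (U w) * cos ((u - u') * U w + (theta - theta')))).
  move=> bh mU.
  have b1 := bterm (u + u') (theta + theta') bh mU bL.
  have b2 := bterm (u - u') (theta - theta') bh mU bL.
  have bc2 : bounded_measurable (fun _ : T => 2^-1 : R) by exact: bounded_measurable_cst.
  rewrite -(expectZ P' _ b1) -(expectZ P' _ b2).
  rewrite -(expectD P' (bounded_measurableM bc2 b1) (bounded_measurableM bc2 b2)).
  apply: eq_Rintegral => w _.
  have -> : (u + u') * U w + (theta + theta') =
    (u * U w + theta) + (u' * U w + theta') by ring.
  have -> : (u - u') * U w + (theta - theta') =
    (u * U w + theta) - (u' * U w + theta') by ring.
  move: (u * U w + theta) (u' * U w + theta') => a b.
  by rewrite cosD cosB; field.
by rewrite !e// !aL.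
Qed.

Let mult_agree F : mult F -> agree F.
Proof.
move=> [_ mF]; have := mF _ agree1; congr agree.
by apply/funext => x; rewrite mulr1.
Qed.

Let agree_cvg (F_ : nat -> R -> R) F M : (forall n, agree (F_ n)) ->
  (forall n x, `|F_ n x| <= M) -> (forall x, F_ n x @[n --> \oo] --> F x) ->
  agree F.
Proof.
move=> aF FM FF.
have mF : measurable_fun setT F.
  apply: (measurable_fun_cvg (h := F_)); first by move=> n; have [[]] := aF n.
  by move=> x _; exact: FF.
have bF x : `|F x| <= M.
  have := FF x => /cvg_norm/cvg_lim <-//; apply: limr_le; last exact: nearW.
  by apply/cvg_ex; exists `|F x|; apply: cvg_norm; exact: FF.
split; first by split => //; exists M.
move=> u theta; have e d (T : measurableType d) (P' : probability T R) (U h : T -> R) :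
    bounded_measurable h -> measurable_fun setT U ->
    \int[P']_w (h w * (F_ n (U w) * cos (u * U w + theta))) @[n --> \oo] -->
    \int[P']_w (h w * (F (U w) * cos (u * U w + theta))).
  move=> bh mU; have [mh [N hN]] := bh.
  apply: (@expect_cvg _ _ _ _ _ _ (N * M)).
  - by move=> n; apply: (bterm _ _ bh mU _).1; have [] := aF n.
  - by apply: (bterm _ _ bh mU _).1; split => //; exists M.
  - move=> n w; rewrite normrM ler_pM// normrM (le_trans _ (FM n (U w)))//.
    by rewrite ler_piMr// ler_norml cos_geN1 cos_le1.
  - apply/aeW => w; apply: cvgM; first exact: cvg_cst.
    by apply: cvgM; [exact: FF|exact: cvg_cst].
have e1 := e _ _ P W H bH mW; have e2 := e _ _ Q V K bK mV.
have e12 : (fun n => \int[P]_w (H w * (F_ n (W w) * cos (u * W w + theta)))) =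
    (fun n => \int[Q]_w (K w * (F_ n (V w) * cos (u * V w + theta)))).
  by apply/funext => n; exact: (aF n).2.
by rewrite e12 in e1; exact: (cvg_unique _ e1 e2).
Qed.

(** On an interval around [p] that grows with [N], this is above 1/2 to the right
    of [p] and below to the left. *)
Let wave (p : R) (N : nat) (x : R) : R := (1 + sin ((x - p) / N.+1%:R)) / 2.

Let wave_itv p N x : 0 <= wave p N x <= 1.
Proof.
by rewrite /wave; have := sin_geN1 ((x - p) / N.+1%:R);
  have := sin_le1 ((x - p) / N.+1%:R); lra.
Qed.

Let mult_wave p N k : mult (fun x => iter k (@smoothstep R) (wave p N x)).
Proof.
elim: k => [|k ih] /=.
  have -> : (fun x => wave p N x) =
      (fun x => 2^-1 + 2^-1 * cos ((N.+1%:R)^-1 * x + (- p / N.+1%:R - pi / 2))).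
    apply/funext => x; rewrite /wave addrA cosBpihalf.
    have -> : N.+1%:R^-1 * x + - p / N.+1%:R = (x - p) / N.+1%:R by ring.
    by field.
  by apply: multD; [exact: mult_cst|apply: multM; [exact: mult_cst|exact: mult_cos]].
rewrite /smoothstep; apply: multM; first exact: multM.
apply: multD; first exact: mult_cst.
have -> : (fun x => - (2 * iter k (@smoothstep R) (wave p N x))) =
    (fun x => (-2) * iter k (@smoothstep R) (wave p N x)).
  by apply/funext => x; rewrite mulNr.
by apply: multM => //; exact: mult_cst.
Qed.

Let step (x : R) : R := if x < 0 then 0 else if x == 0 then 2^-1 else 1.

Let agree_wave p N : agree (fun x => step (sin ((x - p) / N.+1%:R))).
Proof.
apply: (@agree_cvg (fun k x => iter k (@smoothstep R) (wave p N x)) _ 1).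
- by move=> k; apply: mult_agree; exact: mult_wave.
- move=> k x; have /andP[x0 x1] := iter_smoothstep_itv k (wave_itv p N x).
  by rewrite ger0_norm.
- move=> x; have w01 := wave_itv p N x; rewrite /step; case: ltP => [s0|].
    by apply: iter_smoothstep_lt; move: w01; rewrite /wave; lra.
  rewrite le_eqVlt eq_sym => /orP[/eqP s0|s0].
    rewrite s0 eqxx; under eq_fun do rewrite /wave s0 addr0 mul1r iter_smoothstep_half.
    exact: cvg_cst.
  rewrite gt_eqF//; apply: iter_smoothstep_gt; move: w01; rewrite /wave; lra.
Qed.

Let step_bound x : `|step x| <= 1.
Proof.
by rewrite /step; case: ifP => _; [|case: ifP => _]; rewrite ger0_norm; lra.
Qed.

Let agree_step p : agree (fun x => step (x - p)).
Proof.
apply: (@agree_cvg (fun N x => step (sin ((x - p) / N.+1%:R))) _ 1).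
- by move=> N; exact: agree_wave.
- by move=> N x; exact: step_bound.
- move=> x; apply: cvg_near_cst; near=> N.
  have N0 : (0 : R) < N.+1%:R by rewrite ltr0n.
  have xN : `|x - p| / N.+1%:R < pi.
    rewrite ltr_pdivrMr// (@lt_le_trans _ _ (2 * N.+1%:R))//; last first.
      by apply: ler_wpM2r; [exact: ltW|exact: pi_ge2].
    have : `|x - p| <= N%:R by near: N; exact: nbhs_infty_ger.
    have := normr_ge0 (x - p); rewrite -natr1; lra.
  have [xp|xp|xp] := ltgtP (x - p) 0.
  - have s0 : sin ((x - p) / N.+1%:R) < 0.
      rewrite -[X in sin X]opprK sinN oppr_lt0 sin_gt0_pi//.
      rewrite -mulNr divr_gt0 ?oppr_gt0//=.
      by move: xN; rewrite ltr0_norm.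
    by rewrite /step s0 xp.
  - have s0 : 0 < sin ((x - p) / N.+1%:R).
      rewrite sin_gt0_pi// divr_gt0//=.
      by move: xN; rewrite gtr0_norm.
    by rewrite /step ltNge ltW//= gt_eqF// ltNge ltW//= gt_eqF.
  - by rewrite xp mul0r sin0.
Unshelve. all: end_near. Qed.

Let agree_ray p : agree (\1_(`]p, +oo[%classic : set R) : R -> R).
Proof.
apply: (@agree_cvg (fun k x => step (x - (p + k.+1%:R^-1))) _ 1).
- by move=> k; exact: agree_step.
- by move=> k x; exact: step_bound.
- move=> x; rewrite indicE; have [xp|xp] := leP x p.
    rewrite memNset/=; last by rewrite in_itv/= andbT ltNge xp.
    apply: cvg_near_cst; apply: nearW => k; rewrite /step.
    have k0 : (0 : R) < k.+1%:R^-1 by rewrite invr_gt0 ltr0n.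
    by rewrite subr_lt0 (le_lt_trans xp)// ltrDl.
  rewrite mem_set/=; last by rewrite in_itv/= andbT.
  apply: cvg_near_cst; near=> k.
  have kx : k.+1%:R^-1 < x - p.
    near: k; have xp0 : 0 < x - p by rewrite subr_gt0.
    exact: near_infty_natSinv_lt (PosNum xp0).
  have x0 : 0 < x - (p + k.+1%:R^-1) by rewrite subr_gt0 -ltrBrDl.
  by rewrite /step ltNge ltW//= gt_eqF.
Unshelve. all: end_near. Qed.

(** A weighted law on the line is determined by its characteristic function.
    Rather than inverting a Fourier transform, the indicator of a ray is
    approximated boundedly by trigonometric polynomials: iterating the smooth
    step polynomial sharpens a slow sine wave into a step function. *)
Lemma weighted_law_unique (B : set R) : measurable B ->
  \int[P]_w (H w * \1_B (W w)) = \int[Q]_w (K w * \1_B (V w)).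
Proof.
pose C : set (set R) := [set B | exists p, B = `]p, +oo[%classic].
have CE : @measurable _ R = <<s C >> by exact: RGenOInfty.measurableE.
have int1 d (T : measurableType d) (P' : probability T R) (U h : T -> R) B' :
  \int[P']_w (h w * (\1_B' (U w) * cos (0 * U w + 0))) =
  \int[P']_w (h w * \1_B' (U w)).
  by apply: eq_Rintegral => w _; rewrite mul0r addr0 cos0 mulr1.
rewrite CE; apply: expect_dynkin2 => //.
- move=> A; rewrite -CE => mA; rewrite -[X in measurable X]setTI; exact: mW.
- move=> A; rewrite -CE => mA; rewrite -[X in measurable X]setTI; exact: mV.
- move=> _ _ [p ->] [q ->]; exists (Num.max p q).
  by apply/seteqP; split => x /=; rewrite !in_itv/= !andbT gt_max;
    [move=> [-> ->]|move=> /andP[]].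
- have := HK 0 0; under eq_Rintegral do rewrite mul0r addr0 cos0 mulr1.
  by under [RHS]eq_Rintegral do rewrite mul0r addr0 cos0 mulr1.
- move=> _ [p ->]; have [_ /(_ 0 0)] := agree_ray p; rewrite int1 => ->.
  by rewrite int1.
Qed.

End LawUniqueness.

(** * Gaussian random variables *)

Section GaussianExpectation.
Context (R : realType) (d : measure_display) (T : measurableType d).
Variable P : probability T R.
Local Notation mu := (@lebesgue_measure R).
Local Notation E f := (\int[P]_w f w).

Lemma Rintegral_normal (m s : R) (f : R -> R) : measurable_fun setT f ->
  \int[normal_prob m s]_x f x = \int[mu]_x (f x * normal_pdf m s x).
Proof.
move=> mf; apply: Rintegral_density => //.
- exact: measurable_normal_pdf.
- by move=> x; exact: normal_pdf_ge0.
Qed.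

(** A random variable with a Gaussian law is pinned down by its first two
    moments, including in the degenerate case of a constant. *)
Lemma gaussian_cos (Y : T -> R) (V theta : R) : measurable_fun setT Y ->
  gaussian P Y -> E Y = 0 -> (\int[P]_w (Y w ^+ 2)%:E = V%:E)%E ->
  E (fun w => cos (Y w + theta)) = cos theta * expR (- (V / 2)).
Proof.
move=> mY [m [s law]] EY EY2.
have mcos : measurable_fun setT (fun x : R => cos (x + theta)).
  by apply: measurable_cos_comp; apply: measurable_funD.
have EV : E (fun w => Y w ^+ 2) = V by rewrite /Rintegral EY2.
have iY2 : P.-integrable setT (EFin \o (fun w => Y w ^+ 2)).
  apply/integrableP; split; first by apply/measurable_EFinP; exact: measurable_funX.
  under eq_integral do rewrite /= ger0_norm ?sqr_ge0//.
  by rewrite EY2 ltry.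
have iY : P.-integrable setT (EFin \o Y).
  have i1 : P.-integrable setT (EFin \o (fun w => 1 + Y w ^+ 2)).
    rewrite /comp; under eq_fun do rewrite EFinD.
    apply: integrableD => //.
    by apply: integrable_bounded; exact: bounded_measurable_cst.
  apply: le_integrable i1 => //; first exact/measurable_EFinP.
  move=> w _; rewrite /= lee_fin [leRHS]ger0_norm; last first.
    by rewrite addr_ge0// sqr_ge0.
  rewrite -[X in _ <= _ + X]real_normK ?num_real//.
  have := normr_ge0 (Y w); move: `|Y w| => z z0; nra.
have EYm : E (fun w => Y w - m) = - m.
  rewrite RintegralB//; first by rewrite EY expect_cst sub0r.
  by apply: integrable_bounded; exact: bounded_measurable_cst.
have [s0|s0] := eqVneq s 0.
  have lawE f : measurable_fun setT f -> E (fun w => f (Y w)) = f m.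
    move=> mf; rewrite (@eq_law_Rintegral _ _ _ _ _ P (\d_m) Y id f)//.
      have mfE : measurable_fun setT (fun x => (f x)%:E) by exact/measurable_EFinP.
      by rewrite /Rintegral integral_dirac// diracT mul1e.
    by move=> B mB; rewrite law// /gaussian_law s0 eqxx.
  have m0 : m = 0 by have := lawE id (@measurable_id _ _ _); rewrite EY.
  have V0 : V = 0.
    rewrite -EV (lawE (fun x => x ^+ 2)); first by rewrite m0 expr0n.
    exact: measurable_funX.
  by rewrite (lawE (fun x => cos (x + theta)))// m0 V0 add0r mul0r oppr0 expR0 mulr1.
have lawE f : measurable_fun setT f ->
    E (fun w => f (Y w)) = \int[mu]_x (f x * normal_pdf m s x).
  move=> mf; rewrite -Rintegral_normal//.
  apply: (@eq_law_Rintegral _ _ _ _ _ P (normal_prob m s) Y id f) => //.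
  by move=> B mB; rewrite law// /gaussian_law (negbTE s0).
have m0 : m = 0.
  have := lawE (fun x => x - m) (measurable_funB (@measurable_id _ _ _) (@measurable_cst _ _ _ _ _ _)).
  by rewrite EYm normal_mean// => /eqP; rewrite oppr_eq0 => /eqP.
have Vs : V = s ^+ 2.
  rewrite -EV (lawE (fun x => x ^+ 2)); last exact: measurable_funX.
  by rewrite -(@normal_variance _ m)// m0; under [RHS]eq_Rintegral do rewrite subr0.
rewrite (lawE (fun x => cos (x + theta)))// Vs.
have := @normal_cos _ m s s0 theta 1; rewrite expr1n mulr1 => <-.
by rewrite m0; under [RHS]eq_Rintegral do rewrite mul1r subr0.
Qed.

End GaussianExpectation.

Section VanishingWeights.
Context (R : realType) (d : measure_display) (T : measurableType d).
Variables (P : probability T R) (I : eqType) (Z : I -> T -> R).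
Hypothesis mZ : forall i, measurable_fun setT (Z i).
Local Notation E f := (\int[P]_w f w).

Let mcomb (s : seq I) (c : I -> R) (theta : R) :
  measurable_fun setT (fun w => \sum_(i <- s) c i * Z i w + theta).
Proof.
apply: measurable_funD => //; elim: s => [|i s ih].
  by under eq_fun do rewrite big_nil; exact: measurable_cst.
under eq_fun do rewrite big_cons; apply: measurable_funD => //.
exact: measurable_funM.
Qed.

Lemma bounded_measurable_set_indic (Y : T -> R) (B : set R) :
  measurable_fun setT Y -> measurable B ->
  bounded_measurable (fun w => \1_B (Y w) : R).
Proof.
move=> mY mB; apply: (bounded_measurable_comp (f := \1_B)) => //.
by have [_] := @bounded_measurable_indic R _ R B mB.
Qed.

(** The coordinates are traded for indicators one at a time. *)
Lemma expect_box_eq0 (s : seq I) (D : T -> R) (B : I -> set R) : uniq s ->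
  bounded_measurable D -> (forall i, measurable (B i)) ->
  (forall c theta,
    E (fun w => D w * cos (\sum_(i <- s) c i * Z i w + theta)) = 0) ->
  E (fun w => D w * \prod_(i <- s) \1_(B i) (Z i w)) = 0.
Proof.
move=> + + mB; elim: s D => [|k s ih] D /=.
  move=> _ bD /(_ (fun=> 0) 0).
  under eq_Rintegral do rewrite big_nil add0r cos0 mulr1.
  by under [in X in _ -> X]eq_Rintegral do rewrite big_nil mulr1.
move=> /andP[ks us] bD D0.
have bB : bounded_measurable (fun w => \1_(B k) (Z k w) : R).
  exact: bounded_measurable_set_indic.
under eq_Rintegral do rewrite big_cons mulrA.
apply: (ih (fun w => D w * \1_(B k) (Z k w))) => //.
  exact: bounded_measurableM.
move=> c theta.
pose S w := \sum_(i <- s) c i * Z i w + theta.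
have bS : bounded_measurable (fun w => D w * cos (S w)).
  by apply: bounded_measurableM => //; apply: bounded_measurable_cos; exact: mcomb.
have b0 : bounded_measurable (fun _ : T => 0 : R) by exact: bounded_measurable_cst.
have key u t : E (fun w => D w * cos (S w) * cos (u * Z k w + t)) =
               E (fun w => 0 * cos (u * Z k w + t)).
  under [RHS]eq_Rintegral do rewrite mul0r.
  rewrite expect_cst.
  pose cc v i := if i == k then v else c i.
  have ccE v w : \sum_(i <- k :: s) cc v i * Z i w = v * Z k w + \sum_(i <- s) c i * Z i w.
    rewrite big_cons /cc eqxx; congr (_ + _); apply: eq_big_seq => i si.
    by case: eqP => [ik|//]; move: ks; rewrite -ik si.
  have e1 := D0 (cc u) (theta + t); have e2 := D0 (cc (- u)) (theta - t).
  have bt v t' : bounded_measurable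
      (fun w => D w * cos (\sum_(i <- k :: s) cc v i * Z i w + t')).
    by apply: bounded_measurableM => //; apply: bounded_measurable_cos; exact: mcomb.
  have bh (h : T -> R) : bounded_measurable h -> bounded_measurable (fun w => 2^-1 * h w).
    by move=> ?; apply: bounded_measurableM => //; exact: bounded_measurable_cst.
  transitivity (2^-1 * E (fun w => D w * cos (\sum_(i <- k :: s) cc u i * Z i w + (theta + t)))
    + 2^-1 * E (fun w => D w * cos (\sum_(i <- k :: s) cc (- u) i * Z i w + (theta - t)))).
    rewrite -(expectZ P _ (bt _ _)) -(expectZ P _ (bt _ _)).
    rewrite -(expectD P (bh _ (bt _ _)) (bh _ (bt _ _))).
    apply: eq_Rintegral => w _; rewrite !ccE.
    have -> : u * Z k w + \sum_(i <- s) c i * Z i w + (theta + t) =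
      S w + (u * Z k w + t) by rewrite /S; ring.
    have -> : - u * Z k w + \sum_(i <- s) c i * Z i w + (theta - t) =
      S w - (u * Z k w + t) by rewrite /S; ring.
    by move: (S w) (u * Z k w + t) => a b; rewrite cosD cosB; field.
  rewrite [X in _ * X + _](_ : _ = 0); last exact: e1.
  rewrite [X in _ + _ * X](_ : _ = 0); last exact: e2.
  by rewrite !mulr0 addr0.
have := weighted_law_unique bS (mZ k) b0 (mZ k) key (mB k).
under [RHS]eq_Rintegral do rewrite mul0r.
rewrite expect_cst => e; rewrite -[RHS]e.
by apply: eq_Rintegral => w _; rewrite /S; ring.
Qed.

End VanishingWeights.

(** * The posterior of a signal observed in Gaussian noise *)

Section Posterior.
Context (R : realType) (d : measure_display) (T : measurableType d).
Variables (P : probability T R) (X : T -> R).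
Hypothesis mX : measurable_fun setT X.
Local Notation E f := (\int[P]_w f w).
Local Notation mu := (@lebesgue_measure R).

Implicit Types (f : R -> R) (a b c x : R).

(** The likelihood of a value [x] of the signal, up to a factor free of [x], when
    a Gaussian noise of variance [b] is added to [b * x] and [a] is observed. *)
Definition tilt (a b x : R) : R := expR (a * x - b * x ^+ 2 / 2).

Definition tilted (f : R -> R) (a b : R) : R :=
  E (fun w => f (X w) * tilt a b (X w)).

(** The second branch only occurs for [a = 0] almost surely: nothing has been
    observed yet and the posterior is the prior. *)
Definition posterior (f : R -> R) (a b : R) : R :=
  if 0 < b then tilted f a b / tilted (fun=> 1) a b else E (fun w => f (X w)).

Lemma tilt_gt0 a b x : 0 < tilt a b x. Proof. exact: expR_gt0. Qed.

(** Completing the square. *)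
Lemma tilt_le a b x : 0 < b -> tilt a b x <= expR (a ^+ 2 / (2 * b)).
Proof.
move=> b0; rewrite ler_expR -subr_ge0.
have -> : a ^+ 2 / (2 * b) - (a * x - b * x ^+ 2 / 2) = (a - b * x) ^+ 2 / (2 * b).
  by field; rewrite gt_eqF.
by rewrite divr_ge0 ?sqr_ge0// mulr_ge0// ltW.
Qed.

Lemma measurable_tilt2 (d' : measure_display) (T' : measurableType d')
    (a b x : T' -> R) : measurable_fun setT a -> measurable_fun setT b ->
  measurable_fun setT x -> measurable_fun setT (fun z => tilt (a z) (b z) (x z)).
Proof.
move=> ma mb mx; apply: (measurableT_comp (@measurable_expR R)).
apply: measurable_funB; first exact: measurable_funM.
apply: measurable_funM; last exact: measurable_cst.
by apply: measurable_funM => //; exact: measurable_funX.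
Qed.

Lemma bounded_tilt a b f : measurable_fun setT f ->
  (exists M, forall x, `|f x| <= M) -> 0 < b ->
  bounded_measurable (fun w => f (X w) * tilt a b (X w)).
Proof.
move=> mf [M fM] b0; apply: bounded_measurableM.
  by apply: (bounded_measurable_comp mf _ mX); exists M.
split; first by apply: measurable_tilt2 => //; exact: measurable_cst.
exists (expR (a ^+ 2 / (2 * b))) => w.
by rewrite ger0_norm ?tilt_le// ltW// tilt_gt0.
Qed.

Let m1 : measurable_fun setT (fun _ : R => 1 : R).
Proof. exact: measurable_cst. Qed.

Let one_bounded : exists M : R, forall x : R, `|(fun=> 1 : R) x| <= M.
Proof. by exists 1 => x; rewrite normr1. Qed.

Lemma tilted1_gt0 a b : 0 < b -> 0 < tilted (fun=> 1) a b.
Proof.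
move=> b0; have bt := bounded_tilt a m1 one_bounded b0.
have t0 w : 0 <= 1 * tilt a b (X w) by rewrite mul1r ltW ?tilt_gt0.
have T0 : 0 <= tilted (fun=> 1) a b by apply: Rintegral_ge0 => w _; exact: t0.
rewrite lt_neqAle T0 andbT eq_sym; apply/eqP => e0.
have : (\int[P]_w `|(1 * tilt a b (X w))%:E| = 0)%E.
  under eq_integral do rewrite /= ger0_norm//.
  by rewrite expect_EFin// -[RHS]/(0%:E) -e0.
have mt : measurable_fun setT (fun w => (1 * tilt a b (X w))%:E).
  by apply/measurable_EFinP; case: bt.
move=> /(ae_eq_integral_abs P measurableT mt).1 ae0.
have : P.-negligible setT.
  apply: negligibleS ae0 => w _ /= /(_ I) [] /eqP.
  by rewrite mul1r gt_eqF ?tilt_gt0.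
move=> /(measure_negligible measurableT) P0.
have := probability_setT P; rewrite P0 => /eqP; rewrite eqe eq_sym.
by rewrite oner_eq0.
Qed.

Lemma tiltedD_cst f c a b : measurable_fun setT f ->
  (exists M, forall x, `|f x| <= M) -> 0 < b ->
  tilted (fun x => f x + c) a b = tilted f a b + c * tilted (fun=> 1) a b.
Proof.
move=> mf bf b0; have bt := bounded_tilt a mf bf b0.
have bt1 := bounded_tilt a m1 one_bounded b0.
rewrite /tilted -expectZ// -expectD//.
  by apply: eq_Rintegral => w _; ring.
by apply: bounded_measurableM => //; exact: bounded_measurable_cst.
Qed.

Lemma posteriorD_cst f c a b : measurable_fun setT f ->
  (exists M, forall x, `|f x| <= M) ->
  posterior (fun x => f x + c) a b = posterior f a b + c.
Proof.
move=> mf bf; rewrite /posterior; case: ifPn => b0.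
  rewrite tiltedD_cst// mulrDl mulfK// gt_eqF//; exact: tilted1_gt0.
rewrite expectD ?expect_cst//; last exact: bounded_measurable_cst.
exact: (bounded_measurable_comp mf bf mX).
Qed.

Lemma posterior_bound f M a b : measurable_fun setT f ->
  (forall x, `|f x| <= M) -> `|posterior f a b| <= M.
Proof.
move=> mf fM; have bf : exists M, forall x, `|f x| <= M by exists M.
rewrite /posterior; case: ifPn => b0; last first.
  by apply: expect_norm_le => //; exact: (bounded_measurable_comp mf bf mX).
have t1 := tilted1_gt0 a b0.
rewrite normrM normfV (gtr0_norm t1) ler_pdivrMr//.
have bt := bounded_tilt a mf bf b0.
have bt1 := bounded_tilt a m1 one_bounded b0.
apply: le_trans (le_normr_Rintegral _ (integrable_bounded P bt)) _ => //.
rewrite /tilted -expectZ//; apply: expect_le => [||w].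
- case: bt => mt [N tN]; split; first exact: measurableT_comp.
  by exists N => w; rewrite normr_id.
- by apply: bounded_measurableM => //; exact: bounded_measurable_cst.
- by rewrite normrM (gtr0_norm (tilt_gt0 _ _ _)) mul1r ler_wpM2r// ltW// tilt_gt0.
Qed.

Let measurable_tilted_ge0 (f : R -> \bar R) : measurable_fun setT f ->
  (forall x, 0 <= f x)%E ->
  measurable_fun setT (fun z : R * R =>
     \int[P]_w (f (X w) * (tilt z.1 z.2 (X w))%:E)%E)%E.
Proof.
move=> mf f0.
have := @measurable_fun_fubini_tonelli_F _ _ (R * R)%type T R P
  (fun u : (R * R) * T => f (X u.2) * (tilt u.1.1 u.1.2 (X u.2))%:E)%E.
apply; last first.
  by move=> u; apply: mule_ge0 => //; rewrite lee_fin ltW// tilt_gt0.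
apply: emeasurable_funM.
  by apply: measurableT_comp => //; apply: measurableT_comp.
apply/measurable_EFinP; apply: measurable_tilt2.
- exact: (measurableT_comp measurable_fst measurable_fst).
- exact: (measurableT_comp measurable_snd measurable_fst).
- exact: (measurableT_comp mX measurable_snd).
Qed.

Lemma measurable_tilted f : measurable_fun setT f ->
  measurable_fun setT (fun z : R * R => tilted f z.1 z.2).
Proof.
move=> mf; have mfE : measurable_fun setT (EFin \o f) by exact/measurable_EFinP.
have -> : (fun z : R * R => tilted f z.1 z.2) = (fun z => fine
    (\int[P]_w ((EFin \o f)^\+ (X w) * (tilt z.1 z.2 (X w))%:E)%E -
     \int[P]_w ((EFin \o f)^\- (X w) * (tilt z.1 z.2 (X w))%:E)%E)%E).
  apply/funext => z; rewrite /tilted /Rintegral integralE; congr (fine (_ - _)%E).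
    apply: eq_integral => w _; rewrite !funeposE /= -!EFin_max -EFinM.
    by rewrite maxr_pMl ?mul0r// ltW// tilt_gt0.
  apply: eq_integral => w _; rewrite !funenegE /= -!EFin_max -EFinM.
  by rewrite maxr_pMl ?mul0r ?mulNr// ltW// tilt_gt0.
apply: (measurableT_comp (@fine_measurable R setT measurableT)).
apply: emeasurable_funB; apply: measurable_tilted_ge0 => //.
  exact: measurable_funepos.
exact: measurable_funeneg.
Qed.

Lemma measurable_posterior f : measurable_fun setT f ->
  measurable_fun setT (fun z : R * R => posterior f z.1 z.2).
Proof.
move=> mf; pose q (z : R * R) := 0 < z.2.
have -> : (fun z : R * R => posterior f z.1 z.2) = (fun z => if q z then
    tilted f z.1 z.2 * expR (- ln (tilted (fun=> 1) z.1 z.2)) else E (fun w => f (X w))).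
  apply/funext => z; rewrite /posterior /q; case: ifPn => // z0.
  by rewrite expRN lnK// posrE; exact: tilted1_gt0.
apply: measurable_fun_ifT.
- exact: measurable_fun_ltr.
- apply: measurable_funM; first exact: measurable_tilted.
  apply: (measurableT_comp (@measurable_expR R)).
  apply: (measurableT_comp (@oppr_measurable R setT)).
  apply: (measurableT_comp (@measurable_ln R)).
  by apply: measurable_tilted; exact: measurable_cst.
- exact: measurable_cst.
Qed.

End Posterior.

(** * Bayes' formula for Gaussian noise *)

Section BayesLine.
Context (R : realType) (d : measure_display) (T : measurableType d).
Variables (P : probability T R) (X M : T -> R) (b : R).
Hypotheses (mX : measurable_fun setT X) (mM : measurable_fun setT M).
Hypothesis b0 : 0 < b.
Local Notation E f := (\int[P]_w f w).
Local Notation mu := (@lebesgue_measure R).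
Hypothesis cosM : forall u theta,
  E (fun w => cos (u * M w + theta)) = cos theta * expR (- (b * u ^+ 2 / 2)).
Hypothesis XM : forall A B, measurable A -> measurable B ->
  P (X @^-1` A `&` M @^-1` B) = (P (X @^-1` A) * P (M @^-1` B))%E.

Let s := Num.sqrt b.
Let s0 : s != 0. Proof. by rewrite gt_eqF// sqrtr_gt0. Qed.
Let s2 : s ^+ 2 = b. Proof. by rewrite sqr_sqrtr// ltW. Qed.

(** The law of the noise is identified through its characteristic function. *)
Lemma shifted_normal_law (a : R) (B : set R) : measurable B ->
  P ((fun w => a + M w) @^-1` B) = normal_prob a s B.
Proof.
move=> mB; have maM : measurable_fun setT (fun w => a + M w).
  by apply: measurable_funD.
have b1 d' (T' : measurableType d') : bounded_measurable (fun _ : T' => 1 : R).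
  exact: bounded_measurable_cst.
have H := @weighted_law_unique _ _ _ _ _ P (normal_prob a s) (fun=> 1)
  (fun w => a + M w) (fun=> 1) id (b1 _ _) maM (b1 _ _) (@measurable_id _ _ _).
have {}H : E (fun w => \1_B (a + M w)) = \int[normal_prob a s]_x \1_B x.
  have : E (fun w => 1 * \1_B (a + M w)) = \int[normal_prob a s]_x (1 * \1_B x).
    apply: H => // u theta.
    under eq_Rintegral do rewrite mul1r.
    under [RHS]eq_Rintegral do rewrite mul1r.
    rewrite Rintegral_normal; last first.
      by apply: measurable_cos_comp; apply: measurable_funD => //; exact: measurable_funM.
    have := @normal_cos _ a s s0 (u * a + theta) u.
    under eq_Rintegral do rewrite mulrBr addrA subrK.
    move=> ->; rewrite s2 -cosM; apply: eq_Rintegral => w _.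
    by congr cos; ring.
  by under eq_Rintegral do rewrite mul1r; under [in X in _ = X -> _]eq_Rintegral do rewrite mul1r.
have mB' : measurable ((fun w => a + M w) @^-1` B).
  by rewrite -[X in measurable X]setTI; exact: maM.
have := H; rewrite (expect_indic (normal_prob a s) mB).
rewrite -[X in _ = X -> _]/(fine (normal_prob a s B)).
have -> : E (fun w => \1_B (a + M w)) = fine (P ((fun w => a + M w) @^-1` B)).
  by rewrite -expect_indic.
move=> e; have fP := fin_num_measure P _ mB'.
have fN := fin_num_measure (normal_prob a s) _ mB.
by rewrite -[LHS](fineK fP) e; exact: fineK fN.
Qed.

Let p0 := normal_pdf 0 s.

(** As function of the signal [x], the density of the observation [y] is the
    likelihood [tilt y b x]. *)
Lemma normal_pdf_shift (x y : R) : normal_pdf (b * x) s y = p0 y * tilt y b x.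
Proof.
rewrite /p0 !normal_pdfE// /normal_fun /tilt -[RHS]mulrA -expRD; congr (_ * expR _).
rewrite s2; field; exact: lt0r_neq0.
Qed.

Let p0_ge0 y : 0 <= p0 y. Proof. exact: normal_pdf_ge0. Qed.
Let mp0 : measurable_fun setT p0. Proof. exact: measurable_normal_pdf. Qed.

Lemma joint_density (f : R -> R) (B : set R) : measurable_fun setT f ->
  (exists N, forall x, `|f x| <= N) -> (forall x, 0 <= f x) -> measurable B ->
  (\int[P]_w (f (X w) * \1_B (b * X w + M w))%:E =
   \int[mu]_(y in B) (tilted P X f y b * p0 y)%:E)%E.
Proof.
move=> mf bf f0 mB.
have mind : measurable_fun setT (\1_B : R -> R) by exact: measurable_indic.
have i0 x : (0 : R) <= \1_B x by rewrite indicE.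
pose Phi (z : R * R) : \bar R := (f z.1 * \1_B (b * z.1 + z.2))%:E.
have mPhi : measurable_fun setT Phi.
  apply/measurable_EFinP; apply: measurable_funM.
    by apply: measurableT_comp.
  apply: (measurableT_comp mind); apply: measurable_funD => //.
  by apply: measurable_funM.
have Phi0 z : (0 <= Phi z)%E by rewrite lee_fin mulr_ge0.
rewrite (@independent_fubini _ _ _ P _ _ _ _ X M Phi)//.
pose F (u : T * R) : \bar R :=
  (f (X u.1) * (p0 u.2 * tilt u.2 b (X u.1)) * \1_B u.2)%:E.
have mF : measurable_fun setT F.
  apply/measurable_EFinP; apply: measurable_funM; last first.
    exact: (measurableT_comp mind measurable_snd).
  apply: measurable_funM.
    exact: (measurableT_comp mf (measurableT_comp mX measurable_fst)).
  apply: measurable_funM; first exact: (measurableT_comp mp0 measurable_snd).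
  apply: measurable_tilt2; [exact: measurable_snd|exact: measurable_cst|].
  exact: (measurableT_comp mX measurable_fst).
have F0 u : (0 <= F u)%E.
  by rewrite lee_fin !mulr_ge0// ltW// tilt_gt0.
transitivity (\int[P]_w \int[mu]_y F (w, y))%E.
  apply: eq_integral => w _.
  transitivity ((f (X w))%:E * normal_prob (b * X w) s B)%E.
    rewrite -shifted_normal_law// /Phi/=.
    have mBw : measurable ((fun w' => b * X w + M w') @^-1` B).
      rewrite -[X in measurable X]setTI.
      by have : measurable_fun setT (fun w' => b * X w + M w') by [apply: measurable_funD]; exact.
    pose A := (fun w' => b * X w + M w') @^-1` B.
    have mA1 : measurable_fun setT (fun w' => (\1_A w' : R)%:E).
      by apply/measurable_EFinP; exact: measurable_indic.
    have A10 w' : setT w' -> (0 <= (\1_A w' : R)%:E)%E.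
      by rewrite lee_fin indicE.
    have fX0 : (0 <= (f (X w))%:E)%E by rewrite lee_fin.
    have -> : (P A = \int[P]_w' (\1_A w' : R)%:E)%E.
      by rewrite integral_indic// setIT.
    rewrite -(ge0_integralZl P measurableT mA1 A10 fX0).
    by apply: eq_integral => w' _; rewrite EFinM.
  have mpdf : measurable_fun B (fun y => (normal_pdf (b * X w) s y)%:E).
    by apply/measurable_EFinP; apply: measurable_funTS; exact: measurable_normal_pdf.
  have pdf_ge0 y : B y -> (0 <= (normal_pdf (b * X w) s y)%:E)%E.
    by rewrite lee_fin normal_pdf_ge0.
  have fX0 : (0 <= (f (X w))%:E)%E by rewrite lee_fin.
  rewrite /normal_prob -(ge0_integralZl mu mB mpdf pdf_ge0 fX0).
  rewrite integral_mkcond; apply: eq_integral => y _.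
  rewrite patchE /F/= indicE; case: ifPn => yB; last by rewrite mulr0.
  by rewrite mulr1 normal_pdf_shift -EFinM.
transitivity (\int[mu]_y \int[P]_w F (w, y))%E.
  exact: (@fubini_tonelli _ _ _ _ _ P mu F mF F0).
rewrite [RHS]integral_mkcond; apply: eq_integral => y _.
rewrite patchE; have bt := bounded_tilt mX y mf bf b0.
have -> : (\int[P]_w F (w, y) = \int[P]_w ((p0 y * \1_B y)%:E * (f (X w) * tilt y b (X w))%:E))%E.
  by apply: eq_integral => w _; rewrite /F/= -EFinM; congr EFin; ring.
have mbt : measurable_fun setT (fun w => (f (X w) * tilt y b (X w))%:E).
  by apply/measurable_EFinP; case: bt.
have bt0 w : setT w -> (0 <= (f (X w) * tilt y b (X w))%:E)%E.
  by move=> _; rewrite lee_fin mulr_ge0// ltW// tilt_gt0.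
have pB0 : (0 <= (p0 y * \1_B y)%:E)%E by rewrite lee_fin mulr_ge0.
rewrite (ge0_integralZl P measurableT mbt bt0 pB0) expect_EFin// indicE; case: ifPn => yB; last by rewrite mulr0 mul0e.
by rewrite mulr1 -EFinM mulrC.
Qed.

Let one_bounded : exists N : R, forall x : R, `|(fun=> 1 : R) x| <= N.
Proof. by exists 1 => x; rewrite normr1. Qed.

(** Bayes' formula for one Gaussian observation [b X + M] of [X], for a
    nonnegative payoff: both sides have the density [tilted f]. *)
Let bayes_ge0 (f : R -> R) (B : set R) : measurable_fun setT f ->
  (exists N, forall x, `|f x| <= N) -> (forall x, 0 <= f x) -> measurable B ->
  E (fun w => f (X w) * \1_B (b * X w + M w)) =
  E (fun w => posterior P X f (b * X w + M w) b * \1_B (b * X w + M w)).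
Proof.
move=> mf bf f0 mB.
pose alpha w := b * X w + M w.
have malpha : measurable_fun setT alpha by apply: measurable_funD => //; exact: measurable_funM.
pose alpha' : {mfun T >-> measurableTypeR R} :=
  HB.pack (alpha : T -> measurableTypeR R) (isMeasurableFun.Build _ _ T (measurableTypeR R) _ malpha).
have m1 : measurable_fun setT (fun _ : R => 1 : R) by exact: measurable_cst.
have mT (g : R -> R) : measurable_fun setT g ->
    measurable_fun setT (fun y => tilted P X g y b).
  move=> mg; have := @measurable_tilted _ _ _ P X mX g mg.
  exact: measurable_fun_pair1.
have mpost : measurable_fun setT (fun y => posterior P X f y b).
  have := @measurable_posterior _ _ _ P X mX f mf.
  exact: measurable_fun_pair1.
have post0 y : 0 <= posterior P X f y b.
  rewrite /posterior b0 divr_ge0//; apply: Rintegral_ge0 => w _.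
    by rewrite mulr_ge0// ltW// tilt_gt0.
  by rewrite mul1r ltW// tilt_gt0.
have t0 y : 0 <= tilted P X (fun=> 1) y b by rewrite ltW// tilted1_gt0.
have law A : measurable A -> distribution P alpha' A =
    (\int[mu]_(y in A) (tilted P X (fun=> 1) y b * p0 y)%:E)%E.
  move=> mA; rewrite -joint_density//.
  under eq_integral do rewrite mul1r.
  rewrite -[LHS]/(P (alpha @^-1` A)) -[X in P X]setIT.
  by rewrite -integral_indic//; rewrite -[X in measurable X]setTI; exact: (malpha measurableT A mA).
rewrite /Rintegral; congr fine; rewrite joint_density//.
transitivity (\int[distribution P alpha']_y (posterior P X f y b * \1_B y)%:E)%E; last first.
  rewrite ge0_integral_distribution//.
    by apply/measurable_EFinP; apply: measurable_funM => //; exact: measurable_indic.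
  by move=> y; rewrite lee_fin mulr_ge0// indicE.
have mq : measurable_fun setT (fun y => tilted P X (fun=> 1) y b * p0 y).
  by apply: measurable_funM => //; exact: mT.
have q0 y : 0 <= tilted P X (fun=> 1) y b * p0 y by rewrite mulr_ge0.
have mg : measurable_fun setT (fun y => (posterior P X f y b * \1_B y)%:E).
  by apply/measurable_EFinP; apply: measurable_funM => //; exact: measurable_indic.
have g0 y : (0 <= (posterior P X f y b * \1_B y)%:E)%E.
  by rewrite lee_fin mulr_ge0// indicE.
have H := @ge0_integral_density _ _ _ mu (distribution P alpha') _ _ mq q0 law mg g0.
apply/esym; apply: etrans H _.
rewrite [RHS]integral_mkcond; apply: eq_integral => y _.
rewrite patchE indicE; case: ifPn => yB; last by rewrite mulr0 mul0e.
rewrite mulr1 -EFinM /posterior b0; congr EFin.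
by rewrite mulrA divfK// gt_eqF// tilted1_gt0.
Qed.

(** The payoff is shifted by a constant to be nonnegative; the posterior follows
    the shift. *)
Lemma bayes_line (f : R -> R) (B : set R) : measurable_fun setT f ->
  (exists N, forall x, `|f x| <= N) -> measurable B ->
  E (fun w => f (X w) * \1_B (b * X w + M w)) =
  E (fun w => posterior P X f (b * X w + M w) b * \1_B (b * X w + M w)).
Proof.
move=> mf [N fN] mB; have bf : exists N, forall x, `|f x| <= N by exists N.
have mfN : measurable_fun setT (fun x => f x + N) by exact: measurable_funD.
have bfN : exists N', forall x, `|f x + N| <= N'.
  by exists (N + `|N|) => x; rewrite (le_trans (ler_normD _ _))// lerD.
have f0 x : 0 <= f x + N.
  by have := fN x; rewrite ler_norml => /andP[]; rewrite -subr_ge0 opprK.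
have := bayes_ge0 mfN bfN f0 mB.
pose alpha w := b * X w + M w.
have malpha : measurable_fun setT alpha by apply: measurable_funD => //; exact: measurable_funM.
have bB : bounded_measurable (fun w => \1_B (alpha w) : R).
  exact: bounded_measurable_set_indic.
have bc : bounded_measurable (fun _ : T => N) by exact: bounded_measurable_cst.
have bfX : bounded_measurable (fun w => f (X w)) by exact: (bounded_measurable_comp mf bf mX).
have bpost : bounded_measurable (fun w => posterior P X f (alpha w) b).
  split; last by exists N => w; exact: posterior_bound.
  have mpost : measurable_fun setT (fun y => posterior P X f y b).
    have := @measurable_posterior _ _ _ P X mX f mf.
    exact: measurable_fun_pair1.
  exact: (measurableT_comp mpost malpha).
have e (h : T -> R) : bounded_measurable h ->
    E (fun w => (h w + N) * \1_B (alpha w)) =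
    E (fun w => h w * \1_B (alpha w)) + E (fun w => N * \1_B (alpha w)).
  move=> bh; rewrite -expectD; [|exact: bounded_measurableM..].
  by apply: eq_Rintegral => w _; rewrite mulrDl.
under [in X in _ = X -> _]eq_Rintegral do rewrite posteriorD_cst//.
by rewrite (e _ bfX) (e _ bpost) => /addIr.
Qed.

End BayesLine.

Section BayesFamily.
Context (R : realType) (d : measure_display) (T : measurableType d).
Variables (P : probability T R) (X M : T -> R) (b : R).
Variables (I : eqType) (Z : I -> T -> R) (s : seq I) (F : set (set T)).
Hypotheses (us : uniq s) (b0 : 0 < b) (mX : measurable_fun setT X).
Hypotheses (sF : sigma_algebra setT F) (mF : F `<=` measurable).
Hypothesis XF : independent P (sigma_gen [set X]) F.
Hypotheses (FM : measurable_wrt F M) (FZ : forall i, measurable_wrt F (Z i)).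
Local Notation E f := (\int[P]_w f w).
Hypothesis cosMZ : forall u c theta,
  E (fun w => cos (u * M w + (\sum_(i <- s) c i * Z i w + theta))) =
  expR (- (b * u ^+ 2 / 2)) * E (fun w => cos (\sum_(i <- s) c i * Z i w + theta)).

Let mM : measurable_fun setT M. Proof. exact: measurable_wrt_measurable FM. Qed.
Let mZ i : measurable_fun setT (Z i).
Proof. exact: measurable_wrt_measurable (FZ i). Qed.

Let cosM u theta :
  E (fun w => cos (u * M w + theta)) = cos theta * expR (- (b * u ^+ 2 / 2)).
Proof.
have := cosMZ u (fun=> 0) theta.
have S0 w : \sum_(i <- s) 0 * Z i w = 0 by rewrite big1// => i _; rewrite mul0r.
under eq_Rintegral do rewrite S0 add0r.
under [in X in _ = X -> _]eq_Rintegral do rewrite S0 add0r.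
by rewrite expect_cst mulrC.
Qed.

Let box (B : I -> set R) : set T := \bigcap_(i in [set` s]) Z i @^-1` B i.

Let Fbox B : (forall i, measurable (B i)) -> F (box B).
Proof.
move=> mB; rewrite /box; elim: s => [|i r ih].
  rewrite (_ : [set` [::]] = set0) ?bigcap_set0; first exact: sigma_algebra_setT sF.
  by apply/seteqP; split => x.
have -> : [set` i :: r] = i |` [set` r].
  by apply/seteqP; split => x /=; rewrite in_cons => /predU1P.
rewrite bigcap_setU1; apply: (sigma_algebra_setI sF) => //.
exact: FZ.
Qed.

Let box_indic B w : \1_(box B) w = \prod_(i <- s) \1_(B i) (Z i w) :> R.
Proof.
rewrite /box; elim: s => [|i r ih].
  rewrite big_nil (_ : [set` [::]] = set0) ?bigcap_set0 ?indicT//.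
  by apply/seteqP; split => x.
have -> : [set` i :: r] = i |` [set` r].
  by apply/seteqP; split => x /=; rewrite in_cons => /predU1P.
by rewrite big_cons bigcap_setU1 indicI /= ih.
Qed.

Let bcos c theta : bounded_measurable
  (fun w => cos (\sum_(i <- s) c i * Z i w + theta)).
Proof.
apply: bounded_measurable_cos; apply: measurable_funD => //.
elim: s => [|i r ih]; first by under eq_fun do rewrite big_nil; exact: measurable_cst.
under eq_fun do rewrite big_cons; apply: measurable_funD => //.
exact: measurable_funM.
Qed.

Let bMB B : measurable B -> bounded_measurable (fun w => \1_B (M w) : R).
Proof. exact: bounded_measurable_set_indic. Qed.

(** Vanishing of the mixed characteristic function decouples [M] from every
    trigonometric function of the residuals. *)
Let expect_indicM_cos B c theta : measurable B ->
  E (fun w => cos (\sum_(i <- s) c i * Z i w + theta) * \1_B (M w)) =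
  E (fun w => cos (\sum_(i <- s) c i * Z i w + theta)) * E (fun w => \1_B (M w)).
Proof.
move=> mB; pose H w := cos (\sum_(i <- s) c i * Z i w + theta).
have bH : bounded_measurable H := bcos c theta.
have bc : bounded_measurable (fun _ : T => E H) by exact: bounded_measurable_cst.
(* The addition theorem reduces the mixed products to the assumed identity with
   shifted phases. *)
have key u t : E (fun w => H w * cos (u * M w + t)) =
               E (fun w => E H * cos (u * M w + t)).
  rewrite expectZ; last first.
    by apply: bounded_measurable_cos; apply: measurable_funD => //; exact: measurable_funM.
  rewrite cosM.
  have mcomb : measurable_fun setT (fun w => \sum_(i <- s) c i * Z i w).
    elim: s => [|i r ih]; first by under eq_fun do rewrite big_nil; exact: measurable_cst.
    under eq_fun do rewrite big_cons; apply: measurable_funD => //.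
    exact: measurable_funM.
  have bt v t' : bounded_measurable (fun w => cos (v * M w + (\sum_(i <- s) c i * Z i w + t'))).
    apply: bounded_measurable_cos; apply: measurable_funD; first exact: measurable_funM.
    exact: measurable_funD.
  have b2 (h : T -> R) : bounded_measurable h -> bounded_measurable (fun w => 2^-1 * h w).
    by move=> ?; apply: bounded_measurableM => //; exact: bounded_measurable_cst.
  transitivity (2^-1 * E (fun w => cos (u * M w + (\sum_(i <- s) c i * Z i w + (theta + t))))
     + 2^-1 * E (fun w => cos (- u * M w + (\sum_(i <- s) c i * Z i w + (theta - t))))).
    rewrite -(expectZ P _ (bt _ _)) -(expectZ P _ (bt _ _)).
    rewrite -(expectD P (b2 _ (bt _ _)) (b2 _ (bt _ _))).
    apply: eq_Rintegral => w _; rewrite /H.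
    have -> : u * M w + (\sum_(i <- s) c i * Z i w + (theta + t)) =
      (\sum_(i <- s) c i * Z i w + theta) + (u * M w + t) by ring.
    have -> : - u * M w + (\sum_(i <- s) c i * Z i w + (theta - t)) =
      (\sum_(i <- s) c i * Z i w + theta) - (u * M w + t) by ring.
    by move: (_ + theta) (u * M w + t) => x y; rewrite cosD cosB; field.
  rewrite !cosMZ sqrrN.
  have bS t' := bcos c (theta + t').
  have -> : E (fun w => cos (\sum_(i <- s) c i * Z i w + (theta + t))) =
      2 * (cos t * E H) - E (fun w => cos (\sum_(i <- s) c i * Z i w + (theta - t))).
    have e2 : E (fun w => cos (\sum_(i <- s) c i * Z i w + (theta + t)) +
      cos (\sum_(i <- s) c i * Z i w + (theta - t))) = 2 * (cos t * E H).
      rewrite mulrA -expectZ//; apply: eq_Rintegral => w _; rewrite /H !addrA.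
      by move: (_ + theta) => x; rewrite cosD cosB; ring.
    by rewrite -e2 expectD// addrK.
  by field.
have := weighted_law_unique bH mM bc mM key mB.
by move=> ->; rewrite expectZ//; exact: bMB.
Qed.

Let indep_box B A : measurable A -> (forall i, measurable (B i)) ->
  P (M @^-1` A `&` box B) = (P (M @^-1` A) * P (box B))%E.
Proof.
move=> mA mB; have mbox : measurable (box B) by exact/mF/Fbox.
have mMA : measurable (M @^-1` A) by exact/mF/FM.
have bA := bMB mA.
pose D w := \1_A (M w) - E (fun w => \1_A (M w)).
have bD : bounded_measurable D.
  by apply: bounded_measurableB => //; exact: bounded_measurable_cst.
have D0 c theta : E (fun w => D w * cos (\sum_(i <- s) c i * Z i w + theta)) = 0.
  under eq_Rintegral do rewrite /D mulrBl.
  rewrite expectB ?expectZ//; first last.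
  - by apply: bounded_measurableM => //; exact: bounded_measurable_cst.
  - exact: bounded_measurableM.
  under eq_Rintegral do rewrite mulrC.
  by rewrite expect_indicM_cos// mulrC subrr.
have := expect_box_eq0 mZ us bD mB D0.
have bbox : bounded_measurable (\1_(box B) : T -> R) by exact: bounded_measurable_indic.
under eq_Rintegral do rewrite -box_indic /D mulrBl.
rewrite expectB ?expectZ//; first last.
- by apply: bounded_measurableM => //; exact: bounded_measurable_cst.
- exact: bounded_measurableM.
have -> : E (fun w => \1_A (M w)) = fine (P (M @^-1` A)).
  by rewrite -(expect_indic P mMA).
rewrite (expect_indic P mbox).
have -> : E (fun w => \1_A (M w) * \1_(box B) w) = fine (P (M @^-1` A `&` box B)).
  rewrite -expect_indic; last exact: measurableI.
  by apply: eq_Rintegral => w _; rewrite indicI.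
move=> /eqP; rewrite subr_eq0 -fineM ?fin_num_measure// => /eqP e.
have f1 : P (M @^-1` A `&` box B) \is a fin_num.
  by rewrite fin_num_measure//; exact: measurableI.
have f2 : (P (M @^-1` A) * P (box B))%E \is a fin_num by rewrite fin_numM ?fin_num_measure.
by rewrite -(fineK f1) e fineK.
Qed.

Let alpha w := b * X w + M w.
Let malpha : measurable_fun setT alpha.
Proof. by apply: measurable_funD => //; exact: measurable_funM. Qed.

Let XM A B : measurable A -> measurable B ->
  P (X @^-1` A `&` M @^-1` B) = (P (X @^-1` A) * P (M @^-1` B))%E.
Proof.
move=> mA mB; apply: XF; last exact: FM.
exact: (measurable_wrt_gen (fs := [set X])).
Qed.

(** The residuals carry no information on [X] beyond [b X + M]. *)
Lemma bayes_family (f : R -> R) (A : set T) : measurable_fun setT f ->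
  (exists N, forall x, `|f x| <= N) ->
  sigma_gen ([set alpha] `|` [set Z i | i in [set` s]]) A ->
  E (fun w => f (X w) * \1_A w) =
  E (fun w => posterior P X f (alpha w) b * \1_A w).
Proof.
move=> mf bf GA.
have bfX : bounded_measurable (fun w => f (X w)) by exact: (bounded_measurable_comp mf bf mX).
have mpost : measurable_fun setT (fun y => posterior P X f y b).
  have := @measurable_posterior _ _ _ P X mX f mf.
  exact: measurable_fun_pair1.
have bpost : bounded_measurable (fun w => posterior P X f (alpha w) b).
  case: bf => N fN; split; last by exists N => w; exact: posterior_bound.
  exact: (measurableT_comp mpost malpha).
(* Joint independence of the pair ([X], [M]) from the residuals. *)
pose C1 : set (set T) := [set D | exists A B, [/\ measurable A, measurable B &
  D = X @^-1` A `&` M @^-1` B]].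
pose C2 : set (set T) := [set D | exists2 B, (forall i, measurable (B i)) & D = box B].
have mC1 : C1 `<=` measurable.
  move=> _ [A1 [B1 [mA1 mB1 ->]]]; apply: measurableI.
    by rewrite -[X in measurable X]setTI; exact: mX.
  by rewrite -[X in measurable X]setTI; exact: (mM measurableT).
have mC2 : C2 `<=` measurable by move=> _ [B mB ->]; exact/mF/Fbox.
have IC1 : setI_closed C1.
  move=> _ _ [A1 [B1 [mA1 mB1 ->]]] [A2 [B2 [mA2 mB2 ->]]].
  exists (A1 `&` A2), (B1 `&` B2); split; [exact: measurableI|exact: measurableI|].
  by rewrite !preimage_setI setIACA.
have IC2 : setI_closed C2.
  move=> _ _ [B1 mB1 ->] [B2 mB2 ->]; exists (fun i => B1 i `&` B2 i).
    by move=> i; exact: measurableI.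
  by rewrite /box -bigcapI.
have indep12 : independent P <<s C1 >> <<s C2 >>.
  apply: independent_pi => // _ _ [A1 [B1 [mA1 mB1 ->]]] [B2 mB2 ->].
  rewrite -setIA XF; last 2 first.
  - exact: (measurable_wrt_gen (fs := [set X])).
  - by apply: (sigma_algebra_setI sF); [exact: FM|exact: Fbox].
  by rewrite indep_box// muleA -XM.
have XC1 : measurable_wrt <<s C1 >> X.
  move=> B mB; apply: sub_sigma_algebra; exists B, setT; split => //.
  by rewrite preimage_setT setIT.
have MC1 : measurable_wrt <<s C1 >> M.
  move=> B mB; apply: sub_sigma_algebra; exists setT, B; split => //.
  by rewrite preimage_setT setTI.
have sC1 : sigma_algebra setT <<s C1 >> by exact: smallest_sigma_algebra.
have alphaC1 : measurable_wrt <<s C1 >> alpha.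
  apply: (measurable_wrtD sC1) => //; apply: (measurable_wrtM sC1) => //.
  exact: measurable_wrt_cst.
pose C : set (set T) := [set D | exists A B, [/\ measurable A, C2 B &
  D = alpha @^-1` A `&` B]].
have malphaA A1 : measurable A1 -> measurable (alpha @^-1` A1).
  by move=> mA1; rewrite -[X in measurable X]setTI; exact: (malpha measurableT).
have GC : sigma_gen ([set alpha] `|` [set Z i | i in [set` s]]) `<=` <<s C >>.
  apply: sigma_genP; first exact: smallest_sigma_algebra.
  move=> _ [->|[i /= si <-]] B mB; apply: sub_sigma_algebra.
    exists B, (box (fun=> setT)); split => //; first by exists (fun=> setT).
    by rewrite (_ : box _ = setT) ?setIT//; apply/seteqP; split.
  exists setT, (box (fun j => if j == i then B else setT)); split => //.
    by exists (fun j => if j == i then B else setT) => // j; case: eqP.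
  rewrite preimage_setT setTI; apply/seteqP; split => [w Zw j /= sj|w /(_ i si)].
    by case: eqP => [->|].
  by rewrite eqxx.
move: GA => /GC; move: A; apply: expect_dynkin => //.
- by move=> _ [A1 [B1 [mA1 CB1 ->]]]; apply: measurableI; [exact: malphaA|exact: mC2].
- move=> _ _ [A1 [B1 [mA1 CB1 ->]]] [A2 [B2 [mA2 CB2 ->]]].
  exists (A1 `&` A2), (B1 `&` B2); split; [exact: measurableI|exact: IC2|].
  by rewrite preimage_setI setIACA.
- have := bayes_line mX mM b0 cosM XM mf bf measurableT.
  under eq_Rintegral do rewrite indicT mulr1.
  by under [in X in _ = X -> _]eq_Rintegral do rewrite indicT mulr1.
- move=> _ [A1 [B1 [mA1 CB1 ->]]].
  have mB1 := mC2 _ CB1.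
  have bB1 : bounded_measurable (\1_B1 : T -> R) by exact: bounded_measurable_indic.
  have bA1 : bounded_measurable (fun w => \1_A1 (alpha w) : R).
    exact: bounded_measurable_set_indic.
  have WB1 : measurable_wrt <<s C2 >> (\1_B1 : T -> R).
    apply: measurable_wrt_indic; first exact: smallest_sigma_algebra.
    exact: sub_sigma_algebra.
  have WA1 : measurable_wrt <<s C1 >> (fun w => \1_A1 (alpha w) : R).
    by apply: (measurable_wrt_comp (h := \1_A1)) => //; exact: measurable_indic.
  have e (h : T -> R) : bounded_measurable h -> measurable_wrt <<s C1 >> h ->
      E (fun w => h w * \1_(alpha @^-1` A1 `&` B1) w) =
      E (fun w => h w * \1_A1 (alpha w)) * E \1_B1.
    move=> bh Wh; rewrite -(expectM_independent indep12)//.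
    - by apply: eq_Rintegral => w _; rewrite indicI mulrA.
    - exact: measurable_wrtM.
    - exact: bounded_measurableM.
  rewrite !e//.
  + by rewrite (bayes_line mX mM b0 cosM XM mf bf mA1).
  + exact: (measurable_wrt_comp mpost).
  + exact: (measurable_wrt_comp mf).
Qed.

End BayesFamily.

(** * Brownian bridges *)

Section IndependentGaussianSum.
Context (R : realType) (d : measure_display) (T : measurableType d).
Variables (P : probability T R) (I : finType) (F : I -> set (set T)).
Hypothesis sF : forall i, sigma_algebra setT (F i).
Hypothesis mF : forall i, F i `<=` measurable.
Hypothesis iF : mutually_independent P F.
Variables (L : I -> T -> R) (V : I -> R).
Hypothesis FL : forall i, measurable_wrt (F i) (L i).
Local Notation E f := (\int[P]_w f w).
Hypothesis cosL : forall i theta,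
  E (fun w => cos (L i w + theta)) = cos theta * expR (- (V i / 2)).

(** Independence turns the addition theorem for the cosine into a product
    formula; the sine terms need no formula, as they are cosines with a shifted
    [theta]. *)
Lemma independent_sum_cos (s : seq I) theta : uniq s ->
  E (fun w => cos (\sum_(i <- s) L i w + theta)) =
  cos theta * expR (- ((\sum_(i <- s) V i) / 2)).
Proof.
elim: s theta => [|k s ih] theta /=.
  move=> _; under eq_Rintegral do rewrite big_nil add0r.
  by rewrite expect_cst big_nil mul0r oppr0 expR0 mulr1.
move=> /andP[ks us].
pose S w := \sum_(i <- s) L i w.
have mL i : measurable_fun setT (L i) by exact: measurable_wrt_measurable (FL i).
have JS : measurable_wrt (joined F [set i in s]%SET) S.
  apply: (measurable_wrt_ext (f := fun w => \sum_(i <- s | i \in s) L i w)).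
    by move=> w; rewrite /S -big_seq.
  apply: measurable_wrt_sum; first exact: smallest_sigma_algebra.
  move=> i si; apply: measurable_wrtS (FL i).
  by apply: sub_joined; rewrite inE.
have JL : measurable_wrt (joined F [set k]%SET) (L k).
  by apply: measurable_wrtS (FL k); apply: sub_joined; rewrite inE.
have indep : independent P (joined F [set k]%SET) (joined F [set i in s]%SET).
  apply: joined_independent => // i; rewrite !inE => si.
  by apply: contraNN ks => /eqP <-.
have mS : measurable_fun setT S.
  by apply: measurable_wrt_measurable JS; exact: joined_measurable.
have bcos (Y : T -> R) t : measurable_fun setT Y -> bounded_measurable (fun w => cos (Y w + t)).
  by move=> mY; apply: bounded_measurable_cos; exact: measurable_funD.
have Wcos G (Y : T -> R) t : sigma_algebra setT G -> measurable_wrt G Y ->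
    measurable_wrt G (fun w => cos (Y w + t)).
  move=> sG WY; apply: (measurable_wrt_comp (h := cos) (f := fun w => Y w + t)).
    by apply: continuous_measurable_fun; exact: continuous_cos.
  by apply: measurable_wrtD => //; exact: measurable_wrt_cst.
have sJ S' : sigma_algebra setT (joined F S') by exact: smallest_sigma_algebra.
have e t t' : E (fun w => cos (L k w + t) * cos (S w + t')) =
    cos t * expR (- (V k / 2)) * (cos t' * expR (- ((\sum_(i <- s) V i) / 2))).
  rewrite (expectM_independent indep); first by rewrite cosL ih.
  - exact: Wcos.
  - exact: Wcos.
  - exact: bcos.
  - exact: bcos.
have sinE (x : R) : sin x = cos (x + - (pi / 2)) by rewrite cosBpihalf.
under eq_Rintegral => w _.
  rewrite big_cons -/(S w).
  have -> : L k w + S w + theta = (L k w + theta) + (S w + 0) by ring.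
  rewrite cosD sinE [sin (S w + 0)]sinE -!addrA.
  over.
rewrite expectB; [|by apply: bounded_measurableM; exact: bcos..].
rewrite !e add0r cosN cos_pihalf mul0r mulr0 subr0 cos0 mul1r big_cons.
by rewrite -mulrA -expRD mulrDl opprD.
Qed.

End IndependentGaussianSum.

Section BrownianBridge.
Context (R : realType) (d : measure_display) (T : measurableType d).
Variables (P : probability T R) (beta : R -> {RV P >-> R}).
Hypothesis hbeta : brownian_bridge beta.
Local Notation E f := (\int[P]_w f w).

Let hmean t : 0 <= t <= 1 -> ('E_P[beta t] = 0)%E.
Proof. by have [_ + _ _] := hbeta; exact. Qed.

Lemma bridge_covariance s t : 0 <= s <= 1 -> 0 <= t <= 1 ->
  (\int[P]_w (beta s w * beta t w)%:E = (Num.min s t - s * t)%:E)%E.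
Proof.
move=> s01 t01; have [_ _ hcov _] := hbeta.
rewrite -hcov// covariance.unlock hmean// hmean// expectation.unlock.
by apply: eq_integral => w _; rewrite mulrfctE /= !subr0.
Qed.

Let integrable_sq t : 0 <= t <= 1 ->
  P.-integrable setT (fun w => (beta t w ^+ 2)%:E).
Proof.
move=> t01; apply/integrableP; split.
  by apply/measurable_EFinP; exact: measurable_funX.
under eq_integral do rewrite /= ger0_norm ?sqr_ge0// expr2.
by rewrite bridge_covariance// ltry.
Qed.

Lemma bridge_integrableM s t : 0 <= s <= 1 -> 0 <= t <= 1 ->
  P.-integrable setT (fun w => (beta s w * beta t w)%:E).
Proof.
move=> s01 t01.
have i2 : P.-integrable setT (fun w => (beta s w ^+ 2)%:E + (beta t w ^+ 2)%:E)%E.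
  by apply: integrableD => //; exact: integrable_sq.
apply: le_integrable i2 => //; first by apply/measurable_EFinP; exact: measurable_funM.
move=> w _; rewrite /= lee_fin [leRHS]ger0_norm ?addr_ge0 ?sqr_ge0// normrM.
rewrite -(real_normK (num_real (beta s w))) -(real_normK (num_real (beta t w))).
by move: (normr_ge0 (beta s w)) (normr_ge0 (beta t w)); nra.
Qed.

Lemma bridge_integrable t : 0 <= t <= 1 -> P.-integrable setT (EFin \o beta t).
Proof.
move=> t01.
have i1 : P.-integrable setT (fun w => 1%:E + (beta t w ^+ 2)%:E)%E.
  apply: integrableD => //; last exact: integrable_sq.
  by apply: (integrable_bounded P (f := fun=> 1)); exact: bounded_measurable_cst.
apply: le_integrable i1 => //; first exact/measurable_EFinP.
move=> w _; rewrite /= lee_fin [leRHS]ger0_norm ?addr_ge0 ?sqr_ge0//.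
rewrite -(real_normK (num_real (beta t w))).
by move: (normr_ge0 (beta t w)); nra.
Qed.

(** The centred Gaussian vector read off a bridge, through its characteristic
    function. *)
Lemma bridge_cos k (t c : 'I_k -> R) theta : (forall j, 0 <= t j <= 1) ->
  E (fun w => cos (\sum_(j < k) c j * beta (t j) w + theta)) =
  cos theta * expR (- ((\sum_(i < k) \sum_(j < k)
    c i * c j * (Num.min (t i) (t j) - t i * t j)) / 2)).
Proof.
move=> t01; have [hg _ _ _] := hbeta.
pose Y w := \sum_(j < k) c j * beta (t j) w.
have mY : measurable_fun setT Y.
  by apply: measurable_sum => j; exact: measurable_funM.
have icb j : P.-integrable setT (fun w => (c j * beta (t j) w)%:E).
  under eq_fun do rewrite EFinM.
  by apply: integrableZl => //; exact: bridge_integrable.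
have iccbb (p : 'I_k * 'I_k) : P.-integrable setT
    (fun w => (c p.1 * c p.2)%:E * (beta (t p.1) w * beta (t p.2) w)%:E)%E.
  by apply: integrableZl => //; exact: bridge_integrableM.
apply: (gaussian_cos theta mY (hg k t c t01)).
- rewrite /Rintegral; under eq_integral do rewrite -sumEFin.
  rewrite integral_sum//= big1 ?fine0// => j _.
  under eq_integral do rewrite EFinM.
  rewrite integralZl//; last exact: bridge_integrable.
  have := hmean (t01 j); rewrite expectation.unlock => ->.
  by rewrite mule0.
- transitivity (\int[P]_w \sum_(p : 'I_k * 'I_k)
     ((c p.1 * c p.2)%:E * (beta (t p.1) w * beta (t p.2) w)%:E))%E.
    apply: eq_integral => w _; rewrite expr2 big_distrlr/= pair_bigA/= -sumEFin.
    by apply: eq_bigr => p _; rewrite -EFinM; congr EFin; ring.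
  rewrite integral_sum// pair_bigA/= -sumEFin; apply: eq_bigr => p _.
  rewrite integralZl//; last exact: bridge_integrableM.
  by rewrite bridge_covariance.
Qed.

End BrownianBridge.

(** * Sources observed along a fixed schedule *)

Section FixedSchedule.
Context (R : realType) (d : measure_display) (Omega : measurableType d).
Variables (P : probability Omega R) (n : nat) (X : {RV P >-> R}).
Variables (sigma : 'I_n -> R) (beta : 'I_n -> R -> {RV P >-> R}).
Hypothesis hsigma : forall i, 0 < sigma i.
Hypothesis hbeta : forall i, brownian_bridge (beta i).

(** The independent sources of randomness: the signal and the bridges. *)
Definition source_algebra (k : option 'I_n) : set (set Omega) :=
  if k is Some i then
    sigma_gen [set f | exists t, 0 <= t <= 1 /\ f = (beta i t : Omega -> R)]
  else sigma_gen [set (X : Omega -> R)].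

Hypothesis hindep : mutually_independent P source_algebra.
Local Notation E f := (\int[P]_w f w).
Local Notation xi := (xi X sigma beta).

Lemma sigma_gen_measurable (fs : set (Omega -> R)) :
  (forall f, fs f -> measurable_fun setT f) -> sigma_gen fs `<=` measurable.
Proof.
move=> mfs; apply: sigma_genP; first exact: sigma_algebra_measurable.
by move=> f fsf B mB; rewrite -[X in measurable X]setTI; exact: mfs.
Qed.

Lemma source_sigma_algebra k : sigma_algebra setT (source_algebra k).
Proof. by case: k => [i|]; exact: sigma_gen_sigma_algebra. Qed.

Lemma source_measurable k : source_algebra k `<=` measurable.
Proof.
case: k => [i|]; apply: sigma_gen_measurable => f.
  by move=> [t [_ ->]]; exact: measurable_funPT.
by move=> ->; exact: measurable_funPT.
Qed.

Definition noise_algebra : set (set Omega) :=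
  joined source_algebra [set~ None]%SET.

Lemma noise_sigma_algebra : sigma_algebra setT noise_algebra.
Proof. exact: smallest_sigma_algebra. Qed.

Lemma noise_measurable : noise_algebra `<=` measurable.
Proof. by apply: joined_measurable; exact: source_measurable. Qed.

Lemma bridge_noise i t : 0 <= t <= 1 -> measurable_wrt noise_algebra (beta i t).
Proof.
move=> t01 B mB; apply: (@sub_joined _ _ _ _ _ (Some i)); first by rewrite !inE.
by apply: measurable_wrt_gen mB; exists t.
Qed.

Lemma signal_noise_independent : independent P (sigma_gen [set (X : Omega -> R)]) noise_algebra.
Proof.
have H : independent P (joined source_algebra [set None]%SET) noise_algebra.
  apply: joined_independent; [exact: source_sigma_algebra|exact: source_measurable|by []|].
  by move=> k; rewrite !inE => ->.
move=> A B XA NB; apply: H => //.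
by apply: (@sub_joined _ _ _ _ _ None); rewrite ?inE.
Qed.

(** The information of source [i] up to its last active time enters the
    likelihood with this weight. *)
Definition source_weight (i : 'I_n) (t : R) : R := (sigma i) ^- 2 / (1 - t).

Definition total_signal (tau : 'I_n -> R) (w : Omega) : R :=
  \sum_i source_weight i (tau i) * xi i (tau i) w.

Definition total_precision (tau : 'I_n -> R) : R :=
  \sum_i source_weight i (tau i) * tau i.

Section Schedule.
Variables (K : nat) (ts : 'I_K -> R) (obs : 'I_n -> 'I_K -> bool) (tau : 'I_n -> R).
Hypothesis ts01 : forall k, 0 <= ts k <= 1.
Hypothesis tau01 : forall i, 0 <= tau i < 1.
Hypothesis obs_tau : forall i k, obs i k -> ts k <= tau i.

Let g i := source_weight i (tau i).
Let b := total_precision tau.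
Let M w := \sum_i g i * sigma i * beta i (tau i) w.

Let sigma_neq0 i : sigma i != 0. Proof. by rewrite gt_eqF. Qed.
Let onem_tau i : 0 < 1 - tau i. Proof. by have := tau01 i; rewrite subr_gt0 => /andP[]. Qed.
Let tau01' i : 0 <= tau i <= 1.
Proof. by have /andP[-> /ltW ->] := tau01 i. Qed.

Let g_gt0 i : 0 < g i.
Proof. by rewrite /g /source_weight divr_gt0// invr_gt0 exprn_gt0. Qed.

Let gE i : g i * sigma i ^+ 2 * (1 - tau i) = 1.
Proof.
rewrite /g /source_weight; field.
by rewrite sigma_neq0 gt_eqF.
Qed.

Let alphaE w : total_signal tau w = b * X w + M w.
Proof.
rewrite /total_signal /b /total_precision /M mulr_suml -big_split/=.
by apply: eq_bigr => i _; rewrite /Defs.xi -/(g i); ring.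
Qed.

Let NM : measurable_wrt noise_algebra M.
Proof.
apply: measurable_wrt_sum => [|i _]; first exact: noise_sigma_algebra.
apply: (measurable_wrtM noise_sigma_algebra); last exact: bridge_noise.
exact: (measurable_wrt_cst noise_sigma_algebra).
Qed.

(** The residual of an observation after regression on the total signal, in
    which the signal cancels. *)
Let Z (p : 'I_n * 'I_K) w : R :=
  if obs p.1 p.2 then sigma p.1 * beta p.1 (ts p.2) w - ts p.2 / b * M w else 0.

Let NZ p : measurable_wrt noise_algebra (Z p).
Proof.
rewrite /Z; case: (obs _ _); last exact: (measurable_wrt_cst noise_sigma_algebra).
have c c' : measurable_wrt noise_algebra (fun=> c' : R).
  exact: (measurable_wrt_cst noise_sigma_algebra).
apply: (measurable_wrtB noise_sigma_algebra).
  by apply: (measurable_wrtM noise_sigma_algebra); [exact: c|exact: bridge_noise].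
by apply: (measurable_wrtM noise_sigma_algebra); [exact: c|exact: NM].
Qed.

(* Variance of the observed noise, the part that does not involve [M]. *)
Let W i (c : 'I_K -> R) : R := \sum_(k < K) \sum_(l < K)
  (c k * sigma i) * (c l * sigma i) * (Num.min (ts k) (ts l) - ts k * ts l).

(** In the covariance with [M], the weight of source [i] cancels the factor
    [sigma i ^+ 2 * (1 - tau i)] of the bridge covariance: an observation at time
    [u <= tau i] has with [M] the covariance [u], whatever the source. *)
Let source_cos i v (c : 'I_K -> R) theta : (forall k, ~~ obs i k -> c k = 0) ->
  E (fun w => cos (v * (g i * sigma i) * beta i (tau i) w +
    \sum_(k < K) c k * sigma i * beta i (ts k) w + theta)) =
  cos theta * expR (- ((v ^+ 2 * (g i * tau i) +
    2 * v * (\sum_(k < K) c k * ts k) + W i c) / 2)).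
Proof.
move=> c0.
pose t (j : 'I_K.+1) := if unlift ord0 j is Some k then ts k else tau i.
pose cc (j : 'I_K.+1) := if unlift ord0 j is Some k then c k * sigma i
  else v * (g i * sigma i).
have t01 j : 0 <= t j <= 1 by rewrite /t; case: unliftP.
have := bridge_cos (hbeta i) cc theta t01.
under eq_Rintegral => w _.
  rewrite big_ord_recl /cc /t unlift_none.
  under eq_bigr => k _ do rewrite liftK.
  over.
move=> ->; congr (_ * expR (- (_ / 2))).
rewrite big_ord_recl big_ord_recl.
have lin : \sum_(k < K) cc ord0 * cc (lift ord0 k) *
    (Num.min (t ord0) (t (lift ord0 k)) - t ord0 * t (lift ord0 k)) =
    v * \sum_(k < K) c k * ts k.
  rewrite mulr_sumr; apply: eq_bigr => k _.
  rewrite /cc /t unlift_none liftK; have [ok|nok] := boolP (obs i k).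
    rewrite min_r; last exact: obs_tau.
    have -> : v * (c k * ts k) = v * (c k * ts k) * (g i * sigma i ^+ 2 * (1 - tau i)).
      by rewrite gE mulr1.
    by ring.
  by rewrite c0//; ring.
rewrite lin.
have -> : \sum_(k < K) \sum_(j < K.+1) cc (lift ord0 k) * cc j *
    (Num.min (t (lift ord0 k)) (t j) - t (lift ord0 k) * t j) =
    v * (\sum_(k < K) c k * ts k) + W i c.
  rewrite /W -lin -big_split/=; apply: eq_bigr => k _.
  rewrite big_ord_recl; congr (_ + _).
    by rewrite minC; ring.
  by apply: eq_bigr => l _; rewrite /cc /t !liftK.
rewrite /cc /t unlift_none minxx.
have -> : v ^+ 2 * (g i * tau i) =
    v ^+ 2 * (g i * tau i) * (g i * sigma i ^+ 2 * (1 - tau i)).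
  by rewrite gE mulr1.
by ring.
Qed.

Let noise_cos v (c : 'I_n -> 'I_K -> R) theta :
  (forall i k, ~~ obs i k -> c i k = 0) ->
  E (fun w => cos (v * M w +
    \sum_i \sum_(k < K) c i k * sigma i * beta i (ts k) w + theta)) =
  cos theta * expR (- ((v ^+ 2 * b +
    2 * v * (\sum_i \sum_(k < K) c i k * ts k) + \sum_i W i (c i)) / 2)).
Proof.
move=> c0.
pose L (k : option 'I_n) w := if k is Some i then
  v * (g i * sigma i) * beta i (tau i) w + \sum_(k < K) c i k * sigma i * beta i (ts k) w
  else 0.
pose V (k : option 'I_n) := if k is Some i then
  v ^+ 2 * (g i * tau i) + 2 * v * (\sum_(k < K) c i k * ts k) + W i (c i) else 0.
have cosL k th : E (fun w => cos (L k w + th)) = cos th * expR (- (V k / 2)).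
  case: k => [i|] /=; first by apply: source_cos; exact: c0.
  under eq_Rintegral do rewrite add0r.
  by rewrite expect_cst mul0r oppr0 expR0 mulr1.
have WL k : measurable_wrt (source_algebra k) (L k).
  have sk := source_sigma_algebra k.
  case: k sk => [i|] sk; last exact: (measurable_wrt_cst sk).
  have wb u : 0 <= u <= 1 -> measurable_wrt (source_algebra (Some i)) (beta i u).
    by move=> u01; apply: measurable_wrt_gen; exists u.
  apply: (measurable_wrtD sk).
    by apply: (measurable_wrtM sk); [exact: (measurable_wrt_cst sk)|exact: wb].
  apply: (measurable_wrt_sum sk) => k _.
  by apply: (measurable_wrtM sk); [exact: (measurable_wrt_cst sk)|exact: wb].
have us : uniq (map some (index_enum 'I_n)).
  by rewrite map_inj_uniq ?index_enum_uniq// => i j [].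
have := independent_sum_cos source_sigma_algebra source_measurable hindep WL cosL theta us.
rewrite [X in expR (- (X / 2))]big_map /=.
under eq_Rintegral => w _.
  rewrite big_map /=.
  have -> : \sum_i (v * (g i * sigma i) * beta i (tau i) w +
      \sum_(k < K) c i k * sigma i * beta i (ts k) w) =
      v * M w + \sum_i \sum_(k < K) c i k * sigma i * beta i (ts k) w.
    rewrite big_split/= /M mulr_sumr; congr (_ + _).
    by apply: eq_bigr => i _; ring.
  over.
move=> ->; congr (_ * expR (- (_ / 2))).
by rewrite !big_split/= /b /total_precision -!mulr_sumr.
Qed.

(** Whatever has been observed no later than the last active times has the
    conditional distribution of the signal computed from the total signal and
    the total precision alone. *)
Lemma bayes_schedule (f : R -> R) (A : set Omega) : measurable_fun setT f ->
  (exists N, forall x, `|f x| <= N) ->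
  sigma_gen [set h | exists i k, obs i k /\ h = xi i (ts k)] A ->
  E (fun w => f (X w) * \1_A w) =
  E (fun w => posterior P X f (total_signal tau w) b * \1_A w).
Proof.
move=> mf bf GA.
have b_ge0 : 0 <= b.
  apply: sumr_ge0 => i _; apply: mulr_ge0; first exact/ltW/g_gt0.
  by have /andP[] := tau01 i.
have sN := noise_sigma_algebra.
have [b0|b0] := eqVneq b 0.
  have tau0 i : tau i = 0.
    have h0 j : true -> 0 <= g j * tau j.
      move=> _; apply: mulr_ge0; first exact/ltW/g_gt0.
      by have /andP[] := tau01 j.
    have /eqP := b0; rewrite psumr_eq0//.
    move=> /allP/(_ i (mem_index_enum i))/=.
    by rewrite mulf_eq0 (gt_eqF (g_gt0 i)) => /eqP.
  have NA : noise_algebra A.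
    apply: sigma_genP GA => // _ [i [k [ok ->]]].
    have tk0 : ts k = 0.
      apply/eqP; rewrite eq_le; have /andP[-> _] := ts01 k.
      by rewrite -(tau0 i) obs_tau.
    apply: (measurable_wrt_ext (f := fun w => sigma i * beta i (ts k) w)).
      by move=> w; rewrite /Defs.xi tk0 mul0r add0r.
    by apply: (measurable_wrtM sN); [exact: (measurable_wrt_cst sN)|exact: bridge_noise].
  have mA := noise_measurable NA.
  have bX : bounded_measurable (fun w => f (X w)).
    by apply: (bounded_measurable_comp mf bf); exact: measurable_funPT.
  rewrite (expectM_independent signal_noise_independent)//.
  - rewrite /posterior b0 ltxx expectZ//.
    exact: bounded_measurable_indic.
  - by apply: (measurable_wrt_comp mf); exact: measurable_wrt_gen.
  - exact: measurable_wrt_indic.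
  - exact: bounded_measurable_indic.
have {b0}b0 : 0 < b by rewrite lt_neqAle eq_sym b0.
pose s := index_enum ('I_n * 'I_K)%type.
pose cut (c : 'I_n * 'I_K -> R) i k := if obs i k then c (i, k) else 0.
pose kappa c := (\sum_i \sum_(k < K) cut c i k * ts k) / b.
have ZE c w : \sum_(p <- s) c p * Z p w =
    \sum_i \sum_(k < K) cut c i k * sigma i * beta i (ts k) w - kappa c * M w.
  have e1 : \sum_(p <- s) c p * Z p w =
      \sum_i \sum_(k < K) (cut c i k * sigma i * beta i (ts k) w -
                           cut c i k * ts k / b * M w).
    rewrite /s pair_bigA/=; apply: eq_bigr => -[i k] _ /=.
    by rewrite /Z /cut /=; case: (obs i k); ring.
  rewrite e1 /kappa !mulr_suml -sumrB; apply: eq_bigr => i _.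
  by rewrite !mulr_suml -sumrB.
have cut0 c i k : ~~ obs i k -> cut c i k = 0 by rewrite /cut => /negbTE ->.
have cosMZ u c theta :
    E (fun w => cos (u * M w + (\sum_(p <- s) c p * Z p w + theta))) =
    expR (- (b * u ^+ 2 / 2)) * E (fun w => cos (\sum_(p <- s) c p * Z p w + theta)).
  have e v th : E (fun w => cos (v * M w + (\sum_(p <- s) c p * Z p w + th))) =
      cos th * expR (- (((v - kappa c) ^+ 2 * b +
    2 * (v - kappa c) * (kappa c * b) + \sum_i W i (cut c i)) / 2)).
    rewrite divfK ?gt_eqF// -(noise_cos _ _ (cut0 c)).
    by apply: eq_Rintegral => w _; rewrite ZE; congr cos; ring.
  rewrite e; have := e 0 theta; under eq_Rintegral do rewrite mul0r add0r.
  move=> ->; rewrite [RHS]mulrCA -expRD; congr (_ * expR _); by field.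
have us : uniq s by exact: index_enum_uniq.
have mX : measurable_fun setT X by exact: measurable_funPT.
have := @bayes_family _ _ _ P X M b _ Z s noise_algebra us b0 mX sN
  noise_measurable signal_noise_independent NM NZ cosMZ f A mf bf.
under [in X in _ -> _ = X]eq_Rintegral do rewrite alphaE.
apply; set G := sigma_gen _.
have sG : sigma_algebra setT G by exact: sigma_gen_sigma_algebra.
apply: sigma_genP GA => // _ [i [k [ok ->]]].
have Ga : measurable_wrt G (fun w => b * X w + M w) by apply: measurable_wrt_gen; left.
have GZ : measurable_wrt G (Z (i, k)).
  by apply: measurable_wrt_gen; right; exists (i, k) => //=; exact: mem_index_enum.
apply: (measurable_wrt_ext (f := fun w => ts k / b * (b * X w + M w) + Z (i, k) w)).
  by move=> w; rewrite /Z /= ok /Defs.xi; field; rewrite gt_eqF.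
apply: (measurable_wrtD sG) => //.
by apply: (measurable_wrtM sG) => //; exact: (measurable_wrt_cst sG).
Qed.

End Schedule.
End FixedSchedule.

(** * Randomly modulated observation times *)

Section Trace.
Context (R : realType) (d : measure_display) (T : measurableType d).

(** On the event [K] a generated sigma-algebra has no more sets than the
    sigma-algebra [S] that measures copies of its generators on [K]. *)
Lemma sigma_gen_trace (fs : set (T -> R)) (S : set (set T)) (K A : set T) :
  sigma_algebra setT S ->
  (forall f, fs f -> exists g, measurable_wrt S g /\ forall w, K w -> f w = g w) ->
  sigma_gen fs A -> exists2 C, S C & A `&` K = C `&` K.
Proof.
move=> sS H GA.
pose F : set (set T) := [set A | exists2 C, S C & A `&` K = C `&` K].
suff : F A by [].
apply: sigma_genP GA; last first.
  move=> f /H[g [mg fg]] B mB; exists (g @^-1` B); first exact: mg.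
  by apply/seteqP; split => w /= [Bw Kw]; split => //; [rewrite -fg|rewrite fg].
have [S0 SC SU] := sS; split.
- by exists set0.
- move=> B [C SC' e]; rewrite setTD; exists (~` C); first exact: sigma_algebra_setC.
  apply/seteqP; split => w [nB Kw]; split => // nC; apply: nB.
    by have [] : (B `&` K) w by rewrite e; split.
  by have [] : (C `&` K) w by rewrite -e; split.
- move=> B FB; pose C k := sval (cid2 (FB k)).
  have CP k : S (C k) /\ B k `&` K = C k `&` K.
    by rewrite /C; case: cid2 => x /=.
  exists (\bigcup_k C k); first by apply: SU => k; have [] := CP k.
  by rewrite !setI_bigcupl; apply: eq_bigcupr => k _; have [] := CP k.
Qed.

Lemma expect_split (P : probability T R) (C : finType) (c : T -> C)
    (h : C -> T -> R) : (forall j, measurable (c @^-1` [set j])) ->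
  (forall j, bounded_measurable (h j)) ->
  \int[P]_w h (c w) w =
  \sum_j \int[P]_w (h j w * \1_(c @^-1` [set j]) w).
Proof.
move=> mc bh; rewrite -expect_sum => [|j]; last first.
  by apply: bounded_measurableM => //; exact: bounded_measurable_indic.
apply: eq_Rintegral => w _; rewrite (bigD1 (c w))//= indicE mem_set//= mulr1.
rewrite big1 ?addr0// => j jw; rewrite indicE memNset ?mulr0//= => e.
by rewrite e eqxx in jw.
Qed.

End Trace.

Section Grid.
Context (R : realType) (d : measure_display) (Omega : measurableType d).
Variables (P : probability Omega R) (n : nat) (X : {RV P >-> R}).
Variables (sigma : 'I_n -> R) (beta : 'I_n -> R -> {RV P >-> R}).
Variable J : 'I_n -> R -> Omega -> bool.
Hypothesis hsigma : forall i, 0 < sigma i.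
Hypothesis hbeta : forall i, brownian_bridge (beta i).
Hypothesis hindep : mutually_independent P (source_algebra X beta).

Definition state_algebra : set (set Omega) :=
  sigma_gen [set f | exists i t, 0 <= t <= 1 /\ f = (fun w => (J i t w)%:R : R)].

Definition signal_algebra : set (set Omega) :=
  sigma_gen ([set f | exists i t, 0 <= t <= 1 /\ f = xi X sigma beta i t]
    `|` [set (X : Omega -> R)]).

Hypothesis hJmeas : forall i t, 0 <= t <= 1 -> measurable_fun setT (J i t).
Hypothesis hJindep : independent P state_algebra signal_algebra.

Local Notation E f := (\int[P]_w f w).
Local Notation xi := (xi X sigma beta).

Lemma state_measurable : state_algebra `<=` measurable.
Proof.
apply: sigma_gen_measurable => _ [i [t [t01 ->]]].
have mj : measurable_fun setT (fun b : bool => b%:R : R) by [].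
exact: (measurableT_comp mj (hJmeas i t01)).
Qed.

Lemma xi_measurable i t : measurable_fun setT (xi i t).
Proof.
by apply: measurable_funD; apply: measurable_funM => //; exact: measurable_funPT.
Qed.

Lemma signal_measurable : signal_algebra `<=` measurable.
Proof.
apply: sigma_gen_measurable => _ [[i [t [_ ->]]]|->]; first exact: xi_measurable.
exact: measurable_funPT.
Qed.

(** The information of a finite set [D] of observation times. *)
Definition observed (D : seq R) : set (Omega -> R) :=
  [set f | (exists i u, u \in D /\ f = (fun w => (J i u w)%:R * xi i u w))
        \/ (exists i u, u \in D /\ f = (fun w => (J i u w)%:R))].

Definition grid_time (D : seq R) (i : 'I_n) (w : Omega) : R :=
  \big[Num.max/0]_(u <- D | J i u w) u.

Lemma measurable_posterior_comp f (a b : Omega -> R) : measurable_fun setT f ->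
  measurable_fun setT a -> measurable_fun setT b ->
  measurable_fun setT (fun w => posterior P X f (a w) (b w)).
Proof.
move=> mf ma mb.
have mX : measurable_fun setT X by exact: measurable_funPT.
exact: (measurableT_comp (@measurable_posterior _ _ _ P X mX f mf)
  (measurable_fun_pair ma mb)).
Qed.

(** On the event that the states at the times of [D] take given values, the
    schedule of observations is fixed, and that event is independent of signal
    and noise. *)
Lemma bayes_grid (D : seq R) (s : R) (f : R -> R) (A : set Omega) : s < 1 ->
  (forall u, u \in D -> 0 <= u <= s) ->
  measurable_fun setT f -> (exists N, forall x, `|f x| <= N) ->
  sigma_gen (observed D) A ->
  E (fun w => f (X w) * \1_A w) =
  E (fun w => posterior P X f (total_signal X sigma beta (grid_time D ^~ w) w)
                (total_precision sigma (grid_time D ^~ w)) * \1_A w).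
Proof.
move=> s1 Ds mf bf GA.
pose ts (k : 'I_(size D)) : R := nth 0 D k.
have tsD k : ts k \in D by exact: mem_nth.
have ts01 k : 0 <= ts k <= 1.
  by have /andP[-> /le_trans->//] := Ds _ (tsD k); exact: ltW.
pose conf w := [ffun p : 'I_n * 'I_(size D) => J p.1 (ts p.2) w].
pose tau (j : {ffun 'I_n * 'I_(size D) -> bool}) i : R :=
  \big[Num.max/0]_(k < size D | j (i, k)) ts k.
have grid_timeE w i : grid_time D i w = tau (conf w) i.
  rewrite /grid_time (big_nth 0) big_mkord; apply: eq_bigl => k.
  by rewrite ffunE.
have s0 : forall j i, 0 <= tau j i < 1.
  move=> j i; rewrite /tau; elim/big_rec: _ => [|k x _ /andP[x0 x1]]; first by rewrite lexx/=.
  have /andP[tk0 tks] := Ds _ (tsD k).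
  by rewrite le_max tk0/= gt_max x1 (le_lt_trans tks).
have obs_tau (j : {ffun 'I_n * 'I_(size D) -> bool}) i k : j (i, k) -> ts k <= tau j i.
  by move=> jk; rewrite /tau (bigD1 k)//= le_max lexx.
have conf_state j : state_algebra (conf @^-1` [set j]).
  pose h w : R := \sum_p ((J p.1 (ts p.2) w)%:R - (j p)%:R) * ((J p.1 (ts p.2) w)%:R - (j p)%:R).
  have -> : conf @^-1` [set j] = h @^-1` [set 0].
    apply/seteqP; split => w /=.
      move=> cw; rewrite /h big1// => p _; rewrite -cw.
      by rewrite ffunE subrr mul0r.
    move=> h0; apply/ffunP => p; rewrite ffunE.
    have /eqP := h0; rewrite /h psumr_eq0 => [|q _]; last exact: sqr_ge0.
    move=> /allP/(_ p (mem_index_enum p))/=.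
    rewrite mulf_eq0 orbb subr_eq0.
    by case: (J _ _ _); case: (j p) => //; rewrite ?oner_eq0// eq_sym oner_eq0.
  have sS : sigma_algebra setT state_algebra by exact: sigma_gen_sigma_algebra.
  have : measurable_wrt state_algebra h; last by apply; exact: measurable_set1.
  have H p : measurable_wrt state_algebra (fun w => (J p.1 (ts p.2) w)%:R - (j p)%:R : R).
    apply: (measurable_wrtB sS); last exact: (measurable_wrt_cst sS).
    by apply: measurable_wrt_gen; exists p.1, (ts p.2).
  by apply: (measurable_wrt_sum sS) => p _; exact: (measurable_wrtM sS).
have conf_measurable j : measurable (conf @^-1` [set j]).
  by apply: state_measurable; exact: conf_state.
pose Sj (j : {ffun 'I_n * 'I_(size D) -> bool}) :=
  sigma_gen [set h | exists i k, j (i, k) /\ h = xi i (ts k)].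
have sSj j : sigma_algebra setT (Sj j) by exact: sigma_gen_sigma_algebra.
have trace j : {C | Sj j C & A `&` conf @^-1` [set j] = C `&` conf @^-1` [set j]}.
  apply: cid2; apply: (sigma_gen_trace (sSj j)) GA => g.
  move=> [[i [u [uD ->]]]|[i [u [uD ->]]]].
    have kD : (index u D < size D)%N by rewrite index_mem.
    pose k := Ordinal kD; have tk : ts k = u by rewrite /ts nth_index.
    case jk : (j (i, k)); last first.
      exists (fun=> 0); split; first exact: (measurable_wrt_cst (sSj j)).
      by move=> w /= cw; move: jk; rewrite -cw ffunE tk /= => ->; rewrite mul0r.
    exists (xi i (ts k)); split; first by apply: measurable_wrt_gen; exists i, k.
    by move=> w /= cw; move: jk; rewrite -cw ffunE tk /= => ->; rewrite mul1r.
  have kD : (index u D < size D)%N by rewrite index_mem.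
  pose k := Ordinal kD; have tk : ts k = u by rewrite /ts nth_index.
  exists (fun=> (j (i, k))%:R); split; first exact: (measurable_wrt_cst (sSj j)).
  by move=> w /= cw; rewrite -cw ffunE tk.
pose C j := s2val (trace j).
have CS j : Sj j (C j) by rewrite /C; case: (trace j).
have CE j w : conf w = j -> \1_A w = \1_(C j) w :> R.
  move=> cw; rewrite /C; case: (trace j) => B _ /= e.
  rewrite !indicE; congr (_%:R); congr nat_of_bool; apply/idP/idP; rewrite !inE => Aw.
    by have [] : (B `&` conf @^-1` [set j]) w by rewrite -e; split.
  by have [] : (A `&` conf @^-1` [set j]) w by rewrite e; split.
have sSig : sigma_algebra setT signal_algebra by exact: sigma_gen_sigma_algebra.
have Sj_signal j : Sj j `<=` signal_algebra.
  apply: sigma_genP => // _ [i [k [jk ->]]].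
  by apply: measurable_wrt_gen; left; exists i, (ts k).
have mC j : measurable (C j) by apply: signal_measurable; apply: Sj_signal; exact: CS.
have mX : measurable_fun setT X by exact: measurable_funPT.
have SX : measurable_wrt signal_algebra X by apply: measurable_wrt_gen; right.
have bfX : bounded_measurable (fun w => f (X w)) by exact: (bounded_measurable_comp mf bf).
have sig_xi u i : 0 <= u <= 1 -> measurable_wrt signal_algebra (xi i u).
  by move=> u01; apply: measurable_wrt_gen; left; exists i, u.
have SA j : measurable_wrt signal_algebra (total_signal X sigma beta (tau j)).
  apply: (measurable_wrt_sum sSig) => i _; apply: (measurable_wrtM sSig).
    exact: (measurable_wrt_cst sSig).
  by apply: sig_xi; have /andP[-> /ltW] := s0 j i.
pose post j w := posterior P X f (total_signal X sigma beta (tau j) w)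
                   (total_precision sigma (tau j)).
have Spost j : measurable_wrt signal_algebra (post j).
  exact: (measurable_wrt_comp2 sSig (@measurable_posterior _ _ _ P X mX f mf)
    (SA j) (measurable_wrt_cst sSig (total_precision sigma (tau j)))).
have bpost j : bounded_measurable (post j).
  split; first exact: (measurable_wrt_measurable signal_measurable (Spost j)).
  by have [N fN] := bf; exists N => w; exact: posterior_bound.
have prodE g j : measurable_wrt signal_algebra g -> bounded_measurable g ->
    E (fun w => g w * \1_(C j) w * \1_(conf @^-1` [set j]) w) =
    E (fun w => g w * \1_(C j) w) * E (\1_(conf @^-1` [set j])).
  move=> Sg bg; apply: (expectM_independent (independentC hJindep)) => //.
  - apply: (measurable_wrtM sSig) => //.
    by apply: measurable_wrt_indic => //; exact: Sj_signal.
  - by apply: measurable_wrt_indic => //; exact: sigma_gen_sigma_algebra.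
  - by apply: bounded_measurableM => //; exact: bounded_measurable_indic.
  - exact: bounded_measurable_indic.
transitivity (\sum_j E (fun w => f (X w) * \1_(C j) w * \1_(conf @^-1` [set j]) w)).
  rewrite -(expect_split P (h := fun j w => f (X w) * \1_(C j) w))//.
    by apply: eq_Rintegral => w _; rewrite (CE (conf w)).
  by move=> j; apply: bounded_measurableM => //; exact: bounded_measurable_indic.
transitivity (\sum_j E (fun w => post j w * \1_(C j) w * \1_(conf @^-1` [set j]) w)).
  apply: eq_bigr => j _; rewrite (prodE (post j))// (prodE (fun w => f (X w)))//; last first.
    exact: (measurable_wrt_comp mf SX).
  congr (_ * _); apply: (bayes_schedule hsigma hbeta hindep ts01 (s0 j)) (CS j) => //.
  exact: obs_tau.
rewrite -(expect_split P (h := fun j w => post j w * \1_(C j) w))//; last first.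
  by move=> j; apply: bounded_measurableM => //; exact: bounded_measurable_indic.
apply: eq_Rintegral => w _; rewrite -(CE (conf w) w erefl).
have -> : grid_time D ^~ w = tau (conf w) by apply/funext => i; exact: grid_timeE.
by [].
Qed.

End Grid.

(** * Paths of the modulating process *)

Lemma gap_right (R : realFieldType) (l : seq R) (u : R) :
  exists2 e, 0 < e & forall x, x \in l -> u < x -> u + e <= x.
Proof.
elim: l => [|x l [e e0 H]]; first by exists 1.
have [xu|ux] := leP x u.
  exists e => // y; rewrite inE => /predU1P[->|]; last exact: H.
  by move=> uy; move: (lt_le_trans uy xu); rewrite ltxx.
exists (Num.min e (x - u)); first by rewrite lt_min e0 subr_gt0.
move=> y; rewrite inE => /predU1P[->|yl] uy.
  by rewrite addrC -lerBrDr ge_min lexx orbT.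
by apply: le_trans (H y yl uy); rewrite lerD2l ge_min lexx.
Qed.

Lemma gap_left (R : realFieldType) (l : seq R) (t : R) :
  exists2 e, 0 < e & forall x, x \in l -> x < t -> x <= t - e.
Proof.
have [e e0 H] := gap_right [seq - x | x <- l] (- t).
exists e => // x xl xt; rewrite -lerN2 opprB addrC; apply: H; last by rewrite ltrN2.
exact: map_f.
Qed.

Section Paths.
Context (R : realType) (d : measure_display) (Omega : measurableType d).
Variables (n : nat) (J : 'I_n -> R -> Omega -> bool).
Variable zeta : Omega -> seq {ffun 'I_n -> R}.
Hypothesis hJ : switches_at J zeta.

Let switches w : seq R := [seq (p : {ffun 'I_n -> R}) i | p <- zeta w, i <- enum 'I_n].

Let mem_switches w p i : p \in zeta w -> p i \in switches w.
Proof.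
by move=> pz; apply/allpairsP; exists (p, i); split => //=; rewrite mem_enum.
Qed.

Lemma state_right w u : 0 <= u -> exists2 e, 0 < e &
  forall i v, u <= v -> v < u + e -> v <= 1 -> J i v w = J i u w.
Proof.
move=> u0; have [e e0 H] := gap_right (switches w) u.
exists e => // i v uv ve v1; apply: hJ => // p pz; apply/negP => /andP[up pv].
have := H _ (mem_switches i pz) up.
by rewrite leNgt (le_lt_trans pv).
Qed.

Lemma state_left w t : t <= 1 -> exists2 e, 0 < e &
  forall i u v, 0 <= u -> t - e < u -> u <= v -> v < t -> J i v w = J i u w.
Proof.
move=> t1; have [e e0 H] := gap_left (switches w) t.
exists e => // i u v u0 eu uv vt; apply: hJ => //; first by rewrite (le_trans (ltW vt)).
move=> p pz; apply/negP => /andP[up pv].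
have := H _ (mem_switches i pz) (le_lt_trans pv vt).
by rewrite leNgt (lt_trans eu).
Qed.

Lemma last_active_ge0 i t w : 0 <= last_active J i t w.
Proof. by rewrite /last_active le_max lexx. Qed.

Let active_times i t w : set R := [set u | 0 <= u <= t /\ J i u w].

Let active_times_ub i t w : ubound (active_times i t w) t.
Proof. by move=> u [/andP[]]. Qed.

Lemma last_active_le i t w : 0 <= t -> last_active J i t w <= t.
Proof.
move=> t0; rewrite /last_active -/(active_times i t w) ge_max t0/=.
have [->|/set0P A0] := eqVneq (active_times i t w) set0; first by rewrite sup0.
by apply: ge_sup => //; exact: active_times_ub.
Qed.

Lemma le_last_active i t w u : 0 <= u <= t -> J i u w -> u <= last_active J i t w.
Proof.
move=> ut Ju; rewrite /last_active le_max; apply/orP; right.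
by apply: ub_le_sup => //; exists t; exact: active_times_ub.
Qed.

Lemma last_active_active i t w : 0 <= t -> J i t w -> last_active J i t w = t.
Proof.
move=> t0 Jt; apply/eqP; rewrite eq_le last_active_le//=.
by apply: le_last_active => //; rewrite t0 lexx.
Qed.

Lemma last_active_adherent i t w e : 0 < e -> e <= last_active J i t w ->
  exists u, [/\ 0 <= u <= t, J i u w & last_active J i t w - e < u].
Proof.
move=> e0 eL.
have L0 : 0 < last_active J i t w by exact: lt_le_trans eL.
have LE : last_active J i t w = sup (active_times i t w).
  by move: L0; rewrite /last_active -/(active_times i t w) /Num.max; case: ifP => //; rewrite ltxx.
have A0 : active_times i t w !=set0.
  by apply/set0P/eqP => A0; move: L0; rewrite LE A0 sup0 ltxx.
have hs : has_sup (active_times i t w).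
  by split => //; exists t; exact: active_times_ub.
by have [u [ut Ju] Lu] := sup_adherent e0 hs; exists u; rewrite LE.
Qed.

Lemma grid_time_ge0 (D : seq R) i w : 0 <= grid_time J D i w.
Proof.
rewrite /grid_time; elim/big_rec: _ => // u x _ x0.
by rewrite le_max x0 orbT.
Qed.

Lemma grid_time_le (D : seq R) s i w : (forall u, u \in D -> 0 <= u <= s) ->
  grid_time J D i w <= last_active J i s w.
Proof.
move=> Ds; rewrite /grid_time big_seq_cond.
elim/big_rec: _ => [|u x /andP[uD Ju] xL]; first exact: last_active_ge0.
by rewrite ge_max xL andbT; apply: le_last_active => //; exact: Ds.
Qed.

Lemma le_grid_time (D : seq R) i w u : u \in D -> J i u w -> u <= grid_time J D i w.
Proof.
rewrite /grid_time; elim: D => // v D ih; rewrite inE => /predU1P[<-|uD] Ju.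
  by rewrite big_cons Ju le_max lexx.
rewrite big_cons; case: ifP => _; last exact: ih.
by rewrite le_max ih// orbT.
Qed.

(** The end point is included, so that a source active at [s] is seen to be. *)
Definition refined (s : R) (m : nat) : seq R :=
  s :: [seq s * k%:R / m.+1%:R | k <- iota 0 m.+2].

Lemma refined_itv s m u : 0 <= s -> u \in refined s m -> 0 <= u <= s.
Proof.
move=> s0; rewrite inE => /predU1P[->|/mapP[k]]; first by rewrite s0 lexx.
rewrite mem_iota add0n => /andP[_ km] ->.
rewrite divr_ge0 ?mulr_ge0//= ler_pdivrMr ?ltr0n// ler_wpM2l//.
by rewrite ler_nat -ltnS.
Qed.

Lemma refined_right s m u : 0 <= u -> u < s ->
  exists v, [/\ v \in refined s m, u < v & v <= u + s / m.+1%:R].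
Proof.
move=> u0 us; have s0 : 0 < s by exact: le_lt_trans us.
have m0 : 0 < m.+1%:R :> R by rewrite ltr0n.
pose k := Num.truncn (u * m.+1%:R / s).
have q0 : 0 <= u * m.+1%:R / s by rewrite divr_ge0 ?mulr_ge0// ltW.
have /andP[k1 k2] := truncn_itv q0; rewrite -/k in k1 k2.
exists (s * k.+1%:R / m.+1%:R); split.
- rewrite inE; apply/orP; right; apply/mapP; exists k.+1 => //.
  rewrite mem_iota add0n ltnS -(ltr_nat R) (le_lt_trans k1)//.
  by rewrite ltr_pdivrMr// mulrC ltr_pM2l.
- by rewrite ltr_pdivlMr// [s * _]mulrC -ltr_pdivrMr.
- rewrite ler_pdivrMr// mulrDl divfK ?gt_eqF// -natr1 mulrDr mulr1 lerD2r.
  by rewrite mulrC -ler_pdivlMr.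
Qed.

(** Any active time is followed by a short interval of activity, which meets
    every fine enough grid. *)
Lemma grid_time_cvg (D : seq R) s i w : 0 <= s -> s <= 1 ->
  (forall u, u \in D -> 0 <= u <= s) ->
  grid_time J (D ++ refined s m) i w @[m --> \oo] --> last_active J i s w.
Proof.
move=> s0 s1 Ds; set L := last_active J i s w.
have Dm m u : u \in D ++ refined s m -> 0 <= u <= s.
  by rewrite mem_cat => /orP[/Ds//|]; exact: refined_itv.
suff H e : 0 < e -> \forall m \near \oo, L - e < grid_time J (D ++ refined s m) i w.
  apply/cvgrPdist_lt => e e0; near=> m.
  rewrite ger0_norm; last by rewrite subr_ge0; apply: grid_time_le => u; exact: Dm.
  by rewrite ltrBlDr -ltrBlDl; near: m; exact: H.
move=> e0; have [Le|eL] := ltP L e.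
  by near=> m; apply: lt_le_trans (grid_time_ge0 _ _ _); rewrite subr_lt0.
have [u [/andP[u0 us] Ju Lu]] := last_active_adherent e0 eL.
have [us'|{}us] := leP s u.
  have e1 : u = s by apply/eqP; rewrite eq_le us us'.
  near=> m; apply: (lt_le_trans Lu); apply: le_grid_time => //.
  by rewrite mem_cat inE e1 eqxx orbT.
have [r r0 Hr] := state_right w u0.
pose r' := Num.min r (s - u).
have r'0 : 0 < r' by rewrite lt_min r0 subr_gt0.
exists (Num.truncn (s / r')).+1 => // m /= hm.
have mesh : s / m.+1%:R < r'.
  rewrite ltr_pdivrMr ?ltr0n// mulrC -ltr_pdivrMr//.
  apply: (lt_le_trans (truncnS_gt _)); rewrite ler_nat.
  by rewrite (leq_trans hm).
have [v [vD uv vm]] := refined_right m u0 us.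
apply: (lt_le_trans Lu); apply: (le_trans (ltW uv)); apply: le_grid_time.
  by rewrite mem_cat vD orbT.
have vr' : v < u + r' by rewrite (le_lt_trans vm)// ltrD2l.
have vs : v <= s by have /andP[] := refined_itv s0 vD.
rewrite (Hr i v) ?(ltW uv)// ?(le_trans vs)//.
by apply: (lt_le_trans vr'); rewrite lerD2l ge_min lexx.
Unshelve. all: by end_near. Qed.

End Paths.

(** * Limits of the posterior *)

Section PosteriorLimit.
Context (R : realType) (d : measure_display) (T : measurableType d).
Variables (P : probability T R) (X : T -> R).
Hypothesis mX : measurable_fun setT X.
Local Notation E f := (\int[P]_w f w).

(** [tilt a b x] never exceeds [expR (a ^+ 2 / (2 * b))], so bounding that
    ratio dominates the likelihoods along a sequence of observations. *)
Lemma tilted_cvg (f : R -> R) (a_ b_ : nat -> R) (a b K : R) :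
  measurable_fun setT f -> (exists M, forall x, `|f x| <= M) ->
  (\forall m \near \oo, 0 < b_ m /\ a_ m ^+ 2 <= K * b_ m) ->
  a_ m @[m --> \oo] --> a -> b_ m @[m --> \oo] --> b ->
  tilted P X f (a_ m) (b_ m) @[m --> \oo] --> tilted P X f a b.
Proof.
move=> mf [M fM] [N _ HN] aa bb.
rewrite -(cvg_shiftn N) in aa; rewrite -(cvg_shiftn N) in bb.
rewrite -(cvg_shiftn N).
have M0 : 0 <= M by apply: le_trans (fM 0).
have mfX : measurable_fun setT (fun w => f (X w)) by exact: measurableT_comp.
have mt u v : measurable_fun setT (fun w => tilt u v (X w)).
  by apply: measurable_tilt2 => //; exact: measurable_cst.
apply: (@expect_cvg _ _ _ P _ _ (M * expR (K / 2))).
- by move=> m; exact: measurable_funM.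
- exact: measurable_funM.
- move=> m w; rewrite normrM ler_pM// ger0_norm ?(ltW (tilt_gt0 _ _ _))//.
  have [b0 aK] := HN (m + N)%N (leq_addl _ _).
  apply: (le_trans (tilt_le _ _ b0)); rewrite ler_expR.
  by rewrite invfM mulrA mulrAC ler_wpM2r ?invr_ge0// ler_pdivrMr.
- apply: aeW => w; apply: cvgMr; apply: continuous_cvg; first exact: continuous_expR.
  apply: cvgB; first exact: cvgMl.
  by apply: cvgMl; exact: cvgMl.
Qed.

Let one_bounded : exists M : R, forall x : R, `|(fun=> 1 : R) x| <= M.
Proof. by exists 1 => x; rewrite normr1. Qed.

Let m1 : measurable_fun setT (fun _ : R => 1 : R).
Proof. exact: measurable_cst. Qed.

Lemma posterior_cvg (f : R -> R) (a_ b_ : nat -> R) (a b : R) :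
  measurable_fun setT f -> (exists M, forall x, `|f x| <= M) -> 0 < b ->
  a_ m @[m --> \oo] --> a -> b_ m @[m --> \oo] --> b ->
  posterior P X f (a_ m) (b_ m) @[m --> \oo] --> posterior P X f a b.
Proof.
move=> mf bf b0 aa bb.
pose K := (`|a| + 1) ^+ 2 / (b / 2).
have HK : \forall m \near \oo, 0 < b_ m /\ a_ m ^+ 2 <= K * b_ m.
  near=> m.
  have bm : b / 2 < b_ m by near: m; apply: (cvgr_gt _ bb); lra.
  have bm0 : 0 < b_ m by rewrite (lt_trans _ bm)// divr_gt0.
  have am : `|a_ m| <= `|a| + 1.
    near: m; apply: (cvgr_norm_le _ aa); rewrite ltrDl//.
  have am2 : a_ m ^+ 2 <= (`|a| + 1) ^+ 2.
    by rewrite -real_normK ?num_real// ler_pXn2r ?nnegrE// addr_ge0.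
  split=> //; rewrite /K mulrAC ler_pdivlMr ?divr_gt0//.
  by apply: ler_pM => //; [exact: sqr_ge0|rewrite ltW// divr_gt0|exact: ltW].
have tc := tilted_cvg mf bf HK aa bb.
have t1 := tilted_cvg m1 one_bounded HK aa bb.
rewrite /posterior b0; apply: cvg_trans; last first.
  apply: (cvgM tc); apply: cvgV t1; rewrite gt_eqF//; exact: tilted1_gt0.
apply: near_eq_cvg; near=> m.
have [-> //] : 0 < b_ m /\ a_ m ^+ 2 <= K * b_ m by near: m; exact: HK.
Unshelve. all: by end_near. Qed.

Lemma tilted0 f : tilted P X f 0 0 = E (fun w => f (X w)).
Proof.
by apply: eq_Rintegral => w _; rewrite /tilt !mul0r subrr expR0 mulr1.
Qed.

(** With vanishing signal and precision the posterior tends to the prior, as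
    long as the signal is of the order of the square root of the precision. *)
Lemma posterior_cvg0 (f : R -> R) (a_ b_ : nat -> R) (K : R) :
  measurable_fun setT f -> (exists M, forall x, `|f x| <= M) ->
  (\forall m \near \oo, 0 < b_ m /\ a_ m ^+ 2 <= K * b_ m) ->
  a_ m @[m --> \oo] --> 0 -> b_ m @[m --> \oo] --> 0 ->
  posterior P X f (a_ m) (b_ m) @[m --> \oo] --> E (fun w => f (X w)).
Proof.
move=> mf bf HK aa bb.
have tc := tilted_cvg mf bf HK aa bb.
have t1 := tilted_cvg m1 one_bounded HK aa bb.
rewrite !tilted0 expect_cst in tc t1.
rewrite -[X in _ --> X]mulr1 -[X in _ * X]invr1; apply: cvg_trans; last first.
  by apply: (cvgM tc); apply: cvgV t1; rewrite oner_eq0.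
apply: near_eq_cvg; near=> m; rewrite /posterior.
have [-> //] : 0 < b_ m /\ a_ m ^+ 2 <= K * b_ m by near: m; exact: HK.
Unshelve. all: by end_near. Qed.

End PosteriorLimit.

Lemma within_continuous_cvg (R : realType) (g : R -> R) (a b : R) (u : nat -> R) (x : R) :
  {within `[a, b], continuous g} -> (forall m, a <= u m <= b) -> a <= x <= b ->
  u m @[m --> \oo] --> x -> g (u m) @[m --> \oo] --> g x.
Proof.
move=> /subspace_continuousP cg uab xab ux.
have xI : `[a, b]%classic x by rewrite /= in_itv.
apply: (cvg_comp u g _ (cg x xI)) => B.
rewrite /within/= => xB; have [N _ H] := ux _ xB.
exists N => // k /H; apply; rewrite /= in_itv/=; exact: uab.
Qed.

Section Regular.
Context (R : realType) (d : measure_display) (Omega : measurableType d).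
Variables (P : probability Omega R) (n : nat).
Variables (beta : 'I_n -> R -> {RV P >-> R}).
Hypothesis hbeta : forall i, brownian_bridge (beta i).

(** The almost sure properties of the noise that path-by-path limits use. *)
Definition regular_noise (w : Omega) : Prop := forall i,
  {within `[0, 1], continuous (fun t => beta i t w)} /\ beta i 0 w = 0.

(** The variance [t - t * t] vanishes at both ends. *)
Lemma bridge_pinned i t : 0 <= t <= 1 -> t = t * t -> {ae P, forall w, beta i t w = 0}.
Proof.
move=> t01 tt.
have mb : measurable_fun setT (beta i t) by exact: measurable_funPT.
have m2 : measurable_fun setT (fun w => (beta i t w * beta i t w)%:E).
  by apply/measurable_EFinP; exact: measurable_funM.
have := bridge_covariance (hbeta i) t01 t01; rewrite minxx -tt subrr => e.
have : (\int[P]_(w in setT) `|(beta i t w * beta i t w)%:E| = 0)%E.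
  by rewrite -[RHS]e; apply: eq_integral => w _; rewrite gee0_abs// lee_fin sqr_ge0.
move=> /(ae_eq_integral_abs P measurableT m2); apply: filterS => w /(_ I) /=.
by case=> /eqP; rewrite mulf_eq0 orbb => /eqP.
Qed.

Lemma ae_regular_noise : {ae P, forall w, regular_noise w}.
Proof.
apply: filter_forall => i; have [_ _ _ c] := hbeta i.
have z : 0 <= (0 : R) <= 1 by rewrite lexx ler01.
by apply: filterS2 c (bridge_pinned i z (esym (mulr0 0))) => w ? ?.
Qed.

End Regular.

Section TimeLimit.
Context (R : realType) (d : measure_display) (Omega : measurableType d).
Variables (P : probability Omega R) (n : nat) (X : {RV P >-> R}).
Variables (sigma : 'I_n -> R) (beta : 'I_n -> R -> {RV P >-> R}).
Hypothesis hsigma : forall i, 0 < sigma i.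
Local Notation xi := (xi X sigma beta).

Lemma xi_cvg w i (u : nat -> R) (t : R) : regular_noise beta w ->
  (forall m, 0 <= u m <= 1) -> 0 <= t <= 1 -> u m @[m --> \oo] --> t ->
  xi i (u m) w @[m --> \oo] --> xi i t w.
Proof.
move=> rw u01 t01 ut; apply: cvgD; first exact: cvgMl.
apply: cvgMr; exact: (within_continuous_cvg (proj1 (rw i))).
Qed.

Lemma xi0 w i : regular_noise beta w -> xi i 0 w = 0.
Proof. by move=> rw; rewrite /Defs.xi (proj2 (rw i)) mul0r mulr0 addr0. Qed.

Lemma source_weight_gt0 i t : t < 1 -> 0 < source_weight sigma i t.
Proof.
by move=> t1; rewrite /source_weight divr_gt0 ?subr_gt0// invr_gt0 exprn_gt0.
Qed.

Lemma source_weight_cvg i (u : nat -> R) (t : R) : t < 1 ->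
  u m @[m --> \oo] --> t -> source_weight sigma i (u m) @[m --> \oo] --> source_weight sigma i t.
Proof.
move=> t1 ut; apply: cvgMr; apply: cvgV; first by rewrite subr_eq0 gt_eqF.
by apply: cvgB => //; exact: cvg_cst.
Qed.

Lemma sum_cvg (I : Type) (s : seq I) (F : I -> nat -> R) (l : I -> R) :
  (forall i, F i m @[m --> \oo] --> l i) ->
  (\sum_(i <- s) F i m) @[m --> \oo] --> \sum_(i <- s) l i.
Proof.
move=> H; elim: s => [|i s ih].
  by under eq_cvg do rewrite big_nil; rewrite big_nil; exact: cvg_cst.
under eq_cvg do rewrite big_cons; rewrite big_cons; exact: cvgD.
Qed.

Lemma total_precision_cvg (u : nat -> 'I_n -> R) (t : 'I_n -> R) :
  (forall i, t i < 1) -> (forall i, u m i @[m --> \oo] --> t i) ->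
  total_precision sigma (u m) @[m --> \oo] --> total_precision sigma t.
Proof.
move=> t1 ut; apply: sum_cvg => i.
by apply: cvgM => //; exact: source_weight_cvg.
Qed.

Lemma total_signal_cvg w (u : nat -> 'I_n -> R) (t : 'I_n -> R) :
  regular_noise beta w -> (forall m i, 0 <= u m i <= 1) ->
  (forall i, 0 <= t i < 1) -> (forall i, u m i @[m --> \oo] --> t i) ->
  total_signal X sigma beta (u m) w @[m --> \oo] --> total_signal X sigma beta t w.
Proof.
move=> rw u01 t1 ut; apply: sum_cvg => i; have /andP[ti0 ti1] := t1 i.
apply: cvgM; first exact: source_weight_cvg.
by apply: xi_cvg => //; rewrite ti0 ltW.
Qed.

Lemma total_precision_ge0 (t : 'I_n -> R) : (forall i, 0 <= t i < 1) ->
  0 <= total_precision sigma t.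
Proof.
move=> t01; apply: sumr_ge0 => i _; have /andP[t0 t1] := t01 i.
by rewrite mulr_ge0// ltW// source_weight_gt0.
Qed.

(** Without precision nothing has been observed after time 0. *)
Lemma total_precision_eq0 (t : 'I_n -> R) : (forall i, 0 <= t i < 1) ->
  total_precision sigma t = 0 -> forall i, t i = 0.
Proof.
move=> t01 /eqP; rewrite psumr_eq0 => [|i _]; last first.
  by have /andP[t0 t1] := t01 i; rewrite mulr_ge0// ltW// source_weight_gt0.
move=> /allP H i; have := H i (mem_index_enum i); have /andP[t0 t1] := t01 i.
by rewrite /= mulf_eq0 (gt_eqF (source_weight_gt0 i t1)) => /eqP.
Qed.

End TimeLimit.

(** * The filtering formula before augmentation *)

Lemma measurable_invr (R : realType) : measurable_fun setT (fun x : R => x^-1).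
Proof.
have -> : [set: R] = [set x | x != 0] `|` [set 0].
  apply/seteqP; split => // x _ /=; have [->|] := eqVneq x 0; first by right.
  by left.
have o : open [set x : R | x != 0] by exact: open_neq.
apply/measurable_funU => //; first exact: open_measurable.
split; last exact: measurable_fun_set1.
by apply: open_continuous_measurable_fun => // x; rewrite inE/= => x0; exact: inv_continuous.
Qed.

Lemma measurable_source_weight (R : realType) n (sigma : 'I_n -> R) i :
  measurable_fun setT (source_weight sigma i).
Proof.
apply: measurable_funM => //; apply: (measurableT_comp (@measurable_invr R)).
exact: measurable_funB.
Qed.

Section Filtering.
Context (R : realType) (d : measure_display) (Omega : measurableType d).
Variables (P : probability Omega R) (n : nat) (X : {RV P >-> R}).
Variables (sigma : 'I_n -> R) (beta : 'I_n -> R -> {RV P >-> R}).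
Variable J : 'I_n -> R -> Omega -> bool.
Variable zeta : Omega -> seq {ffun 'I_n -> R}.
Hypothesis hcomplete : P.-negligible `<=` measurable.
Hypothesis hsigma : forall i, 0 < sigma i.
Hypothesis hbeta : forall i, brownian_bridge (beta i).
Hypothesis hindep : mutually_independent P (source_algebra X beta).
Hypothesis hJmeas : forall i t, 0 <= t <= 1 -> measurable_fun setT (J i t).
Hypothesis hJ : switches_at J zeta.
Hypothesis hJindep : independent P (state_algebra J) (signal_algebra X sigma beta).

Local Notation E f := (\int[P]_w f w).
Local Notation xi := (xi X sigma beta).
Local Notation raw := (modulated_filtration_raw X sigma beta J).

Definition signal_at (t : R) (w : Omega) : R :=
  total_signal X sigma beta (fun i => last_active J i t w) w.

Definition precision_at (t : R) (w : Omega) : R :=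
  total_precision sigma (fun i => last_active J i t w).

Lemma grid_time_mem (D : seq R) i w :
  (grid_time J D i w \in D /\ J i (grid_time J D i w) w) \/ grid_time J D i w = 0.
Proof.
rewrite /grid_time; elim: D => [|u D ih]; first by right; rewrite big_nil.
rewrite big_cons; case: ifP => Ju; last first.
  by case: ih => [[mD Jm]|->]; [left; rewrite inE mD orbT|right].
rewrite /Num.max; case: ifP => [_|_]; last by left; rewrite inE eqxx.
by case: ih => [[mD Jm]|->]; [left; rewrite inE mD orbT|right].
Qed.

Lemma grid_time_wrt F (D : seq R) i : sigma_algebra setT F ->
  (forall u, u \in D -> measurable_wrt F (fun w => (J i u w)%:R : R)) ->
  (forall u, u \in D -> 0 <= u) ->
  measurable_wrt F (grid_time J D i).
Proof.
move=> sF; elim: D => [|u D ih] FJ D0.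
  apply: (measurable_wrt_ext (f := fun=> 0)); last exact: measurable_wrt_cst.
  by move=> w; rewrite /grid_time big_nil.
apply: (measurable_wrt_ext (f := fun w => Num.max ((J i u w)%:R * u) (grid_time J D i w))).
  move=> w; rewrite /grid_time big_cons; case: (J i u w); rewrite ?mul1r ?mul0r//.
  by rewrite max_r//; exact: grid_time_ge0.
apply: (@measurable_wrt_comp2 _ _ _ F sF (fun w => (J i u w)%:R * u) (grid_time J D i)
  (fun z => Num.max z.1 z.2)).
- by apply: measurable_maxr; [exact: measurable_fst|exact: measurable_snd].
- apply: (measurable_wrtM sF); last exact: (measurable_wrt_cst sF).
  by apply: FJ; rewrite inE eqxx.
- by apply: ih => v vD; [apply: FJ|apply: D0]; rewrite inE vD orbT.
Qed.

Section LastActive.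
Variables (F : set (set Omega)) (t : R) (i : 'I_n).
Hypothesis sF : sigma_algebra setT F.
Hypothesis t01 : 0 <= t <= 1.
Hypothesis FJ : forall u, 0 <= u <= t -> measurable_wrt F (fun w => (J i u w)%:R : R).

Let t0 : 0 <= t. Proof. by have /andP[] := t01. Qed.
Let t1 : t <= 1. Proof. by have /andP[] := t01. Qed.

Let refined_wrt m : measurable_wrt F (grid_time J (refined t m) i).
Proof.
apply: grid_time_wrt => // u uD; first by apply: FJ; exact: (refined_itv t0 uD).
by have /andP[] := refined_itv t0 uD.
Qed.

Let refined_cvg w :
  grid_time J (refined t m) i w @[m --> \oo] --> last_active J i t w.
Proof. by apply: (grid_time_cvg hJ (D := [::]) t0 t1) => u; rewrite in_nil. Qed.

Lemma last_active_wrt : measurable_wrt F (last_active J i t).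
Proof. exact: (measurable_wrt_cvg sF refined_wrt refined_cvg). Qed.

Hypothesis cF : P.-negligible `<=` F.
Hypothesis Fxi : forall u, 0 <= u <= t -> measurable_wrt F (fun w => (J i u w)%:R * xi i u w).

(** A source that has not been active yet carries no information, because all
    bridges start at zero. *)
Lemma xi_last_active_wrt : measurable_wrt F (fun w => xi i (last_active J i t w) w).
Proof.
pose S m w : R := \sum_(u <- undup (refined t m))
  \1_(grid_time J (refined t m) i @^-1` [set u]) w * ((J i u w)%:R * xi i u w).
apply: (measurable_wrt_cvg_ae sF cF (f_ := S)).
  move=> m; pose D := undup (refined t m).
  apply: (measurable_wrt_ext (f := fun w => \sum_(u <- D | u \in D)
    \1_(grid_time J (refined t m) i @^-1` [set u]) w * ((J i u w)%:R * xi i u w))).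
    by move=> w; rewrite -big_seq.
  apply: (measurable_wrt_sum sF) => u.
  rewrite mem_undup => uD; apply: (measurable_wrtM sF).
    by apply: measurable_wrt_indic => //; apply: refined_wrt; exact: measurable_set1.
  by apply: Fxi; exact: (refined_itv t0 uD).
apply: filterS (ae_regular_noise hbeta) => w rw.
have SE m : S m w = xi i (grid_time J (refined t m) i w) w.
  set g := grid_time _ _ _ _.
  have S0 u : u != g -> \1_(grid_time J (refined t m) i @^-1` [set u]) w *
      ((J i u w)%:R * xi i u w) = 0.
    move=> ug; rewrite indicE memNset ?mul0r//= => gu.
    by rewrite /g gu eqxx in ug.
  have [[gD Jg]|g0] := grid_time_mem (refined t m) i w.
    rewrite /S (bigD1_seq g) ?undup_uniq ?mem_undup//= big1 => [|u]; last exact: S0.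
    by rewrite indicE mem_set//= Jg !mul1r addr0.
  rewrite -/g in g0; rewrite g0 (xi0 X sigma i rw) /S big1// => u _.
  have [->|/S0//] := eqVneq u g.
  by rewrite g0 (xi0 X sigma i rw) !mulr0.
under eq_cvg do rewrite SE; apply: xi_cvg => //.
- move=> m; rewrite grid_time_ge0/=; apply: (le_trans (y := t)) => //.
  apply: (le_trans (y := last_active J i t w)); last exact: last_active_le.
  by apply: grid_time_le => u; exact: refined_itv.
- by rewrite last_active_ge0/= (le_trans (last_active_le _ _ _ t0)).
Qed.

End LastActive.

Lemma signal_at_wrt F t : 0 <= t <= 1 -> sigma_algebra setT F -> P.-negligible `<=` F ->
  (forall i u, 0 <= u <= t -> measurable_wrt F (fun w => (J i u w)%:R : R)) ->
  (forall i u, 0 <= u <= t -> measurable_wrt F (fun w => (J i u w)%:R * xi i u w)) ->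
  measurable_wrt F (signal_at t) /\ measurable_wrt F (precision_at t).
Proof.
move=> t01 sF cF FJ Fxi.
have FL i : measurable_wrt F (last_active J i t) by exact: (last_active_wrt sF t01 (FJ i)).
have FW i : measurable_wrt F (fun w => source_weight sigma i (last_active J i t w)).
  apply: (measurable_wrt_comp (h := source_weight sigma i)) (FL i).
  exact: measurable_source_weight.
split; apply: (measurable_wrt_sum sF) => i _; apply: (measurable_wrtM sF) => //.
exact: (xi_last_active_wrt sF t01 (FJ i) cF (Fxi i)).
Qed.

Lemma precision_at_ge0 t w : 0 <= t < 1 -> 0 <= precision_at t w.
Proof.
move=> /andP[t0 t1]; apply: total_precision_ge0 => // i.
by rewrite last_active_ge0 (le_lt_trans (last_active_le _ _ _ t0)).
Qed.

Lemma signal_at_measurable t : 0 <= t <= 1 ->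
  measurable_fun setT (signal_at t) /\ measurable_fun setT (precision_at t).
Proof.
move=> t01.
have sM : sigma_algebra setT (@measurable d Omega) by exact: sigma_algebra_measurable.
have MJ i u : 0 <= u <= t -> measurable_fun setT (fun w => (J i u w)%:R : R).
  move=> /andP[u0 ut]; have mj : measurable_fun setT (fun b : bool => b%:R : R) by [].
  apply: (measurableT_comp mj); apply: hJmeas; rewrite u0 (le_trans ut)//.
  by have /andP[] := t01.
have W h : measurable_fun setT h -> measurable_wrt (@measurable d Omega) h.
  by move=> mh B mB; rewrite -[h @^-1` B]setTI; exact: mh.
have U h : measurable_wrt (@measurable d Omega) h -> measurable_fun setT h.
  by apply: measurable_wrt_measurable.
have [] := @signal_at_wrt (@measurable d Omega) t t01 sM hcomplete.
- by move=> i u ut; apply: W; exact: MJ.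
- by move=> i u ut; apply: W; apply: measurable_funM; [exact: MJ|exact: xi_measurable].
by move=> /U ms /U mp.
Qed.

Lemma posterior_at_measurable (f : R -> R) t : 0 <= t <= 1 ->
  measurable_fun setT f ->
  measurable_fun setT (fun w => posterior P X f (signal_at t w) (precision_at t w)).
Proof.
move=> t01 mf; have [ms mp] := signal_at_measurable t01.
exact: measurable_posterior_comp.
Qed.

(** Events that depend on finitely many times form a pi-system.  Such an event
    may be kept while the grid of times is refined, and then the last active
    times seen on the grid tend to the true ones. *)
Lemma bayes_raw (s : R) (f : R -> R) (A : set Omega) : 0 <= s < 1 ->
  measurable_fun setT f -> (exists N, forall x, `|f x| <= N) -> raw s A ->
  E (fun w => f (X w) * \1_A w) =
  E (fun w => posterior P X f (signal_at s w) (precision_at s w) * \1_A w).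
Proof.
move=> s01 mf bf RA; have /andP[s0 s1] := s01.
have s01' : 0 <= s <= 1 by rewrite s0 ltW.
pose D_ok (D : seq R) := forall u, u \in D -> 0 <= u <= s.
pose C : set (set Omega) := [set A | exists2 D, D_ok D & sigma_gen (observed X sigma beta J D) A].
have mX : measurable_fun setT X by exact: measurable_funPT.
have mfX : bounded_measurable (fun w => f (X w)) by exact: (bounded_measurable_comp mf bf).
have [N fN] := bf.
have mpost := posterior_at_measurable s01' mf.
have bpost : bounded_measurable (fun w => posterior P X f (signal_at s w) (precision_at s w)).
  by split => //; exists N => w; exact: posterior_bound.
have obsS D D' : {subset D <= D'} ->
    sigma_gen (observed X sigma beta J D) `<=` sigma_gen (observed X sigma beta J D').
  move=> DD'; apply: sigma_genP; first exact: sigma_gen_sigma_algebra.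
  move=> g [[i [u [uD ->]]]|[i [u [uD ->]]]]; apply: measurable_wrt_gen.
    by left; exists i, u; split => //; exact: DD'.
  by right; exists i, u; split => //; exact: DD'.
have MJ i u : 0 <= u <= s -> measurable_fun setT (fun w => (J i u w)%:R : R).
  move=> /andP[u0 us]; have mj : measurable_fun setT (fun b : bool => b%:R : R) by [].
  by apply: (measurableT_comp mj); apply: hJmeas; rewrite u0 (le_trans us)// ltW.
have Cm : C `<=` measurable.
  move=> B [D Ds]; apply: sigma_gen_measurable => g [[i [u [uD ->]]]|[i [u [uD ->]]]].
    by apply: measurable_funM; [apply: MJ; exact: Ds|exact: xi_measurable].
  by apply: MJ; exact: Ds.
have CI : setI_closed C.
  move=> A1 A2 [D1 D1s A1D] [D2 D2s A2D]; exists (D1 ++ D2).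
    by move=> u; rewrite mem_cat => /orP[/D1s|/D2s].
  apply: (sigma_algebra_setI (@sigma_gen_sigma_algebra _ _ _ _)).
    by apply: obsS A1D => u uD; rewrite mem_cat uD.
  by apply: obsS A2D => u uD; rewrite mem_cat uD orbT.
have CE B : C B -> E (fun w => f (X w) * \1_B w) =
    E (fun w => posterior P X f (signal_at s w) (precision_at s w) * \1_B w).
  move=> CB; have mB := Cm _ CB; have [D Ds BD] := CB.
  pose D_ m := D ++ refined s m.
  have D_s m : D_ok (D_ m).
    by move=> u; rewrite mem_cat => /orP[/Ds//|]; exact: refined_itv.
  pose post m w := posterior P X f
    (total_signal X sigma beta (fun i => grid_time J (D_ m) i w) w)
    (total_precision sigma (fun i => grid_time J (D_ m) i w)) * \1_B w.
  have postE m : E (post m) = E (fun w => f (X w) * \1_B w).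
    symmetry; apply: (bayes_grid hsigma hbeta hindep hJmeas hJindep s1 (@D_s m)) => //.
    by apply: obsS BD => u uD; rewrite mem_cat uD.
  have g01 m i w : 0 <= grid_time J (D_ m) i w <= last_active J i s w.
    by rewrite grid_time_ge0/= grid_time_le//; exact: D_s.
  have l01 i w : 0 <= last_active J i s w < 1.
    by rewrite last_active_ge0 (le_lt_trans (last_active_le _ _ _ s0)).
  have gcvg i w : grid_time J (D_ m) i w @[m --> \oo] --> last_active J i s w.
    by apply: (grid_time_cvg hJ) => //; exact: ltW.
  have mpost_ m : measurable_fun setT (post m).
    have mg i : measurable_fun setT (grid_time J (D_ m) i).
      apply: (measurable_wrt_measurable (F := measurable)) => //.
      apply: grid_time_wrt; first exact: sigma_algebra_measurable.
        move=> u uD B' mB'; rewrite -[X in measurable X]setTI.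
        by apply: (MJ i u (D_s m u uD)).
      by move=> u uD; have /andP[] := D_s m u uD.
    have mx i : measurable_fun setT (fun w => xi i (grid_time J (D_ m) i w) w).
      pose S w : R := \sum_(u <- undup (0 :: D_ m))
        \1_(grid_time J (D_ m) i @^-1` [set u]) w * xi i u w.
      have SE : (fun w => xi i (grid_time J (D_ m) i w) w) = S.
        apply/funext => w; set g := grid_time J (D_ m) i w.
        have gD : g \in 0 :: D_ m.
          by rewrite inE; case: (grid_time_mem (D_ m) i w) => [[-> _]|/eqP ->]; rewrite ?orbT.
        rewrite /S (bigD1_seq g) ?undup_uniq ?mem_undup//= indicE mem_set//= mul1r.
        rewrite big1 ?addr0// => u ug; rewrite indicE memNset ?mul0r//= => gu.
        by rewrite /g gu eqxx in ug.
      rewrite SE; apply: measurable_sum => u; apply: measurable_funM; last exact: xi_measurable.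
      apply: measurable_indic; rewrite -[X in measurable X]setTI.
      by apply: mg => //; exact: measurable_set1.
    have mw i : measurable_fun setT (fun w => source_weight sigma i (grid_time J (D_ m) i w)).
      exact: (measurableT_comp (measurable_source_weight sigma i)).
    apply: measurable_funM; last exact: measurable_indic.
    by apply: measurable_posterior_comp => //; apply: measurable_sum => i; exact: measurable_funM.
  have lim : E (post m) @[m --> \oo] -->
      E (fun w => posterior P X f (signal_at s w) (precision_at s w) * \1_B w).
    apply: (@expect_cvg _ _ _ P _ _ N) => //.
    - by apply: measurable_funM => //; exact: measurable_indic.
    - move=> m w; rewrite /post normrM indicE normr_nat.
      have := @posterior_bound _ _ _ P X mX f N
       (total_signal X sigma beta (fun i => grid_time J (D_ m) i w) w)
       (total_precision sigma (fun i => grid_time J (D_ m) i w)) mf fN.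
      have N0 := le_trans (normr_ge0 _) (fN 0).
      by case: (w \in B); rewrite ?mulr1// mulr0.
    - apply: filterS (ae_regular_noise hbeta) => w rw; apply: cvgMl.
      have [p0|p0] := eqVneq (precision_at s w) 0; last first.
        apply: posterior_cvg => //.
        + by rewrite lt_neqAle eq_sym p0 precision_at_ge0.
        + apply: total_signal_cvg => // m i; have /andP[-> gl] := g01 m i w.
          by rewrite (le_trans gl)// ltW//; have /andP[] := l01 i w.
        + by apply: total_precision_cvg => // i; have /andP[] := l01 i w.
      have L0 := total_precision_eq0 hsigma (l01 ^~ w) p0.
      apply: cvg_near_cst; apply: nearW => m.
      rewrite {2}/posterior p0 ltxx /posterior ifF//.
      apply/negbTE; rewrite -leNgt /total_precision big1// => i _.
      have -> : grid_time J (D_ m) i w = 0; last by rewrite mulr0.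
      by apply/eqP; rewrite eq_le; have := g01 m i w; rewrite L0 andbC.
  have e : (fun m => E (post m)) = (fun=> E (fun w => f (X w) * \1_B w)).
    by apply/funext => m; exact: postE.
  rewrite e in lim; apply: (cvg_unique _ _ lim) => //; exact: cvg_cst.
suff GA : <<s C >> A.
  apply: (expect_dynkin mfX bpost Cm CI _ CE GA).
  have e1 (h : Omega -> R) : E (fun w => h w * \1_setT w) = E h.
    by apply: eq_Rintegral => w _; rewrite indicT mulr1.
  have CT : C setT.
    exists [::]; first by move=> u; rewrite in_nil.
    by apply: sigma_algebra_setT; exact: sigma_gen_sigma_algebra.
  by have := CE _ CT; rewrite !e1.
have sC : sigma_algebra setT <<s C >> by exact: smallest_sigma_algebra.
apply: sigma_genP RA => // g [[i [u [us ->]]]|[[i [u [us ->]]]|->]].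
- move=> B mB; apply: sub_gen_smallest; exists [:: u].
    by move=> v; rewrite inE => /eqP ->.
  by apply: measurable_wrt_gen mB; left; exists i, u; rewrite inE eqxx.
- move=> B mB; apply: sub_gen_smallest; exists [:: u].
    by move=> v; rewrite inE => /eqP ->.
  by apply: measurable_wrt_gen mB; right; exists i, u; rewrite inE eqxx.
- apply: (measurable_wrt_ext (f := fun=> 0)); last exact: measurable_wrt_cst.
  by move=> w; rewrite lt_eqF// mulr0.
Qed.

End Filtering.

(** * The filtering formula for the augmented filtration *)

Section Completion.
Context (R : realType) (d : measure_display) (T : measurableType d).
Variable P : probability T R.

(** Completion only adds events that differ from given ones by null sets. *)
Lemma completed_ae (F : set (set T)) (A : set T) : sigma_algebra setT F ->
  <<s F `|` P.-negligible >> A ->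
  exists2 B, F B & {ae P, forall w, A w <-> B w}.
Proof.
move=> sF FA.
pose G : set (set T) := [set A | exists2 B, F B & {ae P, forall w, A w <-> B w}].
suff : G A by [].
apply: FA; split; last first.
  move=> B [FB|NB]; first by exists B => //; apply: aeW => w.
  exists set0; first by have [] := sF.
  by apply: negligibleS NB => w /= nBw; apply: contrapT => Bw; apply: nBw; split.
have [F0 FC FU] := sF; split.
- by exists set0 => //; apply: aeW => w.
- move=> B [C FB BC]; rewrite setTD; exists (~` C); first exact: sigma_algebra_setC.
  by apply: filterS BC => w BC /=; rewrite /setC/= BC.
- move=> B GB; pose C k := sval (cid2 (GB k)).
  have CP k : F (C k) /\ {ae P, forall w, B k w <-> C k w}.
    by rewrite /C; case: cid2 => x /=.
  exists (\bigcup_k C k); first by apply: FU => k; have [] := CP k.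
  have : {ae P, forall w, forall k, B k w <-> C k w}.
    by apply: ae_foralln => k; have [] := CP k.
  apply: filterS => w BC; split => -[k _ H]; exists k => //; exact/BC.
Qed.

Lemma expect_ae_set (h : T -> R) (A B : set T) : measurable_fun setT h ->
  measurable A -> measurable B -> {ae P, forall w, A w <-> B w} ->
  \int[P]_w (h w * \1_A w) = \int[P]_w (h w * \1_B w).
Proof.
move=> mh mA mB AB; apply: expect_ae.
- by apply: measurable_funM => //; exact: measurable_indic.
- by apply: measurable_funM => //; exact: measurable_indic.
apply: filterS AB => w AB; rewrite !indicE; congr (_ * (nat_of_bool _)%:R).
by apply/idP/idP; rewrite !inE => /AB.
Qed.

End Completion.

Section RightLimit.
Context (R : realType) (d : measure_display) (Omega : measurableType d).
Variables (n : nat) (J : 'I_n -> R -> Omega -> bool).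
Variable zeta : Omega -> seq {ffun 'I_n -> R}.
Hypothesis hJ : switches_at J zeta.

Lemma last_active_right w t : 0 <= t -> exists2 e, 0 < e &
  forall s i, t <= s -> s < t + e -> s <= 1 ->
    last_active J i s w = if J i t w then s else last_active J i t w.
Proof.
move=> t0; have [e e0 H] := state_right hJ w t0.
exists e => // s i ts se s1; case: ifP => Jt.
  by apply: last_active_active; [exact: le_trans ts|rewrite (H i s)].
rewrite /last_active; congr (Num.max 0 (sup _)); apply/seteqP.
split => u /= [/andP[u0 us] Ju]; last by rewrite u0 (le_trans us).
split => //; rewrite u0/=; have [//|tu] := leP u t.
by move: Ju; rewrite (H i u) ?Jt ?(ltW tu)// ?(le_lt_trans us) ?(le_trans us).
Qed.

End RightLimit.

Lemma cauchy_schwarz_weighted (R : realFieldType) n (p x : 'I_n -> R) :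
  (forall i, 0 <= p i) -> 0 < \sum_i p i ->
  (\sum_i p i * x i) ^+ 2 <= (\sum_i p i * x i ^+ 2) * \sum_i p i.
Proof.
move=> p0; set D := \sum_i p i; set B := \sum_i p i * x i => D0.
have : 0 <= \sum_i p i * (x i - B / D) ^+ 2.
  by apply: sumr_ge0 => i _; rewrite mulr_ge0 ?sqr_ge0.
have -> : \sum_i p i * (x i - B / D) ^+ 2 =
    \sum_i p i * x i ^+ 2 - B ^+ 2 / D.
  transitivity (\sum_i p i * x i ^+ 2 - 2 * (B / D) * B + (B / D) ^+ 2 * D).
    rewrite /B /D !mulr_sumr -sumrB -big_split/=; apply: eq_bigr => i _; ring.
  by field; rewrite gt_eqF.
by rewrite subr_ge0 ler_pdivrMr.
Qed.

Lemma eq_of_close_limits (R : realType) (c : R -> nat -> R) (L L' C : R) :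
  (forall K, 0 < K -> c K k @[k --> \oo] --> L) ->
  (forall K k, 0 < K -> `|c K k - L'| <= C / K) -> L = L'.
Proof.
move=> lim close.
have final K : 0 < K -> `|L - L'| <= C / K.
  move=> K0; have cn : `|c K k - L'| @[k --> \oo] --> `|L - L'|.
    by apply: cvg_norm; apply: cvgB; [exact: lim|exact: cvg_cst].
  by apply: (cvgr_to_le cn); apply: nearW => k; exact: close.
apply/eqP; rewrite -subr_eq0 -normr_le0; apply/ler_addgt0Pr => r r0.
rewrite add0r; pose K := `|C| / r + 1.
have K1 : 0 < K by rewrite ltr_wpDl// divr_ge0// ltW.
apply: (le_trans (final K K1)); rewrite ler_pdivrMr//.
apply: (le_trans (ler_norm C)).
by rewrite /K mulrDr mulr1 mulrC divfK ?gt_eqF// lerDl ltW.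
Qed.

Section Augmented.
Context (R : realType) (d : measure_display) (Omega : measurableType d).
Variables (P : probability Omega R) (n : nat) (X : {RV P >-> R}).
Variables (sigma : 'I_n -> R) (beta : 'I_n -> R -> {RV P >-> R}).
Variable J : 'I_n -> R -> Omega -> bool.
Variable zeta : Omega -> seq {ffun 'I_n -> R}.
Hypothesis hX : (X : Omega -> R) \in Lfun P 2%:E.
Hypothesis hcomplete : P.-negligible `<=` measurable.
Hypothesis hsigma : forall i, 0 < sigma i.
Hypothesis hbeta : forall i, brownian_bridge (beta i).
Hypothesis hindep : mutually_independent P (source_algebra X beta).
Hypothesis hJmeas : forall i t, 0 <= t <= 1 -> measurable_fun setT (J i t).
Hypothesis hJ : switches_at J zeta.
Hypothesis hJindep : independent P (state_algebra J) (signal_algebra X sigma beta).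

Local Notation E f := (\int[P]_w f w).
Local Notation xi := (xi X sigma beta).
Local Notation raw := (modulated_filtration_raw X sigma beta J).
Local Notation signal_at := (signal_at X sigma beta J).
Local Notation precision_at := (precision_at sigma J).

Let Q (s : R) (w : Omega) : R := \sum_i xi i s w ^+ 2 / s.

Let mQ s : measurable_fun setT (Q s).
Proof.
apply: measurable_sum => i; apply: measurable_funM => //.
by apply: measurable_funX; exact: xi_measurable.
Qed.

(** The second moment of an observation at a small time [s] is of the order of
    [s]. *)
Let energy_tail : exists C, forall s K, 0 < s <= 1 -> 0 < K ->
  E (\1_[set w | K < Q s w]) <= C / K.
Proof.
pose m2 := E (fun w => X w ^+ 2).
exists (\sum_i (2 * m2 + 2 * sigma i ^+ 2)) => s K /andP[s0 s1] K0.
have s01 : 0 <= s <= 1 by rewrite ltW.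
pose Y i w := 2 * X w ^+ 2 + 2 * sigma i ^+ 2 / s * (beta i s w * beta i s w).
have iX : P.-integrable setT (EFin \o (fun w => X w ^+ 2)) by exact: Lfun2_integrable_sqr.
have iB i : P.-integrable setT (EFin \o (fun w => beta i s w * beta i s w)).
  exact: (bridge_integrableM (hbeta i) s01 s01).
have iZ c (g : Omega -> R) : P.-integrable setT (EFin \o g) ->
    P.-integrable setT (EFin \o (fun w => c * g w)).
  by move=> ig; exact: (integrableZl measurableT c ig).
have iY i : P.-integrable setT (EFin \o Y i).
  exact: (integrableD measurableT (iZ 2 _ iX) (iZ (2 * sigma i ^+ 2 / s) _ (iB i))).
have EY i : E (Y i) <= 2 * m2 + 2 * sigma i ^+ 2.
  rewrite /Y RintegralD//; [|exact: iZ|exact: iZ].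
  rewrite !RintegralZl// lerD2l.
  have -> : E (fun w => beta i s w * beta i s w) = s - s * s.
    by rewrite /Rintegral (bridge_covariance (hbeta i) s01 s01) minxx.
  have -> : 2 * sigma i ^+ 2 / s * (s - s * s) = 2 * sigma i ^+ 2 * (1 - s).
    by field; rewrite gt_eqF.
  by apply: ler_piMr; [rewrite mulr_ge0 ?sqr_ge0|rewrite gerBl ltW].
have iS : P.-integrable setT (EFin \o (fun w => \sum_i Y i w)).
  rewrite (_ : EFin \o _ = (fun w => \sum_i (Y i w)%:E)%E); last first.
    by apply/funext => w; rewrite /= sumEFin.
  by apply: integrable_sum => // i _; exact: iY.
have QY w : Q s w <= \sum_i Y i w.
  apply: ler_sum => i _; rewrite ler_pdivrMr// /Y /Defs.xi.
  have -> : (2 * X w ^+ 2 + 2 * sigma i ^+ 2 / s * (beta i s w * beta i s w)) * s =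
    2 * s * X w ^+ 2 + 2 * (sigma i * beta i s w) ^+ 2 by field; rewrite gt_eqF.
  have h1 : (s * X w + sigma i * beta i s w) ^+ 2 <=
      2 * (s * X w) ^+ 2 + 2 * (sigma i * beta i s w) ^+ 2.
    rewrite -subr_ge0; set a := s * _; set b := sigma i * _.
    by rewrite (_ : _ - _ = (a - b) ^+ 2) ?sqr_ge0//; ring.
  apply: (le_trans h1); rewrite lerD2r -!mulrA ler_wpM2l// exprMn ler_wpM2r ?sqr_ge0//.
  by rewrite expr2 ger_pMr.
rewrite ler_pdivlMr//.
have mA : measurable [set w | K < Q s w].
  rewrite -[X in measurable X]setTI -[X in _ `&` X](preimage_itvoy (Q s) K).
  by apply: mQ.
have b1 : bounded_measurable (\1_[set w | K < Q s w] : Omega -> R).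
  exact: bounded_measurable_indic.
rewrite mulrC -(expectZ P K b1); apply: (@le_trans _ _ (E (fun w => \sum_i Y i w))).
  apply: le_Rintegral => //.
    by apply: integrable_bounded; apply: bounded_measurableM => //; exact: bounded_measurable_cst.
  move=> w _; apply: le_trans (QY w); rewrite indicE.
  case: (boolP (w \in _)) => wA; first by move: wA; rewrite inE mulr1 => /ltW.
  by rewrite mulr0; apply: sumr_ge0 => i _; rewrite divr_ge0 ?sqr_ge0// ltW.
have -> : E (fun w => \sum_i Y i w) = \sum_i E (Y i); last by apply: ler_sum => i _.
elim: (index_enum 'I_n) => [|i r ih].
  by under eq_Rintegral do rewrite big_nil; rewrite expect_cst big_nil.
under eq_Rintegral do rewrite big_cons.
rewrite big_cons RintegralD// ?ih//.
rewrite (_ : EFin \o _ = (fun w => \sum_(j <- r) (Y j w)%:E)%E); last first.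
  by apply/funext => w; rewrite /= sumEFin.
by apply: integrable_sum => // j _; exact: iY.
Qed.

Let C0 : R := \sum_i 2 * (sigma i) ^- 2.

(** The signal is a sum over sources of weights that add up to the precision, to
    which the inequality of Cauchy and Schwarz applies. *)
Let signal_sqr_le s w : 0 < s <= 2^-1 -> regular_noise beta w ->
  (forall i, last_active J i s w = s \/ last_active J i s w = 0) ->
  0 < precision_at s w ->
  signal_at s w ^+ 2 <= C0 * Q s w * precision_at s w.
Proof.
move=> /andP[s0 s2] rw sL p0.
have s1 : s < 1 by rewrite (le_lt_trans s2)// invf_lt1// ltr1n.
have W0 i u : u < 1 -> 0 < source_weight sigma i u by move=> u1; exact: source_weight_gt0.
pose p i := source_weight sigma i (last_active J i s w) * last_active J i s w.
pose x i := xi i (last_active J i s w) w / s.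
have -> : signal_at s w = \sum_i p i * x i.
  apply: eq_bigr => i _; rewrite /p /x; have [->|->] := sL i.
    by field; rewrite gt_eqF.
  by rewrite (xi0 X sigma i rw) !mul0r !mulr0.
have pp i : 0 <= p i.
  rewrite /p; have [->|->] := sL i; last by rewrite mulr0.
  by rewrite mulr_ge0// ltW// W0.
apply: (le_trans (cauchy_schwarz_weighted x pp p0)); rewrite ler_wpM2r ?(ltW p0)//.
rewrite /Q mulr_sumr; apply: ler_sum => i _.
have q0 : 0 <= xi i s w ^+ 2 / s by rewrite divr_ge0 ?sqr_ge0 ?ltW.
have C00 : 0 <= C0.
  by apply: sumr_ge0 => j _; rewrite mulr_ge0// invr_ge0 sqr_ge0.
rewrite /p /x; have [->|->] := sL i; last by rewrite mulr0 mul0r mulr_ge0.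
have -> : source_weight sigma i s * s * (xi i s w / s) ^+ 2 =
    source_weight sigma i s * (xi i s w ^+ 2 / s) by field; rewrite gt_eqF.
apply: ler_wpM2r => //; rewrite /C0 (bigD1 i)//= /source_weight.
have r0 : 0 <= sigma i ^- 2 by rewrite invr_ge0 sqr_ge0.
apply: (@le_trans _ _ (2 * sigma i ^- 2)); last first.
  by rewrite lerDl; apply: sumr_ge0 => j _; rewrite mulr_ge0// invr_ge0 sqr_ge0.
rewrite mulrC ler_wpM2r// -[leRHS]invrK lef_pV2 ?posrE ?invr_gt0 ?subr_gt0//.
by rewrite lerBrDr -lerBrDl (le_trans s2)//; lra.
Qed.

Lemma raw_measurable t : 0 <= t <= 1 -> raw t `<=` measurable.
Proof.
move=> /andP[t0 t1]; apply: sigma_gen_measurable.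
have MJ i u : 0 <= u <= t -> measurable_fun setT (fun w => (J i u w)%:R : R).
  move=> /andP[u0 us]; have mj : measurable_fun setT (fun b : bool => b%:R : R) by [].
  by apply: (measurableT_comp mj); apply: hJmeas; rewrite u0 (le_trans us).
move=> g [[i [u [ut ->]]]|[[i [u [ut ->]]]|->]]; last first.
- by apply: measurable_funM => //; exact: measurable_funPT.
- exact: MJ.
- by apply: measurable_funM; [exact: MJ|exact: xi_measurable].
Qed.

(** At positive times the filtering formula passes to right limits path by
    path.  At time 0 the posterior may oscillate, as the likelihood of the
    information at a small time [s] is only controlled by the energy
    [\sum_i xi i s ^+ 2 / s]; the energy is bounded in probability, so cutting
    it off at a level [K] costs an error of the order of [1 / K]. *)
Lemma bayes_filtration (t : R) (f : R -> R) (A : set Omega) : 0 <= t < 1 ->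
  measurable_fun setT f -> (exists N, forall x, `|f x| <= N) ->
  modulated_filtration P X sigma beta J t A ->
  E (fun w => f (X w) * \1_A w) =
  E (fun w => posterior P X f (signal_at t w) (precision_at t w) * \1_A w).
Proof.
move=> /andP[t0 t1] mf bf FA; have [N fN] := bf.
have N0 : 0 <= N := le_trans (normr_ge0 _) (fN 0).
have mX : measurable_fun setT X by exact: measurable_funPT.
pose s_ k : R := t + (1 - t) / k.+2%:R.
have onem : 0 < 1 - t by rewrite subr_gt0.
have ts k : t < s_ k by rewrite ltrDl divr_gt0// ltr0n.
have s1 k : s_ k < 1.
  rewrite -ltrBrDl ltr_pdivrMr ?ltr0n// -[ltLHS]mulr1 ltr_pM2l//.
  by rewrite ltr1n.
have s01 k : 0 <= s_ k <= 1 by rewrite (le_trans t0 (ltW (ts k))) ltW.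
have st : s_ k @[k --> \oo] --> t.
  rewrite -[X in _ --> X]addr0; apply: cvgD; first exact: cvg_cst.
  rewrite -[X in _ --> X](mulr0 (1 - t)); apply: cvgMr.
  have := @cvg_harmonic R; rewrite -(cvg_shiftn 1); apply: cvg_trans.
  by apply: near_eq_cvg; apply: nearW => k; rewrite /= addn1.
have rM k : raw (s_ k) `<=` measurable by exact: raw_measurable.
have sR k : sigma_algebra setT (raw (s_ k)) by exact: sigma_gen_sigma_algebra.
have FAk k : <<s raw (s_ k) `|` P.-negligible >> A.
  by apply: FA => /=; left; rewrite ts/= ltW.
have mA : measurable A.
  apply: g_sigma_algebra_measurable (FAk 0) => B [/rM//|]; exact: hcomplete.
pose post k w := posterior P X f (signal_at (s_ k) w) (precision_at (s_ k) w).
have mpost k : measurable_fun setT (post k) by apply: (posterior_at_measurable X sigma hcomplete hbeta hJmeas hJ).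
have mfX : measurable_fun setT (fun w => f (X w)) by exact: measurableT_comp.
have postE k : E (fun w => f (X w) * \1_A w) = E (fun w => post k w * \1_A w).
  have [B RB AB] := completed_ae (sR k) (FAk k).
  have mB := rM k _ RB.
  rewrite (expect_ae_set mfX mA mB AB) (expect_ae_set (mpost k) mA mB AB).
  apply: (bayes_raw hcomplete hsigma hbeta hindep hJmeas hJ hJindep) => //.
  by rewrite s1 andbT; have /andP[] := s01 k.
(* Only at time 0 is there anything to cut off. *)
pose cut (K : R) k w : R := if (t == 0) && (K < Q (s_ k) w) then 0 else signal_at (s_ k) w.
pose cpost K k w := posterior P X f (cut K k w) (precision_at (s_ k) w).
have msp k := signal_at_measurable X sigma hcomplete hbeta hJmeas hJ (s01 k).
have mcpost K k : measurable_fun setT (cpost K k).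
  have [ms mp] := msp k; apply: measurable_posterior_comp => //.
  rewrite /cut; case: (t == 0) => //=; apply: measurable_fun_ifT => //.
  exact: measurable_fun_ltr.
have [C HC] := energy_tail.
have bcpost K k w : `|cpost K k w| <= N by exact: posterior_bound.
have mpostt : measurable_fun setT (fun w => posterior P X f (signal_at t w) (precision_at t w)).
  by apply: (posterior_at_measurable X sigma hcomplete hbeta hJmeas hJ) => //; rewrite t0 ltW.
have l01 i w : 0 <= last_active J i t w < 1.
  by rewrite last_active_ge0 (le_lt_trans (last_active_le _ _ _ t0)).
have lk01 k i w : 0 <= last_active J i (s_ k) w <= 1.
  rewrite last_active_ge0 (le_trans (last_active_le _ _ _ _))//; last exact: ltW.
  by rewrite (le_trans t0)// ltW.
have lim_path K w : 0 < K -> regular_noise beta w ->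
    cpost K k w @[k --> \oo] --> posterior P X f (signal_at t w) (precision_at t w).
  move=> K0 rw; have [e e0 He] := last_active_right hJ w t0.
  have LE : \forall k \near \oo, forall i,
      last_active J i (s_ k) w = if J i t w then s_ k else last_active J i t w.
    near=> k => i; apply: He; [exact: ltW| |exact: ltW].
    by near: k; apply: (cvgr_lt _ st); rewrite ltrDl.
  have lcvg i : last_active J i (s_ k) w @[k --> \oo] --> last_active J i t w.
    case Jt : (J i t w).
      rewrite (last_active_active t0 Jt); apply: cvg_trans st; apply: near_eq_cvg.
      by apply: filterS LE => k ->; rewrite Jt.
    by apply: cvg_near_cst; apply: filterS LE => k ->; rewrite Jt.
  have scvg : signal_at (s_ k) w @[k --> \oo] --> signal_at t w.
    exact: total_signal_cvg.
  have pcvg : precision_at (s_ k) w @[k --> \oo] --> precision_at t w.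
    by apply: total_precision_cvg => // i; have /andP[] := l01 i w.
  have [p0|p0] := eqVneq (precision_at t w) 0; last first.
    have tN0 : (t == 0) = false.
      apply/negbTE; apply: contra_neq p0 => t00.
      rewrite /precision_at /total_precision big1// => i _.
      have -> : last_active J i t w = 0; last by rewrite mulr0.
      apply/eqP; rewrite eq_le last_active_ge0 andbT.
      by rewrite -[leRHS]t00 last_active_le.
    rewrite /cpost /cut tN0 /=; apply: posterior_cvg => //.
    by rewrite lt_neqAle eq_sym p0 precision_at_ge0// t0.
  have L0 := total_precision_eq0 hsigma (l01 ^~ w) p0.
  have -> : posterior P X f (signal_at t w) (precision_at t w) = E (fun w => f (X w)).
    by rewrite /posterior p0 ltxx.
  have [[i Ji]|noJ] := pselect (exists i, J i t w); last first.
    have nJ i : J i t w = false by apply/negbTE/negP => Ji; apply: noJ; exists i.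
    apply: cvg_near_cst; apply: filterS LE => k Lk; rewrite /cpost /posterior.
    rewrite /precision_at /total_precision big1 ?ltxx// => i _.
    by rewrite Lk nJ L0 mulr0.
  have t00 : t = 0 by rewrite -(last_active_active t0 Ji) L0.
  have s0 : signal_at t w = 0.
    rewrite /signal_at /total_signal big1// => j _.
    by rewrite L0 (xi0 X sigma j rw) mulr0.
  apply: (@posterior_cvg0 _ _ _ P X mX f _ _ (`|C0| * K)) => //; last by rewrite p0 in pcvg.
    near=> k.
    have Lk : forall j,
        last_active J j (s_ k) w = if J j t w then s_ k else last_active J j t w.
      by near: k; exact: LE.
    have k2 : 0 < s_ k <= 2^-1.
      rewrite -{1}t00 ts/=; near: k; apply: (cvgr_le _ st).
      by rewrite t00 invr_gt0.
    have pk : 0 < precision_at (s_ k) w.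
      have wi j : 0 <= source_weight sigma j (last_active J j (s_ k) w) * last_active J j (s_ k) w.
        rewrite mulr_ge0 ?last_active_ge0// ltW// source_weight_gt0//.
        by rewrite (le_lt_trans (last_active_le _ _ _ _)) ?s1//; have /andP[] := s01 k.
      rewrite /precision_at /total_precision (bigD1 i)//=.
      rewrite ltr_pwDl//; last by apply: sumr_ge0 => j _; exact: wi.
      rewrite Lk Ji mulr_gt0//; last by have /andP[] := k2.
      exact: source_weight_gt0.
    split => //; rewrite /cut t00 eqxx /=; case: ltP => QK.
      by rewrite expr0n/= mulr_ge0 ?mulr_ge0// ltW.
    have := signal_sqr_le k2 rw _ pk => H; apply: (le_trans (H _)).
      by move=> j; rewrite Lk; case: ifP => _; [left|right].
    rewrite ler_wpM2r ?(ltW pk)// (@le_trans _ _ (`|C0| * Q (s_ k) w))//.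
      rewrite ler_wpM2r ?ler_norm//; apply: sumr_ge0 => j _.
      by rewrite divr_ge0 ?sqr_ge0//; have /andP[] := s01 k.
    by rewrite ler_wpM2l.
  rewrite s0 in scvg; apply/cvgr0Pnorm_lt => r r0.
  move/cvgr0Pnorm_lt : scvg => /(_ r r0); apply: filterS => k.
  by rewrite /cut; case: ifP => // _ _; rewrite normr0.
have lim K : 0 < K -> E (fun w => cpost K k w * \1_A w) @[k --> \oo] -->
    E (fun w => posterior P X f (signal_at t w) (precision_at t w) * \1_A w).
  move=> K0; apply: (@expect_cvg _ _ _ P _ _ N).
  - by move=> k; apply: measurable_funM; [exact: mcpost|exact: measurable_indic].
  - by apply: measurable_funM; [exact: mpostt|exact: measurable_indic].
  - move=> k w; rewrite normrM indicE normr_nat.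
    by case: (w \in A); rewrite ?mulr1// mulr0.
  - by apply: filterS (ae_regular_noise hbeta) => w rw; apply: cvgMl; exact: lim_path.
have bA : bounded_measurable (\1_A : Omega -> R) by exact: bounded_measurable_indic.
have bc K k : bounded_measurable (fun w => cpost K k w * \1_A w).
  by apply: bounded_measurableM; [split; [exact: mcpost|exists N]|exact: bA].
have bp k : bounded_measurable (fun w => post k w * \1_A w).
  apply: bounded_measurableM; last exact: bA.
  by split; [exact: mpost|exists N => w; exact: posterior_bound].
have mQK k K : measurable [set w | K < Q (s_ k) w].
  rewrite -[X in measurable X]setTI -[X in _ `&` X](preimage_itvoy (Q (s_ k)) K).
  by apply: mQ.
have close K k : 0 < K ->
    `|E (fun w => cpost K k w * \1_A w) - E (fun w => f (X w) * \1_A w)| <= 2 * N * (C / K).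
  move=> K0; rewrite (postE k) -expectB//.
  have bQ : bounded_measurable (fun w => 2 * N * \1_[set w | K < Q (s_ k) w] w).
    apply: bounded_measurableM; first exact: bounded_measurable_cst.
    exact: bounded_measurable_indic.
  have le1 w : `|cpost K k w * \1_A w - post k w * \1_A w| <=
      2 * N * \1_[set w | K < Q (s_ k) w] w.
    rewrite -mulrBl normrM [\1_A w]indicE normr_nat.
    case: (boolP (w \in [set w | K < Q (s_ k) w])) => wQ.
      rewrite indicE wQ mulr1; apply: (@le_trans _ _ (`|cpost K k w - post k w| * 1)).
        by rewrite ler_wpM2l//; case: (w \in A).
      rewrite mulr1; apply: (le_trans (ler_normB _ _)).
      by rewrite mulrDl mul1r lerD//; exact: posterior_bound.
    have -> : cpost K k w = post k w.
      rewrite /cpost /cut; have -> : (K < Q (s_ k) w) = false; last by rewrite andbF.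
      by apply/negbTE; apply: contra wQ => h; rewrite inE.
    by rewrite subrr normr0 mul0r mulr_ge0// mulr_ge0.
  have up : E (fun w => 2 * N * \1_[set w | K < Q (s_ k) w] w) <= 2 * N * (C / K).
    rewrite expectZ; last exact: bounded_measurable_indic.
    by rewrite ler_wpM2l ?mulr_ge0//; apply: HC => //; rewrite (le_lt_trans t0 (ts k)) ltW.
  have bd : bounded_measurable (fun w => cpost K k w * \1_A w - post k w * \1_A w).
    exact: bounded_measurableB.
  rewrite ler_norml; apply/andP; split.
    rewrite lerNl; apply: le_trans up; rewrite -mulN1r -expectZ//.
    apply: expect_le => //; first by apply: bounded_measurableM => //; exact: bounded_measurable_cst.
    by move=> w; rewrite mulN1r; apply: le_trans (le1 w); rewrite -normrN ler_norm.
  apply: le_trans up; apply: expect_le => // w.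
  by apply: le_trans (le1 w); exact: ler_norm.
apply/esym; apply: (eq_of_close_limits (C := 2 * N * C) lim) => K k K0.
by rewrite -[leRHS]mulrA; exact: close.
Unshelve. all: by end_near. Qed.

End Augmented.

(** * Activations have no fixed times *)

Section ConditionalExpectation.
Context (R : realType) (d : measure_display) (T : measurableType d).
Variable P : probability T R.
Local Notation E f := (\int[P]_w f w).

Lemma integrable_indicM (Y : T -> R) (A : set T) : measurable A ->
  P.-integrable setT (EFin \o Y) ->
  P.-integrable setT (EFin \o (fun w => Y w * \1_A w)).
Proof.
move=> mA iY; have mY : measurable_fun setT Y.
  by apply/measurable_EFinP; exact: (measurable_int _ iY).
apply: (le_integrable measurableT _ _ iY).
  by apply/measurable_EFinP; apply: measurable_funM => //; exact: measurable_indic.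
move=> w _ /=; rewrite lee_fin normrM indicE normr_nat.
by case: (w \in A); rewrite ?mulr1// mulr0.
Qed.

Lemma integral_indicM (Y : T -> R) (A : set T) : measurable A ->
  P.-integrable setT (EFin \o Y) ->
  (\int[P]_(w in A) (Y w)%:E)%E = (E (fun w => Y w * \1_A w))%:E.
Proof.
move=> mA iY; rewrite /Rintegral fineK; last first.
  by apply: integrable_fin_num => //; exact: integrable_indicM.
rewrite [LHS]integral_mkcond. apply: eq_integral => w _.
by rewrite patchE indicE; case: ifP => _; rewrite ?mulr1// mulr0.
Qed.

(** The defining property of a conditional expectation, for real-valued
    integrals over the whole space. *)
Lemma cond_exp_indic (F : set (set T)) (Y Z : T -> R) (A : set T) :
  F `<=` measurable -> is_cond_exp P F Y Z -> F A ->
  E (fun w => Z w * \1_A w) = E (fun w => Y w * \1_A w).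
Proof.
move=> mF [iY _ iZ H] FA; have mA := mF _ FA.
by apply: EFin_inj; rewrite -!integral_indicM// H.
Qed.

Lemma is_cond_exp_bounded (F : set (set T)) (Y Z : T -> R) :
  F `<=` measurable -> bounded_measurable Y -> measurable_wrt F Z ->
  (exists M, forall w, `|Z w| <= M) ->
  (forall A, F A -> E (fun w => Y w * \1_A w) = E (fun w => Z w * \1_A w)) ->
  is_cond_exp P F Y Z.
Proof.
move=> mF bY FZ bZ H.
have bmZ : bounded_measurable Z by split => //; exact: (measurable_wrt_measurable mF).
split => //; [exact: integrable_bounded|exact: integrable_bounded|].
move=> A FA; have mA := mF _ FA.
by rewrite !integral_set_indic// H.
Qed.

End ConditionalExpectation.

Section Activation.
Context (R : realType) (d : measure_display) (Omega : measurableType d).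
Variables (n : nat) (J : 'I_n -> R -> Omega -> bool).
Variable zeta : Omega -> seq {ffun 'I_n -> R}.
Hypothesis hJ : switches_at J zeta.

Definition activation (s : R) (w : Omega) : bool :=
  (active J s w :\: active_left J s w)%SET != finset.set0.

Let no_activation s w :
  (forall i, exists2 r, r < s & forall v, r < v -> v < s -> J i v w = J i s w) ->
  activation s w = false.
Proof.
move=> H; apply/negbTE; rewrite negbK; apply/eqP/setP => i.
rewrite !inE; apply/negP => /andP[/negP L Ji]; apply: L; apply/asboolP.
have [r rs Hr] := H i; near=> u; rewrite (Hr u)//. 
Unshelve. all: by end_near. Qed.

Let points w : seq R := undup [seq (p : {ffun 'I_n -> R}) i | p <- zeta w, i <- enum 'I_n].

Let mem_points w p i : p \in zeta w -> p i \in points w.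
Proof.
by move=> pz; rewrite mem_undup; apply/allpairsP; exists (p, i); split => //=; rewrite mem_enum.
Qed.

(** Only coordinates of points of [zeta] can be activation times, so the
    activation count is a finite sum. *)
Let activation_points s w : 0 < s -> s <= 1 -> s \notin points w -> activation s w = false.
Proof.
move=> s0 s1 sp; apply: no_activation => i.
have [e e0 He] := gap_left (points w) s.
exists (Num.max 0 (s - e)); first by rewrite gt_max s0 ltrBlDr ltrDl.
move=> v; rewrite gt_max => /andP[v0 ev] vs; symmetry; apply: hJ => //; [exact: ltW..|].
move=> p pz; apply/negP => /andP[vp]; rewrite le_eqVlt => /predU1P[ps|ps].
  by move: sp; rewrite -ps mem_points.
have := He _ (mem_points i pz) ps.
by rewrite leNgt (lt_trans ev).
Qed.

Let activation_countE t w : t <= 1 -> activation_count J t w =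
  \sum_(x <- points w | 0 < x <= t) (activation x w)%:R.
Proof.
move=> t1; rewrite -big_filter.
transitivity (\sum_(s \in `]0, t]) ((activation s w)%:R : R)); first by [].
rewrite (fsbigE [seq x <- points w | 0 < x <= t])//.
- rewrite [LHS]big_filter_cond [RHS]big_filter; apply: eq_bigl => x.
  by rewrite mem_setE in_itv/= andbb.
- by rewrite filter_uniq// undup_uniq.
- by move=> x /=; rewrite mem_filter in_itv/= => /andP[].
- move=> x /=; rewrite in_itv/= mem_filter => /andP[x0 xt].
  rewrite x0 xt/= => xp.
  by rewrite -/(activation x w) activation_points// (le_trans xt).
Qed.

(** Just before a given time the activation count is constant. *)
Lemma activation_count_left t w : 0 < t <= 1 -> exists2 r, 0 <= r < t &
  forall s, r < s -> s < t ->
    activation_count J t w - activation_count J s w = (activation t w)%:R.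
Proof.
move=> /andP[t0 t1]; have [e e0 He] := state_left hJ w t1.
exists (Num.max 0 (t - e)); first by rewrite le_max lexx gt_max t0 ltrBlDr ltrDl.
move=> s; rewrite gt_max => /andP[s0 es] st.
have na x : s < x -> x < t -> activation x w = false.
  move=> sx xt; apply: no_activation => i; exists s => // v sv vx.
  by symmetry; apply: He; [exact: le_trans (ltW s0) (ltW sv)|exact: lt_trans es sv|exact: ltW|].
rewrite !activation_countE//; last by rewrite (le_trans (ltW st)).
rewrite (bigID (fun x => x <= s))/=.
rewrite (eq_bigl (fun x => 0 < x <= s)); last first.
  move=> x; have [xs|] := leP x s; last by rewrite !andbF.
  by rewrite !andbT (le_trans xs (ltW st)) andbT.
rewrite [X in X - _]addrC addrK.
have [tp|tp] := boolP (t \in points w); last first.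
  rewrite activation_points// big1_seq// => x /andP[/andP[/andP[x0 xt] xs] xp].
  have xt' : x < t by rewrite lt_neqAle xt andbT; apply: contraNneq tp => <-.
  by rewrite na// ltNge.
rewrite big_mkcond (bigD1_seq t)//= ?undup_uniq// t0 lexx -ltNge st/=.
rewrite big1 ?addr0// => x xt; case: ifP => // /andP[/andP[x0 xt'] xs].
by rewrite na// ?ltNge// -ltNge lt_neqAle xt.
Qed.

End Activation.

Section NoFixedActivation.
Context (R : realType) (d : measure_display) (Omega : measurableType d).
Variables (P : probability Omega R) (n : nat) (J : 'I_n -> R -> Omega -> bool).
Variable zeta : Omega -> seq {ffun 'I_n -> R}.
Hypothesis hJ : switches_at J zeta.
Hypothesis hcomplete : P.-negligible `<=` measurable.
Variables (F : R -> set (set Omega)) (lambda : R -> Omega -> R).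
Hypothesis mF : forall t, 0 <= t <= 1 -> F t `<=` measurable.
Hypothesis hint : {ae P, forall w, lebesgue_measure.-integrable `[0, 1]
                         (fun s => (lambda s w)%:E)}.
Local Notation E f := (\int[P]_w f w).

Let M t w := activation_count J t w -
  \int[lebesgue_measure]_(s in `[0, t]) lambda s w.

Hypothesis hM : martingale P F M.

(** The compensator is continuous, so [M] inherits the jump [b] of the count at
    [t].  As the increment of the martingale up to [t] integrates to zero over
    the bounded part of its past, so does [b]. *)
Lemma ae_no_activation t : 0 < t <= 1 -> {ae P, forall w, activation J t w = false}.
Proof.
move=> /andP[t0 t1]; have t01 : 0 <= t <= 1 by rewrite ltW.
pose s_ k : R := t - t / k.+2%:R.
have st k : s_ k < t by rewrite ltrBlDr ltrDl divr_gt0// ltr0n.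
have s0 k : 0 <= s_ k.
  by rewrite subr_ge0 ler_pdivrMr ?ltr0n// ler_peMr ?(ltW t0)// ler1n.
have s01 k : 0 <= s_ k <= 1 by rewrite s0/= (le_trans (ltW (st k))).
have scvg : s_ k @[k --> \oo] --> t.
  rewrite -[X in _ --> X]subr0; apply: cvgB; first exact: cvg_cst.
  rewrite -[X in _ --> X](mulr0 t); apply: cvgMr.
  have := @cvg_harmonic R; rewrite -(cvg_shiftn 1); apply: cvg_trans.
  by apply: near_eq_cvg; apply: nearW => k; rewrite /= addn1.
pose b w : R := (activation J t w)%:R.
have b01 w : 0 <= b w <= 1 by rewrite /b; case: activation; rewrite ?lexx ?ler01.
have Mcvg : {ae P, forall w, M t w - M (s_ k) w @[k --> \oo] --> b w}.
  apply: filterS hint => w iw.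
  have cint : \int[lebesgue_measure]_(s in `[0, s_ k]) lambda s w @[k --> \oo]
      --> \int[lebesgue_measure]_(s in `[0, t]) lambda s w.
    have c := parameterized_integral_continuous ler01 iw.
    exact: (within_continuous_cvg c).
  have t01' : 0 < t <= 1 by rewrite t0.
  have [r /andP[r0 rt] Hr] := activation_count_left hJ w t01'.
  have dcvg : activation_count J t w - activation_count J (s_ k) w @[k --> \oo] --> b w.
    apply: cvg_near_cst; near=> k; apply: Hr => //.
    by near: k; apply: (cvgr_gt _ scvg).
  rewrite -[b w]addr0 -(subrr (\int[lebesgue_measure]_(s in `[0, t]) lambda s w)).
  have -> : (fun k => M t w - M (s_ k) w) = (fun k =>
     (activation_count J t w - activation_count J (s_ k) w) +
     (\int[lebesgue_measure]_(s in `[0, s_ k]) lambda s w -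
      \int[lebesgue_measure]_(s in `[0, t]) lambda s w)).
    by apply/funext => k; rewrite /M; ring.
  by apply: cvgD => //; apply: cvgB => //; exact: cvg_cst.
have FM s : 0 <= s -> s <= 1 -> measurable_wrt (F s) (M s).
  by move=> ss0 ss1; have [] := hM ss0 ss1 (lexx 1).
have mM s : 0 <= s -> s <= 1 -> measurable_fun setT (M s).
  move=> ss0 ss1; apply: (measurable_wrt_measurable (F := F s)); last exact: FM.
  by apply: mF; rewrite ss0.
have iM : P.-integrable setT (EFin \o M t).
  by have [] := hM (ltW t0) (lexx t) t1.
have mb : measurable_fun setT b.
  apply: (measurable_wrt_measurable (F := measurable)) => //.
  apply: (measurable_wrt_cvg_ae (sigma_algebra_measurable _) hcomplete) Mcvg => k B mB.
  rewrite -[X in measurable X]setTI; apply: measurable_funB => //; apply: mM => //.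
    exact: ltW.
  by have /andP[] := s01 k.
have bb : bounded_measurable b.
  by split => //; exists 1 => w; have /andP[b0 b1] := b01 w; rewrite ger0_norm.
pose A K k : set Omega := [set w | `|M (s_ k) w| <= K].
have FA K k : F (s_ k) (A K k).
  have -> : A K k = M (s_ k) @^-1` `[- K, K].
    by apply/seteqP; split => w; rewrite /A /= in_itv/= ler_norml.
  by apply: FM => //; have /andP[] := s01 k.
have mA K k : measurable (A K k) by apply: (mF (s01 k)).
have iMs k : P.-integrable setT (EFin \o M (s_ k)).
  by have [] := hM (s0 k) (lexx (s_ k)) (proj2 (andP (s01 k))).
have incr K k : E (fun w => (M t w - M (s_ k) w) * \1_(A K k) w) = 0.
  have e := cond_exp_indic (mF (s01 k)) (hM (s0 k) (ltW (st k)) t1) (FA K k).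
  under eq_Rintegral do rewrite mulrBl.
  rewrite RintegralB; [by rewrite e subrr|exact: measurableT|exact: integrable_indicM..].
have bA K : E (fun w => b w * \1_(A K k) w) @[k --> \oo] --> 0.
  have lim : E (fun w => (b w - (M t w - M (s_ k) w)) * \1_(A K k) w) @[k --> \oo] -->
      E (fun=> 0).
    apply: (@Rintegral_dominated_cvg _ _ _ P _ _ (fun w => (1 + `|K|) + `|M t w|)).
    - move=> k; apply: measurable_funM; last exact: measurable_indic.
      apply: measurable_funB => //; apply: measurable_funB; apply: mM => //; first exact: ltW.
      by have /andP[] := s01 k.
    - exact: measurable_cst.
    - apply: (integrableD measurableT (f := fun=> (1 + `|K|)%:E) (g := fun w => `|M t w|%:E)).
        by apply: integrable_bounded; exact: bounded_measurable_cst.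
      exact: (integrable_norm iM).
    - move=> k w; rewrite normrM [\1_(A K k) w]indicE normr_nat.
      case: (boolP (w \in A K k)); last by rewrite mulr0 !addr_ge0.
      rewrite inE mulr1 => Aw; apply: (le_trans (ler_normB _ _)).
      have /andP[bw0 bw1] := b01 w; rewrite (ger0_norm bw0) -[leRHS]addrA.
      apply: lerD => //; apply: (le_trans (ler_normB _ _)); rewrite [leRHS]addrC.
      by apply: lerD => //; apply: (le_trans Aw); exact: ler_norm.
    - apply: filterS Mcvg => w Mw; apply/cvgr0Pnorm_lt => r r0.
      move/cvgrPdist_lt : Mw => /(_ r r0); apply: filterS => k.
      apply: le_lt_trans; rewrite normrM indicE normr_nat.
      by case: (w \in A K k); rewrite ?mulr1// mulr0.
  rewrite expect_cst in lim; apply: cvg_trans lim; apply: near_eq_cvg; apply: nearW => k.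
  have ib : P.-integrable setT (EFin \o b) by exact: integrable_bounded.
  have id : P.-integrable setT (EFin \o (fun w => M t w - M (s_ k) w)).
    exact: (integrableB measurableT iM (iMs k)).
  under eq_Rintegral do rewrite mulrBl.
  rewrite RintegralB//; [|exact: integrable_indicM|exact: integrable_indicM].
  by rewrite incr subr0.
pose B K : set Omega := [set w | `|M t w - b w| < K].
have mB K : measurable (B K).
  have m : measurable_fun setT (fun w => `|M t w - b w|).
    apply: measurableT_comp => //; apply: measurable_funB => //.
    by apply: mM => //; exact: ltW.
  rewrite -[X in measurable X]setTI -[X in _ `&` X](preimage_itvNyo (fun w => `|M t w - b w|) K).
  by apply: m.
have bB K : E (fun w => b w * \1_(B K) w) = 0.
  have bAB k : E (fun w => b w * \1_(B K) w * \1_(A K k) w) <= E (fun w => b w * \1_(A K k) w).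
    apply: expect_le.
    - by do 2! [apply: bounded_measurableM; last exact: bounded_measurable_indic].
    - by apply: bounded_measurableM => //; exact: bounded_measurable_indic.
    move=> w; have /andP[bw0 _] := b01 w; rewrite !indicE.
    by case: (w \in B K); case: (w \in A K k); rewrite ?mulr1 ?mulr0.
  have lim : E (fun w => b w * \1_(B K) w * \1_(A K k) w) @[k --> \oo] -->
      E (fun w => b w * \1_(B K) w).
    apply: (@expect_cvg _ _ _ P _ _ 1).
    - move=> k; apply: measurable_funM; last exact: measurable_indic.
      by apply: measurable_funM => //; exact: measurable_indic.
    - by apply: measurable_funM => //; exact: measurable_indic.
    - move=> k w; have /andP[bw0 bw1] := b01 w; rewrite !normrM !indicE !normr_nat.
      by case: (w \in B K); case: (w \in A K k); rewrite ?mulr1 ?mulr0.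
    - apply: filterS Mcvg => w Mw; apply: cvg_near_cst.
      have [wB|wB] := boolP (w \in B K); last first.
        by apply: nearW => k; rewrite [\1_(B K) w]indicE (negbTE wB) mulr0 mul0r.
      have Mk : M (s_ k) w @[k --> \oo] --> M t w - b w.
        rewrite (_ : (fun k => M (s_ k) w) = (fun k => M t w - (M t w - M (s_ k) w))).
          by apply: cvgB => //; exact: cvg_cst.
        by apply/funext => k; ring.
      move: wB; rewrite inE => wB; have H : \forall k \near \oo, `|M (s_ k) w| < K.
        exact: (cvgr_norm_lt _ Mk _ wB).
      apply: filterS H => k Mk_lt; rewrite [\1_(A K k) w]indicE mem_set ?mulr1//.
      exact: ltW.
  apply/eqP; rewrite eq_le; apply/andP; split.
    by apply: (ler_cvg_to lim (bA K)); apply: nearW => k; exact: bAB.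
  rewrite -[leLHS](expect_cst P 0); apply: expect_le.
  - exact: bounded_measurable_cst.
  - by apply: bounded_measurableM => //; exact: bounded_measurable_indic.
  - by move=> w; have /andP[bw0 _] := b01 w; rewrite mulr_ge0.
have Eb : E b = 0.
  have lim : E (fun w => b w * \1_(B m%:R) w) @[m --> \oo] --> E b.
    apply: (@expect_cvg _ _ _ P _ _ 1) => //.
    - by move=> m; apply: measurable_funM => //; exact: measurable_indic.
    - move=> m w; have /andP[bw0 bw1] := b01 w; rewrite normrM indicE normr_nat.
      by rewrite ger0_norm//; case: (w \in _); rewrite ?mulr1 ?mulr0.
    - apply: aeW => w; apply: cvg_near_cst; near=> m.
      rewrite indicE mem_set ?mulr1// /B /=.
      apply: (lt_le_trans (truncnS_gt _)); rewrite ler_nat.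
      by near: m; exact: nbhs_infty_ge.
  have e : (fun m => E (fun w => b w * \1_(B m%:R) w)) = (fun=> 0).
    by apply/funext => m; exact: bB.
  by symmetry; rewrite e in lim; apply: (cvg_unique _ _ lim) => //; exact: cvg_cst.
have : (\int[P]_(w in setT) `|(b w)%:E| = 0)%E.
  rewrite -[RHS]/(0%:E) -Eb -expect_EFin//; apply: eq_integral => w _.
  by have /andP[bw0 _] := b01 w; rewrite gee0_abs.
have mbE : measurable_fun setT (fun w => (b w)%:E) by exact/measurable_EFinP.
move=> /(ae_eq_integral_abs P measurableT mbE); apply: filterS => w /(_ I) /=.
by rewrite /b; case: activation => // -[/eqP]; rewrite oner_eq0.
Unshelve. all: by end_near. Qed.

End NoFixedActivation.

(** * Left limits of the posterior *)

Section LeftLimit.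
Context (R : realType) (d : measure_display) (Omega : measurableType d).
Variables (P : probability Omega R) (n : nat) (X : {RV P >-> R}).
Variables (sigma : 'I_n -> R) (beta : 'I_n -> R -> {RV P >-> R}).
Variable J : 'I_n -> R -> Omega -> bool.
Variable zeta : Omega -> seq {ffun 'I_n -> R}.
Hypothesis hsigma : forall i, 0 < sigma i.
Hypothesis hJ : switches_at J zeta.
Local Notation E f := (\int[P]_w f w).
Local Notation signal_at := (signal_at X sigma beta J).
Local Notation precision_at := (precision_at sigma J).

Lemma last_active_lt1 i s w : s < 1 -> last_active J i s w < 1.
Proof.
move=> s1; have [s0|s0] := leP 0 s.
  by apply: le_lt_trans s1; exact: last_active_le.
rewrite /last_active (_ : [set _ | _] = set0) ?sup0 ?maxxx//.
by rewrite -subset0 => u /= [/andP[u0 us] _]; move: (le_trans u0 us); rewrite leNgt s0.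
Qed.

(** Deactivations do not matter here: a source that stops at [t] was last
    active just before. *)
Lemma last_active_left w t : 0 < t <= 1 -> activation J t w = false ->
  exists2 r, 0 <= r < t & forall i,
    (forall s, r < s -> s < t -> last_active J i s w = s) /\ last_active J i t w = t \/
    (forall s, r < s -> s < t -> last_active J i s w = last_active J i t w).
Proof.
move=> /andP[t0 t1] noact; have [e e0 He] := state_left hJ w t1.
exists (Num.max 0 (t - e)); first by rewrite le_max lexx gt_max t0 ltrBlDr ltrDl.
move=> i; pose r := Num.max 0 (t - e).
have rt : r < t by rewrite gt_max t0 ltrBlDr ltrDl.
(* Any time strictly between [r] and [t] would do for comparing states. *)
pose c := (r + t) / 2.
have rc : r < c by rewrite /c; lra.
have ct : c < t by rewrite /c; lra.
have r0 : 0 <= r by rewrite le_max lexx.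
have er u : r < u -> t - e < u by rewrite gt_max => /andP[].
have Jc s : r < s -> s < t -> J i s w = J i c w.
  move=> rs st; have [sc|cs] := leP s c.
    by symmetry; apply: He => //; [exact/ltW/(le_lt_trans r0)|exact: er].
  by apply: He => //; [exact/ltW/(le_lt_trans r0)|exact: er|exact: ltW].
case Jci : (J i c w).
  left; split => [s rs st|].
    by apply: last_active_active; [exact/ltW/(le_lt_trans r0)|rewrite Jc].
  apply/eqP; rewrite eq_le last_active_le ?(ltW t0)//=.
  apply/ler_addgt0Pr => q q0; pose u := Num.max c (t - q).
  have ut : u < t by rewrite gt_max ct ltrBlDr ltrDl.
  have ru : r < u by rewrite lt_max rc.
  have : u <= last_active J i t w.
    apply: le_last_active; last by rewrite Jc.
    by rewrite (ltW (le_lt_trans r0 ru)) ltW.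
  by rewrite ge_max => /andP[_]; rewrite lerBlDr.
right => s rs st.
have nJt : J i t w = false.
  apply/negP => Jt; move: noact; rewrite /activation => /negbFE/eqP/setP/(_ i).
  rewrite !inE Jt andbT => /negbFE/asboolP near_t.
  have : \forall u \near t^'-, False.
    near=> u; have : J i u w by near: u.
    by rewrite Jc ?Jci//; near: u.
  by move=> /filter_ex[].
rewrite /last_active; congr (Num.max 0 (sup _)); apply/seteqP.
split => u /= [/andP[u0 us] Ju]; first by rewrite u0 (le_trans us)// ltW.
split => //; rewrite u0/=; have [//|su] := leP u s.
move: us; rewrite le_eqVlt => /predU1P[ut|ut]; first by rewrite -ut Ju in nJt.
by move: Ju; rewrite Jc ?Jci// (lt_trans rs).
Unshelve. all: by end_near. Qed.

Lemma posterior_left (f : R -> R) t w : 0 < t < 1 ->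
  measurable_fun setT f -> (exists M, forall x, `|f x| <= M) ->
  regular_noise beta w -> activation J t w = false ->
  posterior P X f (signal_at s w) (precision_at s w) @[s --> t^'-] -->
    posterior P X f (signal_at t w) (precision_at t w).
Proof.
move=> /andP[t0 t1] mf bf rw noact.
have mX : measurable_fun setT X by exact: measurable_funPT.
have t01 : 0 < t <= 1 by rewrite t0 ltW.
have [r /andP[r0 rt] Hr] := last_active_left t01 noact.
apply/cvg_at_leftP => u [ut ucvg].
have near_r : \forall k \near \oo, r < u k by exact: (cvgr_gt _ ucvg).
have lcvg i : last_active J i (u k) w @[k --> \oo] --> last_active J i t w.
  have [[H ->]|H] := Hr i.
    by apply: cvg_trans ucvg; apply: near_eq_cvg; apply: filterS near_r => k rk; rewrite H.
  by apply: cvg_near_cst; apply: filterS near_r => k rk; rewrite H.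
have l01 i : 0 <= last_active J i t w < 1 by rewrite last_active_ge0 last_active_lt1.
have lk01 k i : 0 <= last_active J i (u k) w <= 1.
  by rewrite last_active_ge0 ltW// last_active_lt1// (lt_trans (ut k)).
have [p0|p0] := eqVneq (precision_at t w) 0; last first.
  apply: posterior_cvg => //.
  - by rewrite lt_neqAle eq_sym p0 precision_at_ge0// ltW.
  - exact: total_signal_cvg.
  - by apply: total_precision_cvg => // i; have /andP[] := l01 i.
have L0 := total_precision_eq0 hsigma l01 p0.
apply: cvg_near_cst; apply: filterS near_r => k rk.
rewrite /posterior p0 ltxx /precision_at /total_precision big1 ?ltxx// => i _.
have [[_ lt]|->//] := Hr i; last by rewrite L0 mulr0.
by move: t0; rewrite -lt L0 ltxx.
Qed.

End LeftLimit.

(** * The conditional mean of the signal *)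

Section ConditionalMean.
Context (R : realType) (d : measure_display) (T : measurableType d).
Variables (P : probability T R) (X : {RV P >-> R}).
Variables (F : set (set T)) (a b m : T -> R).
Hypothesis sF : sigma_algebra setT F.
Hypothesis mF : F `<=` measurable.
Hypothesis Fa : measurable_wrt F a.
Hypothesis Fb : measurable_wrt F b.
Local Notation E f := (\int[P]_w f w).
Hypothesis bayes : forall (f : R -> R) A, measurable_fun setT f ->
  (exists N, forall x, `|f x| <= N) -> F A ->
  E (fun w => f (X w) * \1_A w) = E (fun w => posterior P X f (a w) (b w) * \1_A w).
Hypothesis hm : is_cond_exp P F X m.

Let mX : measurable_fun setT X. Proof. exact: measurable_funPT. Qed.
Let iX : P.-integrable setT (EFin \o X). Proof. by have [] := hm. Qed.

Let Fpost (f : R -> R) : measurable_fun setT f ->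
  measurable_wrt F (fun w => posterior P X f (a w) (b w)).
Proof.
by move=> mf; exact: (measurable_wrt_comp2 sF (@measurable_posterior _ _ _ P X mX f mf) Fa Fb).
Qed.

Let cutoff (k : nat) (x : R) : R := if `|x| <= k%:R then x else 0.

Let cutoff_measurable k : measurable_fun setT (cutoff k).
Proof.
apply: measurable_fun_ifT => //; apply: measurable_fun_ler => //.
Qed.

Let cutoff_le k x : `|cutoff k x| <= `|x|.
Proof. by rewrite /cutoff; case: ifP => //; rewrite normr0. Qed.

Let cutoff_bounded k : exists N, forall x, `|cutoff k x| <= N.
Proof. by exists k%:R => x; rewrite /cutoff; case: ifP => //; rewrite normr0. Qed.

Let cutoff_cvg x : cutoff k x @[k --> \oo] --> x.
Proof.
apply: cvg_near_cst; near=> k; rewrite /cutoff ifT//.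
apply: ltW; apply: (lt_le_trans (truncnS_gt _)); rewrite ler_nat.
by near: k; exact: nbhs_infty_ge.
Unshelve. all: by end_near. Qed.

Let tilt_norm_integrable u v : 0 < v ->
  P.-integrable setT (EFin \o (fun w => `|X w| * tilt u v (X w))).
Proof.
move=> v0; have mt : measurable_fun setT (fun w => tilt u v (X w)).
  by apply: measurable_tilt2 => //; exact: measurable_cst.
have i0 := integrableZl measurableT (expR (u ^+ 2 / (2 * v))) (integrable_norm iX).
apply: (le_integrable measurableT _ _ i0).
  by apply/measurable_EFinP; apply: measurable_funM => //; exact: measurableT_comp.
move=> w _ /=; rewrite lee_fin !normrM normr_id ger0_norm ?(ltW (tilt_gt0 _ _ _))//.
by rewrite ger0_norm ?expR_ge0// mulrC ler_wpM2r// tilt_le.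
Qed.

Let tilted_cutoff_cvg u v : 0 < v ->
  tilted P X (cutoff k) u v @[k --> \oo] --> tilted P X id u v.
Proof.
move=> v0; have mt : measurable_fun setT (fun w => tilt u v (X w)).
  by apply: measurable_tilt2 => //; exact: measurable_cst.
apply: (@Rintegral_dominated_cvg _ _ _ P _ _ (fun w => `|X w| * tilt u v (X w))).
- move=> k; apply: measurable_funM => //.
  exact: (measurableT_comp (@cutoff_measurable k) mX).
- exact: measurable_funM.
- exact: tilt_norm_integrable.
- move=> k w; rewrite normrM (ger0_norm (ltW (tilt_gt0 _ _ _))).
  by rewrite ler_wpM2r ?cutoff_le// ltW// tilt_gt0.
- by apply: aeW => w; apply: cvgMl; exact: cutoff_cvg.
Qed.

Let posterior_cutoff_le k u v : 0 < v ->
  `|posterior P X (cutoff k) u v| <= posterior P X (fun x => `|x|) u v.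
Proof.
move=> v0; have t1 := tilted1_gt0 P mX u v0; rewrite /posterior v0.
rewrite normrM normfV (gtr0_norm t1) ler_wpM2r ?invr_ge0 ?(ltW t1)//.
have ibk : P.-integrable setT (EFin \o (fun w => cutoff k (X w) * tilt u v (X w))).
  by apply: integrable_bounded; exact: bounded_tilt.
apply: (le_trans (le_normr_Rintegral measurableT ibk)); apply: le_Rintegral => //.
- exact: (integrable_norm ibk).
- exact: tilt_norm_integrable.
- move=> w _ /=; rewrite normrM (ger0_norm (ltW (tilt_gt0 _ _ _))).
  by rewrite ler_wpM2r ?cutoff_le// ltW// tilt_gt0.
Qed.

Let p w := posterior P X id (a w) (b w).
Let good (K : nat) : set T :=
  [set w | 0 < b w /\ posterior P X (fun x => `|x|) (a w) (b w) <= K%:R].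

Let Fgood K : F (good K).
Proof.
have -> : good K = b @^-1` `]0, +oo[ `&`
    (fun w => posterior P X (fun x => `|x|) (a w) (b w)) @^-1` `]-oo, K%:R].
  by apply/seteqP; split => w /=; rewrite !in_itv/= andbT.
apply: (sigma_algebra_setI sF); first exact: Fb.
by apply: (@Fpost (fun x => `|x|)).
Qed.

Let mean_on_good K A : F A ->
  E (fun w => m w * \1_(A `&` good K) w) = E (fun w => p w * \1_(A `&` good K) w).
Proof.
move=> FA; set B := A `&` good K.
have FB : F B by exact: (sigma_algebra_setI sF).
have mB := mF FB.
rewrite (cond_exp_indic mF hm FB).
have pm : measurable_fun setT p.
  by apply: (measurable_wrt_measurable mF); exact: Fpost.
have limX : E (fun w => cutoff k (X w) * \1_B w) @[k --> \oo] --> E (fun w => X w * \1_B w).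
  apply: (@Rintegral_dominated_cvg _ _ _ P _ _ (fun w => `|X w|)).
  - move=> k; apply: measurable_funM; last exact: measurable_indic.
    exact: (measurableT_comp (@cutoff_measurable k) mX).
  - by apply: measurable_funM => //; exact: measurable_indic.
  - exact: (integrable_norm iX).
  - move=> k w; rewrite normrM indicE normr_nat; apply: le_trans (cutoff_le k (X w)).
    by case: (w \in B); rewrite ?mulr1// mulr0.
  - by apply: aeW => w; apply: cvgMl; exact: cutoff_cvg.
have limp : E (fun w => posterior P X (cutoff k) (a w) (b w) * \1_B w) @[k --> \oo] -->
    E (fun w => p w * \1_B w).
  apply: (@expect_cvg _ _ _ P _ _ K%:R).
  - move=> k; apply: measurable_funM; last exact: measurable_indic.
    by apply: (measurable_wrt_measurable mF); exact: Fpost.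
  - by apply: measurable_funM => //; exact: measurable_indic.
  - move=> k w; rewrite normrM indicE normr_nat.
    case: (boolP (w \in B)); last by rewrite mulr0.
    rewrite inE mulr1 => -[_ [bw pw]]; apply: le_trans pw; exact: posterior_cutoff_le.
  - apply: aeW => w; rewrite indicE; case: (boolP (w \in B)); last first.
      by rewrite mulr0 => _; under eq_cvg do rewrite mulr0; exact: cvg_cst.
    rewrite inE => -[_ [bw _]]; apply: cvgMl; rewrite /p /posterior bw.
    by apply: cvgMl; exact: tilted_cutoff_cvg.
have e : (fun k => E (fun w => cutoff k (X w) * \1_B w)) =
    (fun k => E (fun w => posterior P X (cutoff k) (a w) (b w) * \1_B w)).
  by apply/funext => k; exact: bayes.
by rewrite e in limX; exact: (cvg_unique _ limX limp).
Qed.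

Let p_bound K w : good K w -> `|p w| <= K%:R.
Proof.
move=> [bw pw].
have c : `|posterior P X (cutoff k) (a w) (b w)| @[k --> \oo] --> `|p w|.
  apply: cvg_norm; rewrite /p /posterior bw.
  by apply: cvgMl; exact: tilted_cutoff_cvg.
apply: (cvgr_to_le c); apply: nearW => k.
by apply: le_trans pw; exact: posterior_cutoff_le.
Qed.

(** The mean of the signal is unbounded, so the formula is reached by cutting
    the signal off, on events where the posterior mean of [`|X|] is bounded. *)
Lemma cond_mean_posterior :
  {ae P, forall w, 0 < b w -> m w = posterior P X id (a w) (b w)}.
Proof.
have Fm : measurable_wrt F m by have [] := hm.
have im : P.-integrable setT (EFin \o m) by have [] := hm.
have pm : measurable_fun setT p.
  by apply: (measurable_wrt_measurable mF); exact: Fpost.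
have mm : measurable_fun setT m by exact: (measurable_wrt_measurable mF).
have onK K : {ae P, forall w, good K w -> m w = p w}.
  pose D w := (m w - p w) * \1_(good K) w.
  have mgood : measurable (good K) by exact/mF/Fgood.
  have bp : bounded_measurable (fun w => p w * \1_(good K) w).
    split; first by apply: measurable_funM => //; exact: measurable_indic.
    exists K%:R => w; rewrite normrM indicE normr_nat.
    case: (boolP (w \in good K)); last by rewrite mulr0.
    by rewrite inE mulr1 => /p_bound.
  have iD : P.-integrable setT (EFin \o D).
    apply: (eq_integrable measurableT (fun w => (m w * \1_(good K) w)%:E -
      (p w * \1_(good K) w)%:E)%E).
      by move=> w _; rewrite /= -EFinB -mulrBl.
    by apply: integrableB => //; [exact: integrable_indicM|exact: integrable_bounded].
  have D0 A : F A -> E (fun w => D w * \1_A w) = 0.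
    move=> FA; have mA := mF FA; have mAg := measurableI _ _ mA mgood.
    have e := mean_on_good K FA.
    have iI w : \1_(A `&` good K) w = \1_(good K) w * \1_A w :> R.
      by rewrite indicI mulrC.
    transitivity (E (fun w => m w * \1_(A `&` good K) w - p w * \1_(good K) w * \1_A w)).
      by apply: eq_Rintegral => w _; rewrite iI /D; ring.
    rewrite RintegralB//; [|exact: integrable_indicM|].
      by rewrite e; under eq_Rintegral do rewrite iI mulrA; rewrite subrr.
    apply: integrable_indicM => //; exact: integrable_bounded.
  have zero c A : c != 0 -> F A -> (forall w, A w -> 0 <= c * D w) ->
      {ae P, forall w, A w -> D w = 0}.
    move=> c0 FA pos; have mA := mF FA; have iDA := integrable_indicM mA iD.
    have icDA := integrableZl measurableT c iDA.
    have e0 : (\int[P]_w (c * (D w * \1_A w))%:E = 0)%E.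
      have -> : (\int[P]_w (c * (D w * \1_A w))%:E =
          (E (fun w => c * (D w * \1_A w)))%:E)%E.
        by rewrite /Rintegral fineK//; exact: integrable_fin_num.
      by rewrite RintegralZl// D0// mulr0.
    have : (\int[P]_(w in setT) `|(c * (D w * \1_A w))%:E| = 0)%E.
      rewrite -[RHS]e0; apply: eq_integral => w _; rewrite gee0_abs// lee_fin indicE.
      by case: (boolP (w \in A)); rewrite ?mulr0// inE mulr1 => /pos.
    move=> /(ae_eq_integral_abs P measurableT (measurable_int _ icDA)).
    apply: filterS => w /(_ I) /= + Aw; rewrite indicE mem_set// mulr1 => -[/eqP].
    by rewrite mulf_eq0 (negbTE c0) => /eqP.
  have FD : measurable_wrt F D.
    apply: (measurable_wrtM sF); first by apply: (measurable_wrtB sF) => //; exact: Fpost.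
    by apply: measurable_wrt_indic => //; exact: Fgood.
  have Fpos : F (D @^-1` `[0, +oo[) by exact: FD.
  have Fneg : F (D @^-1` `]-oo, 0]) by exact: FD.
  have zp : {ae P, forall w, (D @^-1` `[0, +oo[) w -> D w = 0}.
    apply: (zero 1) => //.
    by move=> w /=; rewrite in_itv/= andbT mul1r.
  have zn : {ae P, forall w, (D @^-1` `]-oo, 0]) w -> D w = 0}.
    apply: (zero (- 1)) => //.
    by move=> w /=; rewrite in_itv/= mulN1r oppr_ge0.
  apply: filterS2 zp zn => w zp zn gw; have : D w = 0.
    have [D0w|D0w] := leP 0 (D w); [apply: zp|apply: zn]; rewrite /= in_itv/= ?andbT//.
    exact: ltW.
  by rewrite /D indicE mem_set// mulr1 => /eqP; rewrite subr_eq0 => /eqP.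
have : {ae P, forall w, forall K, good K w -> m w = p w} by exact: ae_foralln.
apply: filterS => w H bw.
pose q := posterior P X (fun x => `|x|) (a w) (b w).
apply: (H (Num.truncn q).+1); split => //.
exact/ltW/truncnS_gt.
Qed.

End ConditionalMean.

(** * Derivatives of the posterior *)

Section TiltDerivative.
Context (R : realType) (d : measure_display) (T : measurableType d).
Variables (P : probability T R) (X : T -> R).
Hypothesis mX : measurable_fun setT X.
Local Notation tilted := (tilted P X).
Implicit Types f : R -> R.

Lemma norm_le_quad (x : R) : `|x| <= 1 + x ^+ 2.
Proof.
rewrite -[x ^+ 2]real_normK ?num_real//; move: `|x| (normr_ge0 x) => y y0.
have := sqr_ge0 (y - 1); have -> : (y - 1) ^+ 2 = y ^+ 2 - 2 * y + 1 by ring.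
by lra.
Qed.

Definition quadratic_growth f : Prop :=
  measurable_fun setT f /\ exists C, forall x, `|f x| <= C * (1 + x ^+ 2).

(** Half of the Gaussian factor absorbs any polynomial. *)
Let growth_tilt (A B C : R) : 0 < B -> exists K, forall a b x p : R,
  `|a| <= A -> B <= b -> `|p| <= C * (1 + x ^+ 2) ^+ 2 -> `|p * tilt a b x| <= K.
Proof.
move=> B0; pose c := 1 + 8 / B.
exists (`|C| * c ^+ 2 * expR (A ^+ 2 / B)) => a b x p aA Bb pC.
have A0 : 0 <= A by exact: le_trans aA.
have c0 : 0 < c by rewrite /c ltr_wpDr// divr_ge0// ltW.
have u0 : 0 <= B * x ^+ 2 / 8 by rewrite divr_ge0// mulr_ge0 ?sqr_ge0// ltW.
have x2 : 1 + x ^+ 2 <= c * expR (B * x ^+ 2 / 8).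
  apply: (@le_trans _ _ (c * (1 + B * x ^+ 2 / 8))); last first.
    by rewrite ler_pM2l// expR_ge1Dx.
  have -> : c * (1 + B * x ^+ 2 / 8) = 1 + x ^+ 2 + 8 / B + B * x ^+ 2 / 8.
    by rewrite /c; field; rewrite gt_eqF.
  by rewrite -addrA lerDl addr_ge0// divr_ge0// ltW.
have x4 : (1 + x ^+ 2) ^+ 2 <= c ^+ 2 * expR (B * x ^+ 2 / 4).
  have -> : c ^+ 2 * expR (B * x ^+ 2 / 4) = (c * expR (B * x ^+ 2 / 8)) ^+ 2.
    by rewrite exprMn -expRM_natl; congr (_ * expR _); field.
  by rewrite ler_pXn2r// nnegrE ?addr_ge0 ?sqr_ge0// mulr_ge0 ?expR_ge0// ltW.
rewrite normrM (gtr0_norm (tilt_gt0 _ _ _)).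
apply: (@le_trans _ _ ((`|C| * (c ^+ 2 * expR (B * x ^+ 2 / 4))) * tilt a b x)).
  rewrite ler_wpM2r ?(ltW (tilt_gt0 _ _ _))//; apply: (le_trans pC).
  apply: (@le_trans _ _ (`|C| * (1 + x ^+ 2) ^+ 2)).
    by rewrite ler_wpM2r ?sqr_ge0// ler_norm.
  by rewrite ler_wpM2l.
rewrite (_ : _ * tilt a b x =
  `|C| * c ^+ 2 * (expR (B * x ^+ 2 / 4) * tilt a b x)); last by ring.
apply: ler_wpM2l; first by rewrite mulr_ge0// sqr_ge0.
rewrite /tilt -expRD ler_expR.
have ax : a * x <= A * `|x|.
  by apply: (le_trans (ler_norm _)); rewrite normrM ler_wpM2r.
have bx : B * x ^+ 2 / 2 <= b * x ^+ 2 / 2 by rewrite !ler_wpM2r ?sqr_ge0.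
have sq : 0 <= (A - B * `|x| / 2) ^+ 2 / B by rewrite divr_ge0 ?sqr_ge0 ?ltW.
have sqE : (A - B * `|x| / 2) ^+ 2 / B = A ^+ 2 / B - A * `|x| + B * x ^+ 2 / 4.
  rewrite -[x ^+ 2]real_normK ?num_real//; field; rewrite gt_eqF//.
by rewrite sqE in sq; lra.
Qed.

Lemma growth_integrable f (a b : R) : measurable_fun setT f ->
  (exists C, forall x, `|f x| <= C * (1 + x ^+ 2) ^+ 2) -> 0 < b ->
  bounded_measurable (fun w => f (X w) * tilt a b (X w)).
Proof.
move=> mf [C fC] b0; have [K HK] := growth_tilt `|a| C b0.
split; last by exists K => w; exact: HK.
apply: measurable_funM; first exact: measurableT_comp.
by apply: measurable_tilt2 => //; exact: measurable_cst.
Qed.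

Let quad4 f C : (forall x, `|f x| <= C * (1 + x ^+ 2)) ->
  forall x, `|f x| <= `|C| * (1 + x ^+ 2) ^+ 2.
Proof.
move=> fC x; apply: (le_trans (fC x)).
have x0 : 1 <= 1 + x ^+ 2 by rewrite lerDl sqr_ge0.
apply: (@le_trans _ _ (`|C| * (1 + x ^+ 2))).
  by rewrite ler_wpM2r ?ler_norm// (le_trans _ x0).
by rewrite ler_wpM2l// expr2 ler_peMr// (le_trans _ x0).
Qed.

(** Differentiation under the expectation along a curve of signals and
    precisions; the curve may be a coordinate line or the motion in time with the
    effective information held fixed. *)
Lemma tilted_curve f (al be dal dbe : R -> R) (u v s A B : R) :
  quadratic_growth f -> 0 < B -> u < s < v ->
  (forall r : R, u < r < v -> is_derive r 1 al (dal r)) ->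
  (forall r : R, u < r < v -> is_derive r 1 be (dbe r)) ->
  (forall r, u < r < v -> [/\ `|al r| <= A, B <= be r, `|dal r| <= A & `|dbe r| <= A]) ->
  is_derive s 1 (fun r => tilted f (al r) (be r))
    (dal s * tilted (fun x => x * f x) (al s) (be s) -
     dbe s / 2 * tilted (fun x => x ^+ 2 * f x) (al s) (be s)).
Proof.
move=> [mf [C fC]] B0 suv dal_ dbe_ bnd.
pose F r w := f (X w) * tilt (al r) (be r) (X w).
pose F' r w := f (X w) * (dal r * X w - dbe r * X w ^+ 2 / 2) * tilt (al r) (be r) (X w).
have dF r w : u < r < v -> is_derive r 1 (F ^~ w) (F' r w).
  move=> ruv; have da := dal_ r ruv; have db := dbe_ r ruv.
  rewrite /F /F' /tilt.
  pose h q := al q * X w - be q * X w ^+ 2 / 2.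
  have dh : is_derive r 1 h (dal r * X w - dbe r * X w ^+ 2 / 2).
    have e1 : is_derive r 1 (fun q => al q * X w) (dal r * X w).
      by apply: is_derive_eq; rewrite /GRing.scale/=; ring.
    have e2 : is_derive r 1 (fun q => be q * X w ^+ 2 / 2) (dbe r * X w ^+ 2 / 2).
      have e := is_deriveM (is_deriveM db (is_derive_cst (X w ^+ 2) r 1)) (is_derive_cst (2^-1 : R) r 1).
      by apply: (is_derive_eq e); rewrite /GRing.scale/=; ring.
    exact: is_deriveB.
  have de := @is_derive1_comp _ expR h r _ _ (is_derive_expR (h r)) dh.
  have e := is_deriveM (is_derive_cst (f (X w)) r 1) de.
  by apply: (is_derive_eq e); rewrite /GRing.scale/= /h; ring.
have C0 : 0 <= C.
  by have := le_trans (normr_ge0 _) (fC 0); rewrite expr0n addr0 mulr1.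
have [K HK] := growth_tilt A (C * (2 * `|A|)) B0.
have F'K r w : u < r < v -> `|F' r w| <= K.
  move=> ruv; have [alA Bb dA dbA] := bnd _ ruv; apply: HK => //.
  rewrite normrM [leRHS](_ : _ = C * (1 + X w ^+ 2) * (2 * `|A| * (1 + X w ^+ 2))); last by ring.
  apply: ler_pM => //; apply: (le_trans (ler_normB _ _)).
  have x1 := norm_le_quad (X w).
  have q2 : 0 <= X w ^+ 2 / 2 by rewrite divr_ge0// sqr_ge0.
  rewrite -[dbe r * _ / 2]mulrA [`|dal r * _|]normrM [`|dbe r * _|]normrM (ger0_norm q2).
  have A0 : `|dal r| <= `|A| by exact: le_trans dA (ler_norm _).
  have A1 : `|dbe r| <= `|A| by exact: le_trans dbA (ler_norm _).
  have n0 := normr_ge0 A; have q0 := sqr_ge0 (X w).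
  have h1 : `|dal r| * `|X w| <= `|A| * (1 + X w ^+ 2) by exact: ler_pM.
  have h2 : `|dbe r| * X w ^+ 2 <= `|A| * (1 + X w ^+ 2).
    by apply: ler_pM => //; rewrite lerDr.
  have h3 : 0 <= `|dbe r| * X w ^+ 2 by rewrite mulr_ge0.
  by lra.
have intF r : `]u, v[%classic r -> P.-integrable setT (EFin \o F r).
  rewrite /= in_itv/= => ruv; have [_ Bb _ _] := bnd _ ruv.
  apply: integrable_bounded; apply: growth_integrable => //.
    by exists `|C|; exact: quad4.
  exact: lt_le_trans Bb.
have sI : `]u, v[%classic s by rewrite /= in_itv.
have derF r w : `]u, v[%classic r -> [set: T] w -> derivable (F ^~ w) r 1.
  by rewrite /= in_itv/= => ruv _; have [] := dF r w ruv.
have F'E r w : u < r < v -> partial1of2 F r w = F' r w.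
  by move=> ruv; rewrite partial1of2E; have [_ ->] := dF r w ruv.
have iK : P.-integrable setT (EFin \o (fun=> `|K|)).
  by apply: integrable_bounded; exact: bounded_measurable_cst.
have K_ge0 (w : T) : 0 <= `|K| by [].
have F'_ub r w : `]u, v[%classic r -> [set: T] w -> `|partial1of2 F r w| <= `|K|.
  rewrite /= in_itv/= => ruv _; rewrite F'E//.
  exact: le_trans (F'K r w ruv) (ler_norm _).
have D1 := derivable_under_integral measurableT sI intF derF K_ge0 iK F'_ub.
have D2 := differentiation_under_integral measurableT sI intF derF K_ge0 iK F'_ub.
apply: DeriveDef; first exact: D1.
rewrite -derive1E; transitivity (\int[P]_w F' s w).
  by rewrite D2; apply: eq_Rintegral => w _; rewrite F'E.
have [_ Bb _ _] := bnd _ suv; have b0 : 0 < be s by exact: lt_le_trans Bb.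
have b1 : bounded_measurable (fun w => X w * f (X w) * tilt (al s) (be s) (X w)).
  apply: (growth_integrable (f := fun x => x * f x)) => //; first exact: measurable_funM.
  exists `|C| => x; rewrite normrM [leRHS](_ : _ = (1 + x ^+ 2) * (`|C| * (1 + x ^+ 2))); last by ring.
  apply: ler_pM => //; last by apply: (le_trans (fC x)); rewrite ler_wpM2r ?ler_norm// addr_ge0// sqr_ge0.
  exact: norm_le_quad.
have b2 : bounded_measurable (fun w => X w ^+ 2 * f (X w) * tilt (al s) (be s) (X w)).
  apply: (growth_integrable (f := fun x => x ^+ 2 * f x)) => //.
    by apply: measurable_funM => //; exact: measurable_funX.
  exists `|C| => x; rewrite normrM [leRHS](_ : _ = (1 + x ^+ 2) * (`|C| * (1 + x ^+ 2))); last by ring.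
  apply: ler_pM => //; last by apply: (le_trans (fC x)); rewrite ler_wpM2r ?ler_norm// addr_ge0// sqr_ge0.
  by rewrite ger0_norm ?sqr_ge0// lerDr.
rewrite /tilted -expectZ// -expectZ// -expectB; last 2 first.
- by apply: bounded_measurableM => //; exact: bounded_measurable_cst.
- by apply: bounded_measurableM => //; exact: bounded_measurable_cst.
by apply: eq_Rintegral => w _; rewrite /F'; ring.
Qed.

End TiltDerivative.

Lemma is_derive_div (R : realType) (f g : R -> R) (x df dg : R) : g x != 0 ->
  is_derive x 1 f df -> is_derive x 1 g dg ->
  is_derive x 1 (fun y => f y / g y) (df / g x - f x * dg / g x ^+ 2).
Proof.
move=> gx df_ dg_; have e := is_deriveM df_ (is_deriveV gx dg_).
by apply: (is_derive_eq e); rewrite /GRing.scale/=; field.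
Qed.

Section PosteriorDerivative.
Context (R : realType) (d : measure_display) (T : measurableType d).
Variables (P : probability T R) (X : T -> R).
Hypothesis mX : measurable_fun setT X.
Variable f : R -> R.
Hypothesis mf : measurable_fun setT f.
Hypothesis bf : exists M, forall x, `|f x| <= M.
Local Notation tilted := (tilted P X).
Local Notation posterior := (posterior P X).

Let N k : R -> R -> R := tilted (fun x => x ^+ k * 1).
Let F k : R -> R -> R := tilted (fun x => x ^+ k * f x).

(** Derivatives of the quotient [F 0 / N 0]: differentiating in [a] multiplies
    the weight by the signal, differentiating in [b] by minus half its square. *)
Definition posterior_a (a b : R) : R := F 1 a b / N 0 a b - F 0 a b * N 1 a b / N 0 a b ^+ 2.

Definition posterior_aa (a b : R) : R :=
  F 2 a b / N 0 a b - 2 * F 1 a b * N 1 a b / N 0 a b ^+ 2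
  - F 0 a b * N 2 a b / N 0 a b ^+ 2 + 2 * F 0 a b * N 1 a b ^+ 2 / N 0 a b ^+ 3.

Definition posterior_b (a b : R) : R :=
  - (F 2 a b / N 0 a b - F 0 a b * N 2 a b / N 0 a b ^+ 2) / 2.

Let N_gt0 a b : 0 < b -> 0 < N 0 a b.
Proof.
move=> b0; have := tilted1_gt0 P mX a b0; rewrite /N; congr (0 < tilted _ a b).
by apply/funext => x; rewrite expr0 mulr1.
Qed.

Let posteriorE a b : 0 < b -> posterior f a b = F 0 a b / N 0 a b.
Proof.
move=> b0; rewrite /posterior b0 /F /N; congr (tilted _ a b / tilted _ a b).
  by apply/funext => x; rewrite expr0 mul1r.
by apply/funext => x; rewrite expr0 mulr1.
Qed.

(** The posterior mean of the signal makes the drift cancel the derivative in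
    the precision, since a unit of precision acts on the likelihood as minus
    half a second derivative in the signal. *)
Lemma posterior_heat a b : 0 < b ->
  posterior id a b * posterior_a a b + posterior_b a b + posterior_aa a b / 2 = 0.
Proof.
move=> b0; have N0 := lt0r_neq0 (N_gt0 a b0).
have -> : posterior id a b = N 1 a b / N 0 a b.
  rewrite /posterior b0 /N; congr (tilted _ a b / tilted _ a b).
    by apply/funext => x; rewrite expr1 mulr1.
  by apply/funext => x; rewrite expr0 mulr1.
by rewrite /posterior_a /posterior_b /posterior_aa; field.
Qed.

Let growthF k : (k < 2)%N -> quadratic_growth (fun x => x ^+ k * f x).
Proof.
move=> k2; have [M fM] := bf; split.
  by apply: measurable_funM => //; exact: measurable_funX.
exists `|M| => x; rewrite normrM mulrC; apply: ler_pM => //.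
  exact: le_trans (fM x) (ler_norm _).
case: k k2 => [|[|//]] _; first by rewrite expr0 normr1 lerDl sqr_ge0.
by rewrite expr1 norm_le_quad.
Qed.

Let growthN k : (k < 2)%N -> quadratic_growth (fun x : R => x ^+ k * 1).
Proof.
move=> k2; split; first by apply: measurable_funM => //; exact: measurable_funX.
exists 1 => x; rewrite mul1r mulr1.
case: k k2 => [|[|//]] _; first by rewrite expr0 normr1 lerDl sqr_ge0.
by rewrite expr1 norm_le_quad.
Qed.

Let step (g : R -> R) k : (fun x => x * (x ^+ k * g x)) = (fun x => x ^+ k.+1 * g x).
Proof. by apply/funext => x; rewrite exprS mulrA. Qed.

Let tilted_da (g : R -> R) (a b : R) : quadratic_growth g -> 0 < b ->
  is_derive a 1 (fun q => tilted g q b) (tilted (fun x => x * g x) a b).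
Proof.
move=> qg b0.
have H := @tilted_curve _ _ _ P X mX g id (fun=> b) (fun=> 1) (fun=> 0) (a - 1) (a + 1) a
  (`|a| + 1) b qg b0.
have I : a - 1 < a < a + 1 by apply/andP; split; lra.
have H1 (r : R) : a - 1 < r < a + 1 -> is_derive r 1 (id : R -> R) 1.
  by move=> _; exact: is_derive_id.
have H2 (r : R) : a - 1 < r < a + 1 -> is_derive r 1 (fun=> b : R) 0.
  by move=> _; exact: is_derive_cst.
have H3 (r : R) : a - 1 < r < a + 1 ->
    [/\ `|r| <= `|a| + 1, b <= b, `|1 : R| <= `|a| + 1 & `|0 : R| <= `|a| + 1].
  move=> /andP[ra ar]; split => //.
  - rewrite -[r](subrK a) addrC; apply: (le_trans (ler_normD _ _)).
    by rewrite lerD2l ler_norml; apply/andP; split; lra.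
  - by rewrite normr1 lerDr.
  - by rewrite normr0 addr_ge0.
by apply: (is_derive_eq (H I H1 H2 H3)); rewrite mul1r mul0r mul0r subr0.
Qed.

Let dF k (a b : R) : (k < 2)%N -> 0 < b -> is_derive a 1 (F k ^~ b) (F k.+1 a b).
Proof. by move=> k2 b0; have := tilted_da a (growthF k2) b0; rewrite step. Qed.

Let dN k (a b : R) : (k < 2)%N -> 0 < b -> is_derive a 1 (N k ^~ b) (N k.+1 a b).
Proof. by move=> k2 b0; have := tilted_da a (growthN k2) b0; rewrite step. Qed.

Lemma is_derive_posterior_a (a b : R) : 0 < b ->
  is_derive a 1 (posterior f ^~ b) (posterior_a a b).
Proof.
move=> b0; have -> : posterior f ^~ b = (fun q => F 0 q b / N 0 q b).
  by apply/funext => q; exact: posteriorE.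
have N0 := lt0r_neq0 (N_gt0 a b0).
exact: (@is_derive_div _ (F 0 ^~ b) (N 0 ^~ b) a _ _ N0 (dF (k := 0) a isT b0) (dN (k := 0) a isT b0)).
Qed.

Lemma is_derive_posterior_aa (a b : R) : 0 < b ->
  is_derive a 1 (posterior_a ^~ b) (posterior_aa a b).
Proof.
move=> b0; have N0 := lt0r_neq0 (N_gt0 a b0).
have N02 : N 0 a b * N 0 a b != 0 by rewrite mulf_neq0.
have dF0 := dF (k := 0) a isT b0; have dF1 := dF (k := 1) a isT b0.
have dN0 := dN (k := 0) a isT b0; have dN1 := dN (k := 1) a isT b0.
have e1 := @is_derive_div _ (F 1 ^~ b) (N 0 ^~ b) a _ _ N0 dF1 dN0.
have e2 := @is_derive_div _ ((F 0 ^~ b) * (N 1 ^~ b)) ((N 0 ^~ b) * (N 0 ^~ b)) a _ _ N02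
  (is_deriveM dF0 dN1) (is_deriveM dN0 dN0).
have -> : posterior_a ^~ b = (fun q => F 1 q b / N 0 q b) -
    (fun q => ((F 0 ^~ b) * (N 1 ^~ b)) q / ((N 0 ^~ b) * (N 0 ^~ b)) q).
  by apply/funext.
apply: (is_derive_eq (is_deriveB e1 e2)).
rewrite /posterior_aa /GRing.scale /= !mulrfctE /=; by field.
Qed.

Lemma is_derive_posterior_curve (al be dal dbe : R -> R) (u v s A B : R) :
  0 < B -> u < s < v ->
  (forall r : R, u < r < v -> is_derive r 1 al (dal r)) ->
  (forall r : R, u < r < v -> is_derive r 1 be (dbe r)) ->
  (forall r, u < r < v -> [/\ `|al r| <= A, B <= be r, `|dal r| <= A & `|dbe r| <= A]) ->
  is_derive s 1 (fun r => posterior f (al r) (be r))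
    (dal s * posterior_a (al s) (be s) + dbe s * posterior_b (al s) (be s)).
Proof.
move=> B0 suv dal_ dbe_ bnd.
have [_ Bs _ _] := bnd _ suv; have b0 : 0 < be s by exact: lt_le_trans Bs.
have N0 := lt0r_neq0 (N_gt0 (al s) b0).
have dF0 := tilted_curve P mX (growthF (isT : (0 < 2)%N)) B0 suv dal_ dbe_ bnd.
have dN0 := tilted_curve P mX (growthN (isT : (0 < 2)%N)) B0 suv dal_ dbe_ bnd.
have sq (g : R -> R) : (fun x => x ^+ 2 * (x ^+ 0 * g x)) = (fun x => x ^+ 2 * g x).
  by apply/funext => x; rewrite expr0 mul1r.
rewrite step sq in dF0; rewrite step sq in dN0.
apply: (near_eq_is_derive (f := fun r => F 0 (al r) (be r) / N 0 (al r) (be r))).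
  have sI : s \in `]u, v[ by rewrite in_itv.
  apply: filterS (near_in_itvoo sI) => r; rewrite in_itv/= => /bnd[_ Br _ _].
  by rewrite posteriorE// (lt_le_trans B0).
apply: (is_derive_eq (@is_derive_div _ (fun r => F 0 (al r) (be r))
  (fun r => N 0 (al r) (be r)) s _ _ N0 dF0 dN0)).
by rewrite /posterior_a /posterior_b -/(F 1 _ _) -/(N 1 _ _) -/(F 2 _ _) -/(N 2 _ _)
  -/(F 0 _ _) -/(N 0 _ _); field.
Qed.

End PosteriorDerivative.

(** * The partial differential equation *)

Section Discount.
Context (R : realType).
Variable psi : R -> R.
Hypothesis cpsi : continuous psi.

Definition discount (t : R) : R := expR (- \int[lebesgue_measure]_(s in `[t, 1]) psi s).

Let ipsi : lebesgue_measure.-integrable `[0, 1] (EFin \o psi).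
Proof.
apply: continuous_compact_integrable; first exact: segment_compact.
exact: continuous_subspaceT.
Qed.

Lemma is_derive_discount (t : R) : 0 < t < 1 -> is_derive t 1 discount (psi t * discount t).
Proof.
move=> /andP[t0 t1].
pose H r := \int[lebesgue_measure]_(s in `[0, 1]) psi s
  - \int[lebesgue_measure]_(s in `[0, r]) psi s.
have e r : 0 < r -> r < 1 -> \int[lebesgue_measure]_(s in `[r, 1]) psi s = H r.
  move=> r0 r1; have r01 : `]r, 1] `<=` `[0, 1]%classic.
    by move=> x /=; rewrite !in_itv/= => /andP[rx ->]; rewrite (ltW (lt_trans r0 rx)).
  rewrite /H Rintegral_itvB ?bnd_simp ?ltW// Rintegral_itv_obnd_cbnd//.
  by apply: integrableS ipsi.
have ct : {for t, continuous psi} by exact: cpsi.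
have [dH dHE] := @continuous_FTC1_closed _ psi 0 t 1 t1 ipsi t0 ct.
have dHt : is_derive t 1 (fun r => \int[lebesgue_measure]_(s in `[0, r]) psi s) (psi t).
  by apply: DeriveDef; [exact: dH|rewrite -derive1E; exact: dHE].
have dh : is_derive t 1 (fun r => - H r) (psi t).
  apply: (is_derive_eq (is_deriveN (is_deriveB (is_derive_cst _ t 1) dHt))).
  by rewrite sub0r opprK.
have de := @is_derive1_comp _ expR (fun r => - H r) t _ _ (is_derive_expR _) dh.
apply: (near_eq_is_derive (f := expR \o (fun r => - H r))).
  have tI : t \in `]0, 1[ by rewrite in_itv/= t0.
  apply: filterS (near_in_itvoo tI) => r; rewrite in_itv/= => /andP[r0 r1].
  by rewrite /discount e.
by apply: (is_derive_eq de); rewrite /discount e// mulrC.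
Qed.

Lemma discount1 : discount 1 = 1.
Proof. by rewrite /discount set_itv1 Rintegral_set1 oppr0 expR0. Qed.

End Discount.

Section Value.
Context (R : realType) (d : measure_display) (T : measurableType d).
Variables (P : probability T R) (X : T -> R).
Hypothesis mX : measurable_fun setT X.
Variables (psi f c : R -> R).
Hypothesis cpsi : continuous psi.
Hypothesis mf : measurable_fun setT f.
Hypothesis bf : exists M, forall x, `|f x| <= M.
Variables (a0 b0 k : R).
Hypothesis b0_ge0 : 0 <= b0.
Hypothesis k_ge0 : 0 <= k.
Local Notation posterior := (posterior P X).
Local Notation D := (discount psi).

(** The signal and the precision when the past information has signal [a0] and
    precision [b0] and the active sources have effective information [y] with
    precision [k]. *)
Definition current_signal (y t : R) : R := a0 + k * y / (1 - t).
Definition current_precision (t : R) : R := b0 + k * t / (1 - t).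

Definition value (y t : R) : R :=
  if t == 1 then c y else D t * posterior f (current_signal y t) (current_precision t).

Local Notation al := current_signal.
Local Notation be := current_precision.
Local Notation Pa := (posterior_a P X f).
Local Notation Pb := (posterior_b P X f).
Local Notation Paa := (posterior_aa P X f).

Lemma current_precision_gt0 t : 0 < t < 1 -> 0 < k -> 0 < be t.
Proof.
move=> /andP[t0 t1] k0; rewrite ltr_pwDr// divr_gt0 ?mulr_gt0// subr_gt0//.
Qed.

Lemma is_derive_value_t (y t : R) : 0 < t < 1 ->
  is_derive t 1 (value y)
    (psi t * value y t + D t * (k * y / (1 - t) ^+ 2 * Pa (al y t) (be t) +
                                 k / (1 - t) ^+ 2 * Pb (al y t) (be t))).
Proof.
move=> t01; have /andP[t0 t1] := t01.
have dD := is_derive_discount cpsi t01.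
suff dG : is_derive t 1 (fun r => posterior f (al y r) (be r))
    (k * y / (1 - t) ^+ 2 * Pa (al y t) (be t) + k / (1 - t) ^+ 2 * Pb (al y t) (be t)).
  apply: (near_eq_is_derive (f := D * (fun r => posterior f (al y r) (be r)))).
    have tI : t \in `]0, 1[ by rewrite in_itv/= t0.
    apply: filterS (near_in_itvoo tI) => r; rewrite in_itv/= => /andP[r0 r1].
    by rewrite /value lt_eqF.
  apply: (is_derive_eq (is_deriveM dD dG)).
  by rewrite /value lt_eqF// /GRing.scale/=; ring.
have [k0|k0] := eqVneq k 0.
  have -> : (fun r => posterior f (al y r) (be r)) = cst (posterior f a0 b0).
    by apply/funext => r; rewrite /al /be k0 !mul0r !addr0.
  by apply: (is_derive_eq (is_derive_cst _ t 1)); rewrite k0 !mul0r addr0.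
have {}k0 : 0 < k by rewrite lt_neqAle eq_sym k0.
pose u := t / 2; pose v := (1 + t) / 2.
have tuv : u < t < v by rewrite /u /v; apply/andP; split; lra.
have uv r : u < r < v -> [/\ 0 < r, 0 < (1 - t) / 2 & (1 - t) / 2 <= 1 - r].
  by rewrite /u /v => /andP[ur rv]; split; lra.
pose q := 2 / (1 - t).
have q0 : 0 < q by rewrite divr_gt0// subr_gt0.
have invq r : u < r < v -> 0 < (1 - r)^-1 <= q.
  move=> /uv[_ h1 h2]; have h3 : 0 < 1 - r by exact: lt_le_trans h2.
  rewrite invr_gt0 h3/= /q -[2 / _]invrK invf_div lef_pV2 ?posrE//.
(* Explicit bounds on the curve and its derivatives between [u] and [v], where
   [1 - r] stays above half of [1 - t]. *)
pose A := `|a0| + k * `|y| * q + k * `|y| * q ^+ 2 + k * q ^+ 2.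
pose B := k * u.
have B0 : 0 < B by rewrite mulr_gt0// /u; lra.
have dinv r : u < r < v -> is_derive r 1 (fun r => (1 - r)^-1) ((1 - r) ^- 2).
  move=> ruv; have [_ h1 h2] := uv r ruv.
  have h3 : 1 - r != 0 by rewrite gt_eqF// (lt_le_trans h1).
  have e : is_derive r 1 (fun r => 1 - r) (-1).
    by apply: (is_derive_eq (is_deriveB (is_derive_cst (1:R) r 1) (is_derive_id r 1))); rewrite sub0r.
  by apply: (is_derive_eq (@is_deriveV _ (fun r => 1 - r) r _ _ h3 e)); rewrite /GRing.scale/= mulrN1 opprK.
have dal r : u < r < v -> is_derive r 1 (al y) (k * y / (1 - r) ^+ 2).
  move=> ruv; have di := dinv r ruv.
  have e := is_deriveD (is_derive_cst a0 r 1) (is_deriveM (is_derive_cst (k * y) r 1) di).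
  by apply: (is_derive_eq e); rewrite /GRing.scale/=; ring.
have dbe r : u < r < v -> is_derive r 1 be (k / (1 - r) ^+ 2).
  move=> ruv; have di := dinv r ruv; have [_ h1 h2] := uv r ruv.
  have h3 : 1 - r != 0 by rewrite gt_eqF// (lt_le_trans h1).
  have e := is_deriveD (is_derive_cst b0 r 1) (is_deriveM
    (is_deriveM (is_derive_cst k r 1) (is_derive_id r 1)) di).
  by apply: (is_derive_eq e); rewrite /GRing.scale/= !mulrfctE/= /cst; field.
have bnd r : u < r < v -> [/\ `|al y r| <= A, B <= be r,
    `|k * y / (1 - r) ^+ 2| <= A & `|k / (1 - r) ^+ 2| <= A].
  move=> ruv; have [r0 h1 h2] := uv r ruv; have /andP[i0 iq] := invq r ruv.
  have ky0 : 0 <= k * `|y| by rewrite mulr_ge0.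
  have p1 : 0 <= k * `|y| * q by rewrite mulr_ge0// ltW.
  have p2 : 0 <= k * `|y| * q ^+ 2 by rewrite mulr_ge0// sqr_ge0.
  have p3 : 0 <= k * q ^+ 2 by rewrite mulr_ge0// sqr_ge0.
  have i2 : 0 <= (1 - r) ^- 2 <= q ^+ 2.
    rewrite -exprVn sqr_ge0 ler_pXn2r// nnegrE; exact: ltW.
  have nk : `|k| = k by rewrite ger0_norm.
  have a0n := normr_ge0 a0.
  have /andP[i20 i2q] := i2; split.
  - apply: (le_trans (ler_normD _ _)); rewrite !normrM nk (gtr0_norm i0).
    have : k * `|y| * (1 - r)^-1 <= k * `|y| * q by rewrite ler_wpM2l.
    by rewrite /A; lra.
  - rewrite /B /be -[leLHS]add0r lerD// -mulrA ler_pM2l//.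
    have /andP[ur _] := ruv; apply: (@le_trans _ _ (r * 1)); first by rewrite mulr1 ltW.
    rewrite ler_pM2l// invf_ge1; first by rewrite gerBl ltW.
    exact: lt_le_trans h2.
  - rewrite !normrM nk (ger0_norm i20).
    have : k * `|y| * (1 - r) ^- 2 <= k * `|y| * q ^+ 2 by rewrite ler_wpM2l.
    by rewrite /A; lra.
  - rewrite !normrM nk (ger0_norm i20).
    have : k * (1 - r) ^- 2 <= k * q ^+ 2 by rewrite ler_wpM2l.
    by rewrite /A; lra.
exact: (is_derive_posterior_curve P mX mf bf B0 tuv dal dbe bnd).
Qed.

Let is_derive_al (y t : R) : is_derive y 1 (al ^~ t) (k / (1 - t)).
Proof.
have e := is_deriveD (is_derive_cst a0 y 1) (is_deriveM
  (is_deriveM (is_derive_cst k y 1) (is_derive_id y 1)) (is_derive_cst ((1 - t)^-1) y 1)).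
by apply: (is_derive_eq e); rewrite /GRing.scale/=; ring.
Qed.

Lemma is_derive_value_y (y t : R) : 0 < t < 1 ->
  is_derive y 1 (value ^~ t) (D t * (k / (1 - t)) * Pa (al y t) (be t)).
Proof.
move=> t01; have /andP[t0 t1] := t01.
have [k0|k0] := eqVneq k 0.
  have -> : value ^~ t = cst (D t * posterior f a0 b0).
    by apply/funext => x; rewrite /value (lt_eqF t1) /al /be k0 !mul0r !addr0.
  by apply: (is_derive_eq (is_derive_cst _ y 1)); rewrite k0 !(mul0r, mulr0).
have {}k0 : 0 < k by rewrite lt_neqAle eq_sym k0.
have -> : value ^~ t = cst (D t) * ((fun q => posterior f q (be t)) \o (al ^~ t)).
  by apply/funext => x; rewrite mulrfctE /value (lt_eqF t1).
have dp := is_derive_posterior_a P mX mf bf (al y t) (current_precision_gt0 t01 k0).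
have e := @is_derive1_comp _ (fun q => posterior f q (be t)) (al ^~ t) y _ _ dp (is_derive_al y t).
by apply: (is_derive_eq (is_deriveM (is_derive_cst (D t) y 1) e)); rewrite /GRing.scale/=; ring.
Qed.

Lemma derive1_value_y (t : R) : 0 < t < 1 ->
  derive1 (value ^~ t) = (fun y => D t * (k / (1 - t)) * Pa (al y t) (be t)).
Proof.
move=> t01; apply/funext => y; rewrite derive1E.
by have [_ ->] := is_derive_value_y y t01.
Qed.

Lemma is_derive_value_yy (y t : R) : 0 < t < 1 ->
  is_derive y 1 (derive1 (value ^~ t)) (D t * (k / (1 - t)) ^+ 2 * Paa (al y t) (be t)).
Proof.
move=> t01; rewrite (derive1_value_y t01).
have [k0|k0] := eqVneq k 0.
  rewrite (_ : (fun y => _) = cst 0); last by apply/funext => x; rewrite k0 !(mul0r, mulr0).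
  by apply: (is_derive_eq (is_derive_cst _ y 1)); rewrite k0 !(mul0r, mulr0) expr0n/= mulr0 mul0r.
have {}k0 : 0 < k by rewrite lt_neqAle eq_sym k0.
have dp := is_derive_posterior_aa P mX mf bf (al y t) (current_precision_gt0 t01 k0).
have e := @is_derive1_comp _ (fun q => Pa q (be t)) (al ^~ t) y _ _ dp (is_derive_al y t).
apply: (is_derive_eq (is_deriveM (is_derive_cst (D t * (k / (1 - t))) y 1) e)).
by rewrite /GRing.scale/=; ring.
Qed.

Lemma differentiable_value : differentiable_in_t_xi value.
Proof.
move=> y t t01; split.
- by have [] := is_derive_value_t y t01.
- by have [] := is_derive_value_y y t01.
- by have [] := is_derive_value_yy y t01.
Qed.

(** The chain rule: [current_signal] and [current_precision] carry the whole
    dependence on the effective information and on time. *)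
Lemma value_pdeE (y t mu sg lam : R) : 0 < t < 1 ->
  pde psi value y t mu sg 0 lam =
  (D t * (k / (1 - t) ^+ 2 * (y * Pa (al y t) (be t) + Pb (al y t) (be t)) +
    mu * (k / (1 - t)) * Pa (al y t) (be t) +
    sg ^+ 2 * (k / (1 - t)) ^+ 2 * Paa (al y t) (be t) / 2) = 0).
Proof.
move=> t01; rewrite /pde derive1nS derive1n1 !derive1E.
have [_ ->] := is_derive_value_t y t01; have [_ ->] := is_derive_value_y y t01.
have [_ ->] := is_derive_value_yy y t01; congr (_ = 0); rewrite mul0r addr0.
by ring.
Qed.

Lemma value_pde_active (y t m sg lam : R) : 0 < t < 1 -> 0 < k ->
  m = posterior id (al y t) (be t) -> sg ^+ 2 = k^-1 ->
  pde psi value y t ((m - y) / (1 - t)) sg 0 lam.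
Proof.
move=> t01 k0 mE sgE; rewrite value_pdeE// sgE.
have /andP[_ t1] := t01; have t10 : 1 - t != 0 by rewrite subr_eq0 gt_eqF.
have h := posterior_heat P mX f (al y t) (current_precision_gt0 t01 k0).
transitivity (D t * (k / (1 - t) ^+ 2) * (posterior id (al y t) (be t) * Pa (al y t) (be t) +
    Pb (al y t) (be t) + Paa (al y t) (be t) / 2)); last by rewrite h mulr0.
by rewrite -mE; field; rewrite t10 gt_eqF.
Qed.

Lemma value_pde_inactive (y t sg lam : R) : 0 < t < 1 -> k = 0 ->
  pde psi value y t 0 sg 0 lam.
Proof. by move=> t01 k0; rewrite value_pdeE// k0 !(mul0r, mulr0, addr0, expr0n)/=. Qed.

End Value.

(** * The effective and the complementary information *)

Section Information.
Context (R : realType) (d : measure_display) (Omega : measurableType d).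
Variables (P : probability Omega R) (n : nat) (X : {RV P >-> R}).
Variables (sigma : 'I_n -> R) (beta : 'I_n -> R -> {RV P >-> R}).
Variable J : 'I_n -> R -> Omega -> bool.
Hypothesis hsigma : forall i, 0 < sigma i.
Local Notation signal_at := (signal_at X sigma beta J).
Local Notation precision_at := (precision_at sigma J).
Local Notation xi := (xi X sigma beta).
Local Notation xi_hat := (xi_hat X sigma beta J).
Local Notation eta_fun := (eta_fun X sigma beta J).

Definition rate (A : {set 'I_n}) : R := \sum_(i in A) (sigma i) ^- 2.

(** The complementary information is the exponential of a quadratic function
    vanishing at 0; its values at 1 and -1 give back the coefficients. *)
Definition past_signal (e : R -> R) : R := (ln (e 1) - ln (e (-1))) / 2.
Definition past_precision (e : R -> R) : R := Num.max 0 (- (ln (e 1) + ln (e (-1)))).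

Lemma rate_ge0 A : 0 <= rate A.
Proof. by apply: sumr_ge0 => i _; rewrite invr_ge0 sqr_ge0. Qed.

Lemma rate_gt0 A : A != finset.set0 -> 0 < rate A.
Proof.
move=> /finset.set0Pn[i iA]; rewrite /rate (bigD1 i)//= ltr_pwDl//.
  by rewrite invr_gt0 exprn_gt0.
by apply: sumr_ge0 => j _; rewrite invr_ge0 sqr_ge0.
Qed.

Lemma rate0 : rate finset.set0 = 0.
Proof. by rewrite /rate big1// => i; rewrite inE. Qed.

Lemma rate_activeE t w : rate (active J t w) = \sum_i (J i t w)%:R * (sigma i) ^- 2.
Proof.
rewrite /rate [LHS]big_mkcond/=; apply: eq_bigr => i _.
by rewrite inE; case: (J i t w); rewrite ?mul1r ?mul0r.
Qed.

Lemma sigma_hat_sqr t w : active J t w != finset.set0 ->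
  sigma_hat sigma J t w ^+ 2 = (rate (active J t w))^-1.
Proof.
by move=> Ht; rewrite /sigma_hat Ht exprVn sqr_sqrtr// rate_ge0.
Qed.

(** When no source is active both sides are empty sums. *)
Lemma rate_xi_hat t w : rate (active J t w) * xi_hat t w =
  \sum_(i in active J t w) (sigma i) ^- 2 * xi i t w.
Proof.
have [e|ne] := eqVneq (active J t w) finset.set0.
  by rewrite e rate0 mul0r big1// => i; rewrite inE.
rewrite /Defs.xi_hat ne sigma_hat_sqr// mulrA divff ?mul1r//.
by rewrite gt_eqF// rate_gt0.
Qed.

Let past t w (x : R) : R := \sum_(i in (~: active J t w)%SET)
  (x * xi i (last_active J i t w) w - last_active J i t w * x ^+ 2 / 2) /
    (sigma i ^+ 2 * (1 - last_active J i t w)).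

Lemma ln_eta t w x : ln (eta_fun t w x) = past t w x.
Proof.
suff -> : eta_fun t w x = expR (past t w x) by rewrite expRK.
by rewrite /Defs.eta_fun /past expR_sum.
Qed.

Let split_active t w (h : 'I_n -> R) :
  \sum_i h i = \sum_(i in (~: active J t w)%SET) h i + \sum_(i in active J t w) h i.
Proof.
rewrite (bigID (fun i => i \in active J t w))/= addrC; congr (_ + _).
by apply: eq_bigl => i; rewrite !inE.
Qed.

Let onem_last i t w : 0 <= t < 1 -> 1 - last_active J i t w != 0.
Proof.
move=> /andP[t0 t1]; rewrite subr_eq0 gt_eqF//.
by apply: le_lt_trans t1; exact: last_active_le.
Qed.

(** Active sources contribute their present values, summed up in [xi_hat]; the
    others contribute the values at their last active times, which [eta_fun]
    retains. *)
Lemma signal_atE t w : 0 <= t < 1 ->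
  signal_at t w = current_signal (past_signal (eta_fun t w))
    (rate (active J t w)) (xi_hat t w) t.
Proof.
move=> t01; have /andP[t0 t1] := t01; have t10 : 1 - t != 0 by rewrite subr_eq0 gt_eqF.
rewrite /signal_at /total_signal (split_active t w) /current_signal; congr (_ + _).
  rewrite /past_signal !ln_eta /past -sumrB mulr_suml; apply: eq_bigr => i _.
  rewrite /source_weight; field.
  by rewrite (onem_last i w t01) gt_eqF.
rewrite rate_xi_hat mulr_suml; apply: eq_bigr => i; rewrite inE => Ji.
by rewrite (last_active_active t0 Ji) /source_weight mulrAC.
Qed.

Lemma past_precisionE t w : 0 <= t < 1 -> past_precision (eta_fun t w) =
  \sum_(i in (~: active J t w)%SET)
     source_weight sigma i (last_active J i t w) * last_active J i t w.
Proof.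
move=> t01; rewrite /past_precision !ln_eta.
have -> : - (past t w 1 + past t w (-1)) = \sum_(i in (~: active J t w)%SET)
     source_weight sigma i (last_active J i t w) * last_active J i t w.
  rewrite /past -big_split/= -sumrN; apply: eq_bigr => i _.
  rewrite /source_weight; field.
  by rewrite (onem_last i w t01) gt_eqF.
apply: max_r; apply: sumr_ge0 => i _; have /andP[t0 t1] := t01.
rewrite mulr_ge0 ?last_active_ge0// ltW// source_weight_gt0//.
by apply: le_lt_trans t1; exact: last_active_le.
Qed.

Lemma precision_atE t w : 0 <= t < 1 ->
  precision_at t w = current_precision (past_precision (eta_fun t w))
    (rate (active J t w)) t.
Proof.
move=> t01; have /andP[t0 t1] := t01.
rewrite /precision_at /total_precision (split_active t w) /current_precision.
rewrite (past_precisionE w t01); congr (_ + _).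
rewrite /rate mulr_suml mulr_suml; apply: eq_bigr => i; rewrite inE => Ji.
by rewrite (last_active_active t0 Ji) /source_weight mulrAC.
Qed.

End Information.

(** * The functional and its conditional expectations *)

Section Functional.
Context (R : realType) (d : measure_display) (Omega : measurableType d).
Variables (P : probability Omega R) (n : nat) (X : {RV P >-> R}).
Variables (sigma : 'I_n -> R) (beta : 'I_n -> R -> {RV P >-> R}).
Variable J : 'I_n -> R -> Omega -> bool.
Variable zeta : Omega -> seq {ffun 'I_n -> R}.
Hypothesis hX : (X : Omega -> R) \in Lfun P 2%:E.
Hypothesis hcomplete : P.-negligible `<=` measurable.
Hypothesis hsigma : forall i, 0 < sigma i.
Hypothesis hbeta : forall i, brownian_bridge (beta i).
Hypothesis hindep : mutually_independent P (source_algebra X beta).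
Hypothesis hJmeas : forall i t, 0 <= t <= 1 -> measurable_fun setT (J i t).
Hypothesis hJ : switches_at J zeta.
Hypothesis hJindep : independent P (state_algebra J) (signal_algebra X sigma beta).
Variables psi phi : R -> R.
Hypothesis mphi : measurable_fun setT phi.
Hypothesis bphi : exists M, forall x, `|phi x| <= M.

Local Notation E f := (\int[P]_w f w).
Local Notation xi := (xi X sigma beta).
Local Notation raw := (modulated_filtration_raw X sigma beta J).
Local Notation filt := (modulated_filtration P X sigma beta J).
Local Notation signal_at := (signal_at X sigma beta J).
Local Notation precision_at := (precision_at sigma J).
Local Notation xi_hat := (xi_hat X sigma beta J).
Local Notation eta_fun := (eta_fun X sigma beta J).

Let mX : measurable_fun setT X. Proof. exact: measurable_funPT. Qed.

Lemma augmentation_sigma_algebra t : sigma_algebra setT (filt t).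
Proof.
have S s : sigma_algebra setT <<s raw s `|` P.-negligible >> by exact: smallest_sigma_algebra.
split.
- by move=> s _; have [] := S s.
- by move=> A FA s st; have [_ C _] := S s; apply: C; exact: FA.
- by move=> A FA s st; have [_ _ U] := S s; apply: U => k; exact: FA.
Qed.

Lemma augmentation_negligible t : P.-negligible `<=` filt t.
Proof. by move=> A NA s _; apply: sub_gen_smallest; right. Qed.

Lemma augmentation_measurable t : filt t `<=` measurable.
Proof.
move=> A /(_ 1) FA; have {}FA : <<s raw 1 `|` P.-negligible >> A by apply: FA; right.
apply: g_sigma_algebra_measurable FA => B [|]; last exact: hcomplete.
by apply: raw_measurable; [exact: hJmeas|rewrite ler01 lexx].
Qed.

Let augmentation_gen t (f : Omega -> R) : t <= 1 ->
  (forall s, t <= s -> s <= 1 -> measurable_wrt (raw s) f) -> measurable_wrt (filt t) f.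
Proof.
move=> t1 H B mB s ts; apply: sub_gen_smallest; left; apply: H => //.
  by case: ts => [/andP[/ltW]|->].
by case: ts => [/andP[]|->].
Qed.

Lemma state_wrt t i u : t <= 1 -> 0 <= u <= t ->
  measurable_wrt (filt t) (fun w => (J i u w)%:R : R).
Proof.
move=> t1 /andP[u0 ut]; apply: augmentation_gen => // s ts s1; apply: measurable_wrt_gen.
by right; left; exists i, u; rewrite u0 (le_trans ut).
Qed.

Lemma modulated_wrt t i u : t <= 1 -> 0 <= u <= t ->
  measurable_wrt (filt t) (fun w => (J i u w)%:R * xi i u w).
Proof.
move=> t1 /andP[u0 ut]; apply: augmentation_gen => // s ts s1; apply: measurable_wrt_gen.
by left; exists i, u; rewrite u0 (le_trans ut).
Qed.

Lemma terminal_wrt t : t <= 1 -> measurable_wrt (filt t) (terminal_info X t).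
Proof.
move=> t1; apply: augmentation_gen => // s ts s1.
have [t1E|tN1] := eqVneq t 1.
  have s1E : s = 1 by apply/eqP; rewrite eq_le s1 -t1E.
  by apply: measurable_wrt_gen; right; right; rewrite /terminal_info t1E s1E.
apply: (measurable_wrt_ext (f := fun=> 0)).
  by move=> w; rewrite /terminal_info (negbTE tN1) mulr0.
by apply: measurable_wrt_cst; exact: sigma_gen_sigma_algebra.
Qed.

Section Time.
Variable t : R.
Hypothesis t01 : 0 <= t <= 1.
Let t0 : 0 <= t. Proof. by have /andP[] := t01. Qed.
Let t1 : t <= 1. Proof. by have /andP[] := t01. Qed.
Let sF : sigma_algebra setT (filt t). Proof. exact: augmentation_sigma_algebra. Qed.
Let FJ i u : 0 <= u <= t -> measurable_wrt (filt t) (fun w => (J i u w)%:R : R).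
Proof. exact: state_wrt. Qed.
Let Fxi i u : 0 <= u <= t -> measurable_wrt (filt t) (fun w => (J i u w)%:R * xi i u w).
Proof. exact: modulated_wrt. Qed.
Let tt : 0 <= t <= t. Proof. by rewrite t0 lexx. Qed.

Lemma rate_wrt H : sigma_algebra setT H ->
  (forall i, measurable_wrt H (fun w => (J i t w)%:R : R)) ->
  measurable_wrt H (fun w => rate sigma (active J t w)).
Proof.
move=> sH HJ; apply: (measurable_wrt_ext (f := fun w => \sum_i (J i t w)%:R * (sigma i) ^- 2)).
  by move=> w; rewrite rate_activeE.
apply: (measurable_wrt_sum sH) => i _.
by apply: (measurable_wrtM sH) => //; exact: (measurable_wrt_cst sH).
Qed.

Lemma xi_hat_wrt : measurable_wrt (filt t) (xi_hat t).
Proof.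
apply: (measurable_wrt_ext (f := fun w => (rate sigma (active J t w))^-1 *
    \sum_i (sigma i) ^- 2 * ((J i t w)%:R * xi i t w))).
  move=> w; have -> : \sum_i (sigma i) ^- 2 * ((J i t w)%:R * xi i t w) =
      rate sigma (active J t w) * xi_hat t w.
    rewrite rate_xi_hat// [RHS]big_mkcond; apply: eq_bigr => i _.
    by rewrite inE; case: (J i t w); rewrite ?mul1r// mul0r mulr0.
  have [e|ne] := eqVneq (active J t w) finset.set0.
    by rewrite e rate0 mul0r mulr0 /Defs.xi_hat e eqxx.
  by rewrite mulrA mulVf ?mul1r// gt_eqF// rate_gt0.
apply: (measurable_wrtM sF).
  apply: (measurable_wrt_comp (@measurable_invr R)); apply: rate_wrt => // i.
  exact: FJ.
apply: (measurable_wrt_sum sF) => i _; apply: (measurable_wrtM sF); last exact: Fxi.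
exact: (measurable_wrt_cst sF).
Qed.

Lemma eta_fun_wrt x : measurable_wrt (filt t) (fun w => eta_fun t w x).
Proof.
pose q i w : R := (x * xi i (last_active J i t w) w - last_active J i t w * x ^+ 2 / 2) /
  (sigma i ^+ 2 * (1 - last_active J i t w)).
have cst c : measurable_wrt (filt t) (fun=> c : R) by exact: (measurable_wrt_cst sF).
have Fq i : measurable_wrt (filt t) (q i).
  have FL := last_active_wrt hJ sF t01 (FJ i).
  have FX := xi_last_active_wrt hbeta hJ sF t01 (FJ i) (@augmentation_negligible t) (Fxi i).
  apply: (measurable_wrtM sF).
    apply: (measurable_wrtB sF); first by apply: (measurable_wrtM sF).
    by do 2! [apply: (measurable_wrtM sF); last exact: cst].
  apply: (measurable_wrt_comp (@measurable_invr R)); apply: (measurable_wrtM sF) => //.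
  by apply: (measurable_wrtB sF).
apply: (measurable_wrt_ext (f := expR \o (fun w => \sum_i (1 - (J i t w)%:R) * q i w))).
  move=> w /=; rewrite /Defs.eta_fun [RHS]big_mkcond expR_sum; apply: eq_bigr => i _.
  by rewrite !inE; case: (J i t w); rewrite ?subrr ?mul0r ?expR0// subr0 mul1r.
apply: (measurable_wrt_comp (@measurable_expR R)); apply: (measurable_wrt_sum sF) => i _.
by apply: (measurable_wrtM sF) => //; apply: (measurable_wrtB sF) => //; exact: FJ.
Qed.

Lemma sub_modulated : sigma_xi_eta_X X sigma beta J t `<=` filt t.
Proof.
apply: sigma_genP => // f [[[[i ->]|->]|[x ->]]|->].
- exact: FJ.
- exact: xi_hat_wrt.
- exact: eta_fun_wrt.
- exact: terminal_wrt.
Qed.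

End Time.

(** The argument [z] carries the terminal information, which matters at time 1
    only. *)
Definition functional (A : {set 'I_n}) (y : R) (e : R -> R) (z t : R) : R :=
  value P X psi phi (fun=> phi z) (past_signal e) (past_precision e) (rate sigma A) y t.

Definition functional_at (t : R) (w : Omega) : R :=
  functional (active J t w) (xi_hat t w) (eta_fun t w) (terminal_info X t w) t.

Lemma functional_atE t w : 0 <= t < 1 -> functional_at t w =
  discount psi t * posterior P X phi (signal_at t w) (precision_at t w).
Proof.
move=> t01; have /andP[_ t1] := t01.
rewrite (signal_atE X beta J hsigma w t01) (precision_atE X beta J hsigma w t01).
by rewrite /functional_at /functional /value (lt_eqF t1).
Qed.

Lemma functional_at1 w : functional_at 1 w = phi (X w).
Proof. by rewrite /functional_at /functional /value eqxx /terminal_info eqxx mulr1. Qed.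

Lemma functional_bound t : 0 <= t <= 1 -> exists M, forall w, `|functional_at t w| <= M.
Proof.
move=> /andP[t0]; rewrite le_eqVlt => /predU1P[->|t1]; have [M pM] := bphi.
  by exists M => w; rewrite functional_at1.
exists (discount psi t * M) => w; rewrite functional_atE ?t0// normrM.
by rewrite (ger0_norm (expR_ge0 _)) ler_wpM2l ?expR_ge0//; exact: posterior_bound.
Qed.

Let gen_info t : set (Omega -> R) :=
  gen_state J t `|` [set xi_hat t] `|` gen_eta X sigma beta J t.

Lemma signal_precision_wrt t : 0 <= t < 1 ->
  measurable_wrt (sigma_gen (gen_info t)) (signal_at t) /\
  measurable_wrt (sigma_gen (gen_info t)) (precision_at t).
Proof.
move=> t01; set H := sigma_gen _.
have sH : sigma_algebra setT H by exact: sigma_gen_sigma_algebra.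
have cst c : measurable_wrt H (fun=> c : R) by exact: (measurable_wrt_cst sH).
have Hy : measurable_wrt H (xi_hat t) by apply: measurable_wrt_gen; left; right.
have He x : measurable_wrt H (fun w => ln (eta_fun t w x)).
  apply: (measurable_wrt_comp (@measurable_ln R)); apply: measurable_wrt_gen.
  by right; exists x.
have Hr : measurable_wrt H (fun w => rate sigma (active J t w)).
  by apply: rate_wrt => // i; apply: measurable_wrt_gen; left; left; exists i.
split.
  apply: (measurable_wrt_ext (f := fun w => current_signal (past_signal (eta_fun t w))
    (rate sigma (active J t w)) (xi_hat t w) t)).
    by move=> w; rewrite signal_atE.
  apply: (measurable_wrtD sH).
    by apply: (measurable_wrtM sH) => //; exact: (measurable_wrtB sH).
  by apply: (measurable_wrtM sH) => //; exact: (measurable_wrtM sH).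
apply: (measurable_wrt_ext (f := fun w => current_precision (past_precision (eta_fun t w))
  (rate sigma (active J t w)) t)).
  by move=> w; rewrite (precision_atE X beta).
apply: (measurable_wrtD sH).
  apply: (@measurable_wrt_comp2 _ _ _ H sH (fun=> 0)
    (fun w => - (ln (eta_fun t w 1) + ln (eta_fun t w (-1)))) (fun z => Num.max z.1 z.2)) => //.
    by apply: measurable_maxr; [exact: measurable_fst|exact: measurable_snd].
  apply: (measurable_wrt_ext (f := fun w => 0 - (ln (eta_fun t w 1) + ln (eta_fun t w (-1))))).
    by move=> w; rewrite sub0r.
  by apply: (measurable_wrtB sH) => //; exact: (measurable_wrtD sH).
by apply: (measurable_wrtM sH) => //; exact: (measurable_wrtM sH).
Qed.

Lemma functional_wrt t : 0 <= t <= 1 ->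
  measurable_wrt (sigma_xi_eta_X X sigma beta J t) (functional_at t).
Proof.
move=> /andP[t0]; rewrite le_eqVlt => /predU1P[->|t1].
  apply: (measurable_wrt_ext (f := phi \o terminal_info X 1)).
    by move=> w; rewrite functional_at1 /= /terminal_info eqxx mulr1.
  by apply: (measurable_wrt_comp mphi); apply: measurable_wrt_gen; right.
have t01 : 0 <= t < 1 by rewrite t0.
have [Ha Hb] := signal_precision_wrt t01.
apply: (measurable_wrtS (F := sigma_gen (gen_info t))).
  apply: sigma_genP; first exact: sigma_gen_sigma_algebra.
  by move=> f fH; apply: measurable_wrt_gen; left.
have sH : sigma_algebra setT (sigma_gen (gen_info t)) by exact: sigma_gen_sigma_algebra.
apply: (measurable_wrt_ext (f := fun w => discount psi t *
    posterior P X phi (signal_at t w) (precision_at t w))).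
  by move=> w; rewrite functional_atE.
apply: (measurable_wrtM sH); first exact: (measurable_wrt_cst sH).
exact: (measurable_wrt_comp2 sH (@measurable_posterior _ _ _ P X mX phi mphi) Ha Hb).
Qed.

Lemma discounted_bounded t : bounded_measurable (discounted X psi phi t).
Proof.
apply: bounded_measurableM; first exact: bounded_measurable_cst.
exact: (bounded_measurable_comp mphi bphi mX).
Qed.

(** Before time 1 the functional is a discounted posterior; at time 1 it is the
    payoff. *)
Lemma functional_expect t A : 0 <= t <= 1 -> filt t A ->
  E (fun w => discounted X psi phi t w * \1_A w) = E (fun w => functional_at t w * \1_A w).
Proof.
move=> /andP[t0]; rewrite le_eqVlt => /predU1P[->|t1] FA.
  apply: eq_Rintegral => w _; rewrite functional_at1 /discounted.
  by rewrite -/(discount psi 1) discount1 mul1r.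
have t01 : 0 <= t < 1 by rewrite t0.
have t01' : 0 <= t <= 1 by rewrite t0 ltW.
have mA := augmentation_measurable FA.
have bA : bounded_measurable (\1_A : Omega -> R) by exact: bounded_measurable_indic.
have bX : bounded_measurable (fun w => phi (X w)) by exact: (bounded_measurable_comp mphi bphi mX).
have bp : bounded_measurable (fun w => posterior P X phi (signal_at t w) (precision_at t w)).
  split; first by apply: (posterior_at_measurable X sigma hcomplete hbeta hJmeas hJ).
  by have [M pM] := bphi; exists M => w; exact: posterior_bound.
have D1 (g : Omega -> R) : bounded_measurable g ->
    E (fun w => discount psi t * g w * \1_A w) = discount psi t * E (fun w => g w * \1_A w).
  move=> bg; under eq_Rintegral do rewrite -mulrA.
  by rewrite expectZ//; exact: bounded_measurableM.
transitivity (E (fun w => discount psi t * phi (X w) * \1_A w)); first by [].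
rewrite D1// (bayes_filtration hX hcomplete hsigma hbeta hindep hJmeas hJ hJindep t01 mphi bphi FA).
by rewrite -D1//; apply: eq_Rintegral => w _; rewrite functional_atE.
Qed.

Lemma functional_cond_exp t H : 0 <= t <= 1 -> H `<=` filt t ->
  measurable_wrt H (functional_at t) ->
  is_cond_exp P H (discounted X psi phi t) (functional_at t).
Proof.
move=> t01 HF Hv; apply: is_cond_exp_bounded => //.
- by move=> A /HF; exact: augmentation_measurable.
- exact: discounted_bounded.
- exact: functional_bound.
- by move=> A /HF; exact: functional_expect.
Qed.

(** Conditioning on less than the filtration suffices, as the signal and the
    precision are functions of the effective and complementary information. *)
Lemma mean_posterior t m : 0 <= t < 1 ->
  is_cond_exp P (sigma_xi_eta X sigma beta J t) X m ->
  {ae P, forall w, 0 < precision_at t w ->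
    m w = posterior P X id (signal_at t w) (precision_at t w)}.
Proof.
move=> t01 hm; have t01' : 0 <= t <= 1 by have /andP[-> /ltW] := t01.
have HF : sigma_xi_eta X sigma beta J t `<=` filt t.
  apply: (subset_trans _ (sub_modulated t01')).
  apply: sigma_genP; first exact: sigma_gen_sigma_algebra.
  by move=> f fH; apply: measurable_wrt_gen; left.
have [Ha Hb] := signal_precision_wrt t01.
apply: (cond_mean_posterior (F := sigma_xi_eta X sigma beta J t)) => //.
- exact: sigma_gen_sigma_algebra.
- by move=> A /HF; exact: augmentation_measurable.
move=> f A mf bf /HF FA.
exact: (bayes_filtration hX hcomplete hsigma hbeta hindep hJmeas hJ hJindep t01 mf bf FA).
Qed.

End Functional.

(** * The equation along the paths *)

Section FunctionalPDE.
Context (R : realType) (d : measure_display) (Omega : measurableType d).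
Variables (P : probability Omega R) (n : nat) (X : {RV P >-> R}).
Variables (sigma : 'I_n -> R) (beta : 'I_n -> R -> {RV P >-> R}).
Variable J : 'I_n -> R -> Omega -> bool.
Variable zeta : Omega -> seq {ffun 'I_n -> R}.
Hypothesis hsigma : forall i, 0 < sigma i.
Hypothesis hJ : switches_at J zeta.
Variables psi phi : R -> R.
Hypothesis cpsi : continuous psi.
Hypothesis mphi : measurable_fun setT phi.
Hypothesis bphi : exists M, forall x, `|phi x| <= M.

Local Notation xi := (xi X sigma beta).
Local Notation signal_at := (signal_at X sigma beta J).
Local Notation precision_at := (precision_at sigma J).
Local Notation xi_hat := (xi_hat X sigma beta J).
Local Notation eta_fun := (eta_fun X sigma beta J).
Local Notation functional_at := (functional_at X sigma beta J psi phi).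

Let mX : measurable_fun setT X. Proof. exact: measurable_funPT. Qed.

Lemma functional_at_left t w : 0 < t < 1 -> regular_noise beta w ->
  activation J t w = false -> functional_at s w @[s --> t^'-] --> functional_at t w.
Proof.
move=> t01 rw noact; have /andP[t0 t1] := t01.
have t01' : 0 <= t < 1 by rewrite ltW.
rewrite functional_atE//.
have cD : discount psi s @[s --> t^'-] --> discount psi t.
  apply: cvg_at_left_filter; apply: differentiable_continuous; apply/derivable1_diffP.
  by have [] := is_derive_discount cpsi t01.
apply: cvg_trans; last exact: (cvgM cD (posterior_left hsigma hJ t01 mphi bphi rw noact)).
apply: near_eq_cvg; near=> s; rewrite functional_atE//; apply/andP; split.
  by apply: ltW; near: s; exact: nbhs_left_gt.
by apply: lt_trans t1; near: s; exact: nbhs_left_lt.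
Unshelve. all: by end_near. Qed.

(** The condition on [m] is needed with some precision only: otherwise no
    source is active and the coefficients of the equation vanish. *)
Lemma value_pde_at (c : R -> R) (m : Omega -> R) t w lam : 0 < t < 1 ->
  (0 < precision_at t w -> m w = posterior P X id (signal_at t w) (precision_at t w)) ->
  pde psi (value P X psi phi c (past_signal (eta_fun t w)) (past_precision (eta_fun t w))
             (rate sigma (active J t w)))
    (xi_hat t w) t (drift X sigma beta J m t w) (sigma_hat sigma J t w) 0 lam.
Proof.
move=> t01 hm; have /andP[t0 t1] := t01.
have t01' : 0 <= t < 1 by rewrite ltW.
have b0 : 0 <= past_precision (eta_fun t w) by rewrite /past_precision le_max lexx.
have k0 := rate_ge0 sigma (active J t w).
rewrite /drift; have [e|ne] := eqVneq (active J t w) finset.set0.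
  by apply: value_pde_inactive => //; rewrite e rate0.
have k1 := rate_gt0 hsigma ne.
apply: value_pde_active => //; last exact: sigma_hat_sqr.
rewrite -(signal_atE X beta)// -(precision_atE X beta)//; apply: hm.
by rewrite (precision_atE X beta)// current_precision_gt0.
Qed.

End FunctionalPDE.

(** * Sources that stay active *)

Section StayActive.
Context (R : realType) (d : measure_display) (Omega : measurableType d).
Variables (P : probability Omega R) (n : nat) (X : {RV P >-> R}).
Variables (sigma : 'I_n -> R) (beta : 'I_n -> R -> {RV P >-> R}).
Variable J : 'I_n -> R -> Omega -> bool.
Hypothesis hsigma : forall i, 0 < sigma i.
Hypothesis hbeta : forall i, brownian_bridge (beta i).

Definition stays_active (w : Omega) : Prop :=
  (forall i t u, 0 <= t -> t <= u -> u <= 1 -> J i t w -> J i u w) /\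
  active J 0 w != finset.set0.

(** A source that is inactive now has never been active, so it has contributed
    its initial value 0 only. *)
Lemma eta_fun_eq1 t w : 0 <= t <= 1 -> stays_active w -> regular_noise beta w ->
  eta_fun X sigma beta J t w = (fun=> 1).
Proof.
move=> /andP[t0 t1] [mono _] rw; apply/funext => x.
rewrite /eta_fun big1// => i; rewrite !inE => nJ.
have -> : last_active J i t w = 0.
  rewrite /last_active (_ : [set _ | _] = set0) ?sup0 ?maxxx//.
  rewrite -subset0 => u /= [/andP[u0 ut] Ju]; move/negP: nJ; apply.
  exact: mono Ju.
by rewrite (xi0 X sigma i rw) /hker mulr0 !mul0r subrr mul0r expR0.
Qed.

Lemma past_signal1 : past_signal (fun=> 1 : R) = 0.
Proof. by rewrite /past_signal subrr mul0r. Qed.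

Lemma past_precision1 : past_precision (fun=> 1 : R) = 0.
Proof. by rewrite /past_precision ln1 addr0 oppr0 maxxx. Qed.

Lemma xi_hat1 : {ae P, forall w, stays_active w -> xi_hat X sigma beta J 1 w = X w}.
Proof.
have : {ae P, forall w, forall i, beta i 1 w = 0}.
  apply: filter_forall => i; apply: (bridge_pinned hbeta); last by rewrite mulr1.
  by rewrite ler01 lexx.
apply: filterS => w b1 [mono ne0].
have ne : active J 1 w != finset.set0.
  have /finset.set0Pn[i] := ne0; rewrite inE => Ji.
  by apply/finset.set0Pn; exists i; rewrite inE (mono i 0 1).
have k0 := rate_gt0 hsigma ne.
have := rate_xi_hat X beta J hsigma 1 w.
rewrite (eq_bigr (fun i => sigma i ^- 2 * X w)); last first.
  by move=> i _; rewrite /xi b1 mulr0 addr0 mul1r.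
rewrite -mulr_suml => e; apply: (mulfI (lt0r_neq0 k0)); exact: e.
Qed.

Variables psi phi : R -> R.

(** The functional without complementary information; at time 1 the effective
    information is the signal itself. *)
Definition functional2 (A : {set 'I_n}) (y t : R) : R :=
  value P X psi phi phi 0 0 (rate sigma A) y t.

Lemma functional2_at : {ae P, forall w, stays_active w -> forall t, 0 <= t <= 1 ->
  functional2 (active J t w) (xi_hat X sigma beta J t w) t =
  functional_at X sigma beta J psi phi t w}.
Proof.
apply: filterS2 (ae_regular_noise hbeta) xi_hat1 => w rw x1 sw t t01.
rewrite /functional_at /functional (eta_fun_eq1 t01 sw rw) past_signal1 past_precision1.
rewrite /functional2 /value; case: ifP => // /eqP ->.
by rewrite x1// /terminal_info eqxx mulr1.
Qed.

Hypothesis mphi : measurable_fun setT phi.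
Hypothesis bphi : exists M, forall x, `|phi x| <= M.

Lemma functional2_wrt t : measurable_wrt (sigma_xi X sigma beta J t)
  (fun w => functional2 (active J t w) (xi_hat X sigma beta J t w) t).
Proof.
have mX : measurable_fun setT X by exact: measurable_funPT.
set H := sigma_xi _ _ _ _ _.
have sH : sigma_algebra setT H by exact: sigma_gen_sigma_algebra.
have cst c : measurable_wrt H (fun=> c : R) by exact: (measurable_wrt_cst sH).
have Hy : measurable_wrt H (xi_hat X sigma beta J t) by apply: measurable_wrt_gen; right.
have Hr : measurable_wrt H (fun w => rate sigma (active J t w)).
  by apply: rate_wrt => // i; apply: measurable_wrt_gen; left; exists i.
rewrite /functional2 /value; case: (t == 1); first exact: (measurable_wrt_comp mphi).
apply: (measurable_wrtM sH) => //.
have Ha : measurable_wrt H (fun w => current_signal 0 (rate sigma (active J t w))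
    (xi_hat X sigma beta J t w) t).
  apply: (measurable_wrtD sH) => //.
  by apply: (measurable_wrtM sH) => //; exact: (measurable_wrtM sH).
have Hb : measurable_wrt H (fun w => current_precision 0 (rate sigma (active J t w)) t).
  apply: (measurable_wrtD sH) => //.
  by apply: (measurable_wrtM sH) => //; exact: (measurable_wrtM sH).
exact: (measurable_wrt_comp2 sH (@measurable_posterior _ _ _ P X mX phi mphi) Ha Hb).
Qed.

Lemma functional2_bound t : exists M, forall A y, `|functional2 A y t| <= M.
Proof.
have mX : measurable_fun setT X by exact: measurable_funPT.
have [M pM] := bphi; exists (M + discount psi t * M) => A y.
have M0 : 0 <= M := le_trans (normr_ge0 _) (pM 0).
have D0 : 0 <= discount psi t by exact: expR_ge0.
rewrite /functional2 /value; case: ifP => _.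
  by apply: (le_trans (pM y)); rewrite lerDl mulr_ge0.
rewrite normrM (ger0_norm D0); apply: (@le_trans _ _ (discount psi t * M)).
  by rewrite ler_wpM2l//; exact: posterior_bound.
by rewrite lerDr.
Qed.

End StayActive.


Unset Implicit Arguments.

Theorem proposition2p18 (R : realType) (d : measure_display)
    (Omega : measurableType d) (P : probability Omega R)
    (G : R -> set (set Omega)) (hG : usual_filtration P G)
    (n : nat) (hn : (0 < n)%N)
    (X : {RV P >-> R}) (hX : (X : Omega -> R) \in Lfun P 2%:E)
    (sigma : 'I_n -> R) (hsigma : forall i, 0 < sigma i)
    (beta : 'I_n -> R -> {RV P >-> R})
    (hbeta : forall i, brownian_bridge (beta i))
    (hindep : mutually_independent P
       (fun k : option 'I_n =>
          if k is Some i
          then sigma_gen [set f | exists t, 0 <= t <= 1 /\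
                                    f = (beta i t : Omega -> R)]
          else sigma_gen [set (X : Omega -> R)]))
    (zeta : Omega -> seq {ffun 'I_n -> R}) (hzeta : random_point_field zeta)
    (J : 'I_n -> R -> Omega -> bool)
    (hJmeas : forall i t, 0 <= t <= 1 -> measurable_fun setT (J i t))
    (hJ : switches_at J zeta)
    (hJindep : independent P
       (sigma_gen [set f | exists i t, 0 <= t <= 1 /\
                             f = (fun w => (J i t w)%:R : R)])
       (sigma_gen ([set f | exists i t, 0 <= t <= 1 /\
                              f = xi X sigma beta i t]
                   `|` [set (X : Omega -> R)])))
    (lambda : R -> Omega -> R)
    (hlambda : activation_intensity P X sigma beta J lambda)
    (psi phi : R -> R)
    (hpsi : continuous psi) (hpsib : [bounded psi x | x in [set: R]])
    (hphi : continuous phi) (hphib : [bounded phi x | x in [set: R]]) :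
  (* the arguments of v are the state, xi_hat_t, eta_t, X 1_{t=1}, t *)
  (exists v : {set 'I_n} -> R -> (R -> R) -> R -> R -> R,
     let vt t w := v (active J t w) (xi_hat X sigma beta J t w)
                     (eta_fun X sigma beta J t w) (terminal_info X t w) t in
     [/\ forall t, 0 <= t <= 1 ->
           is_cond_exp P (modulated_filtration P X sigma beta J t)
             (discounted X psi phi t) (vt t),
         forall t, 0 <= t <= 1 ->
           is_cond_exp P (sigma_xi_eta_X X sigma beta J t)
             (discounted X psi phi t) (vt t),
         forall A e, differentiable_in_t_xi (fun y t => v A y e 0 t),
         forall t, 0 < t < 1 -> forall m : Omega -> R,
           is_cond_exp P (sigma_xi_eta X sigma beta J t) X m ->
           {ae P, forall w, exists l : R,
              (fun s => vt s w) @ t^'- --> l /\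
              pde psi
                (fun y s => v (active J t w) y (eta_fun X sigma beta J t w) 0 s)
                (xi_hat X sigma beta J t w) t
                (drift X sigma beta J m t w) (sigma_hat sigma J t w)
                (vt t w - l) (lambda t w)}
       & {ae P, forall w, vt 1 w = phi (X w)}])
  /\
  (* the arguments of v are the state, xi_hat_t, t *)
  ({ae P, forall w i t u, 0 <= t -> t <= u -> u <= 1 -> J i t w -> J i u w} ->
   {ae P, forall w, active J 0 w != finset.set0} ->
   exists v : {set 'I_n} -> R -> R -> R,
     let vt t w := v (active J t w) (xi_hat X sigma beta J t w) t in
     [/\ forall t, 0 <= t <= 1 ->
           is_cond_exp P (sigma_xi X sigma beta J t)
             (discounted X psi phi t) (vt t),
         forall A, differentiable_in_t_xi (v A),
         forall t, 0 < t < 1 -> forall m : Omega -> R,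
           is_cond_exp P (sigma_xi_eta X sigma beta J t) X m ->
           {ae P, forall w, exists l : R,
              (fun s => vt s w) @ t^'- --> l /\
              pde psi (fun y s => v (active J t w) y s)
                (xi_hat X sigma beta J t w) t
                (drift X sigma beta J m t w) (sigma_hat sigma J t w)
                (vt t w - l) (lambda t w)}
       & {ae P, forall w, vt 1 w = phi (X w)}]).
Proof.
have hcomplete : P.-negligible `<=` measurable.
  have [sub _ _ neg] := hG; have [_ m] := sub 0 (lexx 0).
  by move=> A /(neg 0 (lexx 0)); exact: m.
have mphi : measurable_fun setT phi by exact: continuous_measurable_fun.
have bphi : exists M, forall x, `|phi x| <= M.
  have [M [_ HM]] := hphib; exists (M + 1) => x.
  by apply: (HM (M + 1)) => //; rewrite ltrDl.
have noact t : 0 < t < 1 -> {ae P, forall w, activation J t w = false}.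
  move=> /andP[t0 t1]; have [_ _ hint hM] := hlambda.
  apply: (ae_no_activation hJ hcomplete _ hint hM); last by rewrite t0 ltW.
  by move=> s _; exact: (augmentation_measurable hcomplete hJmeas).
have reg := ae_regular_noise hbeta.
have mean t m : 0 < t < 1 -> is_cond_exp P (sigma_xi_eta X sigma beta J t) X m ->
    {ae P, forall w, 0 < precision_at sigma J t w -> m w =
      posterior P X id (signal_at X sigma beta J t w) (precision_at sigma J t w)}.
  move=> /andP[t0 t1]; apply: (mean_posterior hX hcomplete hsigma hbeta hindep hJmeas hJ hJindep).
  by rewrite ltW.
have info t : 0 <= t <= 1 ->
    sigma_xi_eta_X X sigma beta J t `<=` modulated_filtration P X sigma beta J t.
  by move=> t01; exact: (sub_modulated hsigma hbeta hJ t01).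
split.
  exists (functional X sigma psi phi); split.
  - move=> t t01; apply: (functional_cond_exp hX hcomplete hsigma hbeta hindep hJmeas hJ hJindep) => //.
    by apply: measurable_wrtS (info t t01) _; exact: functional_wrt.
  - move=> t t01; apply: (functional_cond_exp hX hcomplete hsigma hbeta hindep hJmeas hJ hJindep) => //.
      exact: info.
    exact: functional_wrt.
  - move=> A e; apply: differentiable_value => //; last exact: rate_ge0.
    by rewrite /past_precision le_max lexx.
  - move=> t t01 m hm; apply: filterS3 reg (noact t t01) (mean t m t01 hm) => w rw na mw.
    exists (functional_at X sigma beta J psi phi t w); split.
      exact: (functional_at_left hsigma hJ hpsi mphi bphi t01 rw na).
    by rewrite subrr; exact: (value_pde_at hsigma hpsi mphi bphi).
  - by apply: aeW => w; exact: functional_at1.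
move=> mono act.
have sw : {ae P, forall w, stays_active J w} by apply: filterS2 mono act => w ? ?.
have agree := functional2_at X J hsigma hbeta psi phi.
exists (functional2 X sigma psi phi); split.
- move=> t t01.
  have HF : sigma_xi X sigma beta J t `<=` modulated_filtration P X sigma beta J t.
    apply: (subset_trans _ (info t t01)).
    apply: sigma_genP; first exact: sigma_gen_sigma_algebra.
    by move=> f fH; apply: measurable_wrt_gen; left; left.
  have mF : modulated_filtration P X sigma beta J t `<=` measurable.
    exact: (augmentation_measurable hcomplete hJmeas).
  have mH : sigma_xi X sigma beta J t `<=` measurable by move=> A /HF; exact: mF.
  have H2 : measurable_wrt (sigma_xi X sigma beta J t)
      (fun w => functional2 X sigma psi phi (active J t w) (xi_hat X sigma beta J t w) t).
    exact: functional2_wrt.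
  apply: is_cond_exp_bounded => //.
  + exact: discounted_bounded.
  + by have [M HM] := functional2_bound X sigma psi mphi bphi t; exists M => w; exact: HM.
  + move=> A HA.
    transitivity (\int[P]_w (functional_at X sigma beta J psi phi t w * \1_A w)).
      apply: (functional_expect hX hcomplete hsigma hbeta hindep hJmeas hJ hJindep) => //.
      exact: HF.
    have mA := mH _ HA.
    apply: expect_ae.
    * apply: measurable_funM; last exact: measurable_indic.
      have mI : sigma_xi_eta_X X sigma beta J t `<=` measurable by move=> B /(info t t01); exact: mF.
      by apply: (measurable_wrt_measurable mI); exact: functional_wrt.
    * apply: measurable_funM; last exact: measurable_indic.
      exact: (measurable_wrt_measurable mH).
    * by apply: filterS2 agree sw => w aw /aw/(_ t t01) <-.
- by move=> A; apply: differentiable_value => //; exact: rate_ge0.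
- move=> t t01 m hm; have /andP[t0 t1] := t01.
  apply: filterS3 (filterI reg agree) (filterI sw (noact t t01)) (mean t m t01 hm).
  move=> w [rw aw] [sww na] mw; have {}aw := aw sww.
  have t01' : 0 <= t <= 1 by rewrite !ltW.
  exists (functional_at X sigma beta J psi phi t w); split.
    apply: cvg_trans (functional_at_left hsigma hJ hpsi mphi bphi t01 rw na).
    apply: near_eq_cvg; near=> s; rewrite aw//; apply/andP; split.
      by apply: ltW; near: s; exact: nbhs_left_gt.
    by apply: ltW; apply: lt_trans t1; near: s; exact: nbhs_left_lt.
  rewrite aw// subrr.
  have := value_pde_at hsigma hpsi mphi bphi phi (lambda t w) t01 mw.
  by rewrite (eta_fun_eq1 X sigma t01' sww rw) past_signal1 past_precision1.
- have o1 : 0 <= (1 : R) <= 1 by rewrite ler01 lexx.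
  apply: filterS2 agree sw => w aw /aw/(_ 1 o1) ->; exact: functional_at1.
Unshelve. all: by end_near. Qed.
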